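(* Let $2\le k\le n$ and $d=\gcd(k-1,n)$. The map $T_k$ is completely integrable on the $2n$-dimensional $(\mathbf x,\mathbf y)$-space. That is, there exists a $T_k$-invariant Poisson bracket on the $(\mathbf x,\mathbf y)$-space (for $n\ge 2k-1$ it is the bracket $\{\cdot,\cdot\}$ written in the context), of rank $2(n-d)$ at generic points, such that the functions $I_{ij}(\mathbf x,\mathbf y)$ are invariant under $T_k$, pairwise Poisson-commute, and form a maximal involutive family: among them there are $n+d=2n-\tfrac12\cdot 2(n-d)$ functionally independent functions.
   Context: Let $n\ge 2$ and $2\le k\le n$ be integers; $\mathbf x=(x_1,\dots,x_n)$, $\mathbf y=(y_1,\dots,y_n)$ are real independent variables, all indices are taken mod $n$. Put $r=\lfloor k/2\rfloor-1$ and $r'=k-2-r$. The rational map $T_k:(\mathbf x,\mathbf y)\mapsto(\mathbf x^*,\mathbf y^* )$ is $$x_i^*=x_{i-r'-1}\frac{x_{i+r}+y_{i+r}}{x_{i-r'-1}+y_{i-r'-1}},\qquad y_i^*=y_{i-r'}\frac{x_{i+r+1}+y_{i+r+1}}{x_{i-r'}+y_{i-r'}}.$$ The functions $I_{ij}$: for $k=2$ let $L_i(\lambda)=\begin{pmatrix}-\lambda x_i & x_i+y_i\\ -\lambda & 1\end{pmatrix}$; for $k\ge 3$ let $L_i(\lambda)$ be the $k\times k$ matrix whose only nonzero entries are: $(1,k-1)$ entry $x_i$; $(1,k)$ entry $x_i+y_i$; $(2,1)$ entry $-\lambda$; $(j,j-1)$ entry $1$ for $3\le j\le k$; $(k,k)$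 entry $1$. Put $M_{k,n}(\lambda)=L_1(\lambda)\cdots L_n(\lambda)$ and define $I_{ij}$ by $\det(I_k+zM_{k,n}(\lambda))=\sum_{i,j}I_{ij}(\mathbf x,\mathbf y)\lambda^iz^j$. The bracket for $n\ge 2k-1$ (indices mod $n$, only nonzero brackets of coordinates listed, up to skew-symmetry): $$\{x_i,x_{i+l}\}=-x_ix_{i+l}\ (1\le l\le k-2),\qquad \{y_i,y_{i+l}\}=-y_iy_{i+l}\ (1\le l\le k-1),$$ $$\{y_i,x_{i+l}\}=-y_ix_{i+l}\ (1\le l\le k-1),\qquad \{y_i,x_{i-l}\}=y_ix_{i-l}\ (0\le l\le k-2).$$ A Poisson bracket is $T_k$-invariant if $\{f\circ T_k,g\circ T_k\}=\{f,g\}\circ T_k$ for all $f,g$. Functions are functionally independent if their differentials are linearly independent at generic points. Complete integrability of a map means: existence of an invariant Poisson bracket and of a maximal family of integrals in involution, i.e. on a space of dimension $N$ with a bracket of rank $2s$, of $N-s$ functionally independent Poisson-commuting invariant functions. *)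

(* Defs.v *)
From HB Require Import structures.
From mathcomp Require Import all_boot all_order all_algebra.
From mathcomp Require Import fraction.
From mathcomp Require Import reals.
From mathcomp Require Import mpoly.

Set Implicit Arguments.
Unset Strict Implicit.
Unset Printing Implicit Defensive.

Import GRing.Theory.
Local Open Scope ring_scope.

(* The notation of fraction.v, which does not export it. *)
Notation "p %:F" := (FracField.tofrac p) : ring_scope.

(** The map T_k is rational, so its action on functions, and the Poisson
    brackets, are considered on the field of rational functions in the N
    coordinates; a polynomial is embedded in it by %:F.  Such a bracket is
    determined by the brackets of the coordinates, as it is a biderivation
    vanishing on constants. *)

Definition ratfun (R : realType) (N : nat) : fieldType :=
  {fraction {mpoly R[N]}}.

Definition ratC (R : realType) (N : nat) (c : R) : ratfun R N :=
  (c%:MP_[N])%:F.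

Definition coord (R : realType) (N : nat) (a : 'I_N) : ratfun R N :=
  ('X_a : {mpoly R[N]})%:F.

Definition poly_comp (R : realType) (N : nat) (T : 'I_N -> ratfun R N)
    (p : {mpoly R[N]}) : ratfun R N :=
  mmap (@ratC R N) T p.

(** f o T, for the rational map T with components T_a.  This does not depend on
    the fraction representing f as soon as T is dominant (no nonzero polynomial
    vanishes identically on its image), which is the case of T_k. *)
Definition rat_comp (R : realType) (N : nat) (T : 'I_N -> ratfun R N)
    (f : ratfun R N) : ratfun R N :=
  poly_comp T (\n_(repr f)) / poly_comp T (\d_(repr f)).

Record poisson_bracket (R : realType) (N : nat)
    (br : ratfun R N -> ratfun R N -> ratfun R N) : Prop := PoissonBracket {
  pb_linear : forall (c : R) f g h,
    br (ratC N c * f + g) h = ratC N c * br f h + br g h;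
  pb_skew : forall f g, br f g = - br g f;
  pb_leibniz : forall f g h, br (f * g) h = f * br g h + br f h * g;
  pb_jacobi : forall f g h,
    br f (br g h) + br g (br h f) + br h (br f g) = 0 }.

(** The bracket is regular on the whole of R^N: [P] is its (polynomial) Poisson
    tensor. *)
Definition poisson_tensor (R : realType) (N : nat)
    (br : ratfun R N -> ratfun R N -> ratfun R N)
    (P : 'M[{mpoly R[N]}]_N) : Prop :=
  forall a b : 'I_N, br (coord R a) (coord R b) = (P a b)%:F.

Definition bracket_invariant (R : realType) (N : nat)
    (T : 'I_N -> ratfun R N)
    (br : ratfun R N -> ratfun R N -> ratfun R N) : Prop :=
  forall f g, br (rat_comp T f) (rat_comp T g) = rat_comp T (br f g).

(** Generic points: off a proper algebraic subset of R^N. *)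
Definition generically (R : realType) (N : nat) (Q : ('I_N -> R) -> Prop) :
    Prop :=
  exists2 q : {mpoly R[N]}, q != 0 & forall v, q.@[v] != 0 -> Q v.

Definition generic_rank (R : realType) (N : nat) (P : 'M[{mpoly R[N]}]_N)
    (s : nat) : Prop :=
  generically (fun v => \rank (map_mx (meval v) P) = s).

Definition functionally_independent (R : realType) (N m : nat)
    (f : 'I_m -> {mpoly R[N]}) : Prop :=
  generically (fun v => row_free (\matrix_(a < m, b < N) (f a)^`M(b).@[v])).

(** The coordinates are (x, y) in this order; indices mod n are elements of
    ['I_n], and [i +~ l], [i -~ l] are i + l and i - l mod n.  The ordinal i
    stands for the index i + 1 of the mathematical convention 1..n. *)

Definition shiftp (n : nat) (i : 'I_n) (l : nat) : 'I_n := iter l (@ordS n) i.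
Definition shiftm (n : nat) (i : 'I_n) (l : nat) : 'I_n :=
  iter l (@ord_pred n) i.

Notation "i +~ l" := (shiftp i l) (at level 50, left associativity).
Notation "i -~ l" := (shiftm i l) (at level 50, left associativity).

Definition px (R : realType) (n : nat) (i : 'I_n) : {mpoly R[n + n]} :=
  'X_(lshift n i).
Definition py (R : realType) (n : nat) (i : 'I_n) : {mpoly R[n + n]} :=
  'X_(rshift n i).
Definition rx (R : realType) (n : nat) (i : 'I_n) : ratfun R (n + n) :=
  (px R i)%:F.
Definition ry (R : realType) (n : nat) (i : 'I_n) : ratfun R (n + n) :=
  (py R i)%:F.

Definition r_ (k : nat) : nat := (k./2).-1.
Definition r'_ (k : nat) : nat := (k - 2 - r_ k)%N.

Definition xstar (R : realType) (k n : nat) (i : 'I_n) : ratfun R (n + n) :=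
  let r := r_ k in
  let j := i -~ (r'_ k).+1 in
  rx R j * ((rx R (i +~ r) + ry R (i +~ r)) / (rx R j + ry R j)).

Definition ystar (R : realType) (k n : nat) (i : 'I_n) : ratfun R (n + n) :=
  let r := r_ k in
  let j := i -~ r'_ k in
  ry R j * ((rx R (i +~ r.+1) + ry R (i +~ r.+1)) / (rx R j + ry R j)).

Definition T_ (R : realType) (k n : nat) (a : 'I_(n + n)) :
    ratfun R (n + n) :=
  match split a with
  | inl i => xstar R k i
  | inr i => ystar R k i
  end.

(** [L_ R k i] is L_i(lambda), lambda being the variable of the polynomials over
    {mpoly R[n + n]}; [u] and [v] are the usual row and column numbers,
    starting from 1. *)
Definition L_ (R : realType) (n k : nat) (i : 'I_n) :
    'M[{poly {mpoly R[n + n]}}]_k :=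
  let xi := (px R i)%:P in
  let yi := (py R i)%:P in
  \matrix_(a < k, b < k)
    let u := a.+1 in
    let v := b.+1 in
    if (k == 2)%N then
      if (u == 1)%N && (v == 1)%N then - 'X * xi
      else if (u == 1)%N && (v == 2)%N then xi + yi
      else if (u == 2)%N && (v == 1)%N then - 'X
      else 1
    else
      if (u == 1)%N && (v == k.-1)%N then xi
      else if (u == 1)%N && (v == k)%N then xi + yi
      else if (u == 2)%N && (v == 1)%N then - 'X
      else if (3 <= u)%N && (v == u.-1)%N then 1
      else if (u == k)%N && (v == k)%N then 1
      else 0.

Definition M_ (R : realType) (n k : nat) : 'M[{poly {mpoly R[n + n]}}]_k :=
  \big[mulmx/1%:M]_(i < n) L_ R k i.

(** The outer variable is z and the inner one is lambda, so that the coefficient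
    of lambda^i z^j is [p`_j`_i]. *)
Definition spectral (R : realType) (n k : nat) :
    {poly {poly {mpoly R[n + n]}}} :=
  \det (1%:M + 'X *: map_mx polyC (M_ R n k)).

Definition I_ (R : realType) (k n i j : nat) : {mpoly R[n + n]} :=
  (spectral R n k)`_j`_i.

Record standard_bracket (R : realType) (k n : nat)
    (br : ratfun R (n + n) -> ratfun R (n + n) -> ratfun R (n + n)) : Prop :=
  StandardBracket {
  sb_xx : forall (i : 'I_n) l, (1 <= l <= k - 2)%N ->
    br (rx R i) (rx R (i +~ l)) = - (rx R i * rx R (i +~ l));
  sb_yy : forall (i : 'I_n) l, (1 <= l <= k - 1)%N ->
    br (ry R i) (ry R (i +~ l)) = - (ry R i * ry R (i +~ l));
  sb_yx : forall (i : 'I_n) l, (1 <= l <= k - 1)%N ->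
    br (ry R i) (rx R (i +~ l)) = - (ry R i * rx R (i +~ l));
  sb_yx' : forall (i : 'I_n) l, (0 <= l <= k - 2)%N ->
    br (ry R i) (rx R (i -~ l)) = ry R i * rx R (i -~ l);
  sb_xx0 : forall i j : 'I_n,
    (forall l, (1 <= l <= k - 2)%N -> j <> i +~ l /\ i <> j +~ l) ->
    br (rx R i) (rx R j) = 0;
  sb_yy0 : forall i j : 'I_n,
    (forall l, (1 <= l <= k - 1)%N -> j <> i +~ l /\ i <> j +~ l) ->
    br (ry R i) (ry R j) = 0;
  sb_yx0 : forall i j : 'I_n,
    (forall l, (1 <= l <= k - 1)%N -> j <> i +~ l) ->
    (forall l, (0 <= l <= k - 2)%N -> j <> i -~ l) ->
    br (ry R i) (rx R j) = 0 }.

(* Main.v *)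
(** Let S be the cyclic shift matrix, m = k - 1, z = - t ^ n and l = lambda t ^ m.
    Unrolling the product of the L_i into a recurrence of order k shows that
    det(1 + z M(lambda)) is the n x n determinant of
    D(l, t) = 1 - t S + l S^m (x + t y S), x and y being diagonal; T_k amounts to
    a refactorization of D, so it preserves this determinant.

    The bracket is {u_a, u_b} = J_ab u_a u_b, with J a constant integer matrix
    made of circulants. Its invariance is Z J Z^T = J, where Z is the logarithmic
    Jacobian matrix of T_k, and its rank is that of J, namely twice the rank of
    S^m - 1. By Jacobi's formula {det D(l, t), det D(l', t')} is a trace
    tr (D^-1 delta D), where delta D = U D - D V with tr U = tr V.

    For the independence, the exponents of lambda and t in det D leave n + d
    nonconstant coefficients, so it is enough that no nonzero vector of an
    (n + d)-dimensional space is tangent to all of them at some point. On y = - x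
    the matrix D factors as (1 + l S^m x) (1 - t S), which turns tangency into
    explicit linear equations; these have only the zero solution if x_j = j + 1
    for j <= d and x_j = 1 for j > d (j = 1, ..., n). *)

Require Import Defs.
From HB Require Import structures.
From mathcomp Require Import all_boot all_order all_algebra.
From mathcomp Require Import fraction reals mpoly zify ring.
From mathcomp Require Import generic_quotient perm polyXY.

Set Implicit Arguments.
Unset Strict Implicit.
Unset Printing Implicit Defensive.

Import GRing.Theory.
Local Open Scope ring_scope.

(** * Cyclic shifts *)

(** Two restrictions shape the argument. The passage from the L_i to D is a change of basis that is
    invertible only if lambda and all y_i are nonzero, and the involution argument cancels a factor
    1 - (t' / t) ^ n, so it says nothing about two equal values of z. Both are removed by
    interpolation: for invariance and involution, lambda and t run over positive integers,
    infinitely many of which remain after the bad ones are discarded. Integers are used because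
    derivations vanish on them and additive maps commute with evaluation at them.

    For the independence, tangency at y = - x decouples: t = 0 only sees the x-components of a
    vector, and once these vanish t = 1 yields equations for the y-components. D is singular at t =
    1, but the factor 1 - t ^ n is cancelled formally beforehand. The n + d directions are all the
    y-directions and the first d x-directions, one for each orbit of the shift by m = k - 1. The d
    special values of x have to be nonzero and distinct, to tell the orbits apart, and different
    from 1, to single out one point of each orbit; hence 2, ..., d + 1. *)

Lemma shiftp_val n (i : 'I_n) l : val (i +~ l) = ((i + l) %% n)%N.
Proof.
elim: l => [|l IH]; first by rewrite addn0 modn_small.
by rewrite /shiftp iterS -/(shiftp i l) /= [nat_of_ord _]IH -addn1 modnDml addn1 addnS.
Qed.

Lemma shiftp0 n (i : 'I_n) : i +~ 0 = i. Proof. by []. Qed.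

Lemma shiftpD n (i : 'I_n) a b : (i +~ a) +~ b = i +~ (a + b).
Proof. by rewrite /shiftp addnC iterD. Qed.

Lemma shiftpn n (i : 'I_n) : i +~ n = i.
Proof. by apply: val_inj; rewrite shiftp_val modnDr modn_small. Qed.

Lemma shiftpnM n (i : 'I_n) a : i +~ (n * a) = i.
Proof. by elim: a => [|a IH]; rewrite ?muln0 // mulnS -shiftpD shiftpn. Qed.

Lemma shiftpK n (i : 'I_n) a : (i +~ a) -~ a = i.
Proof.
by elim: a => // a IH; rewrite /shiftm /shiftp iterSr iterS ordSK.
Qed.

Lemma shiftmK n (i : 'I_n) a : (i -~ a) +~ a = i.
Proof.
by elim: a => // a IH; rewrite /shiftm /shiftp iterSr iterS ord_predK.
Qed.

Lemma shiftp_inj n a : injective (fun i : 'I_n => i +~ a).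
Proof. by move=> i j /(congr1 (fun u => u -~ a)); rewrite !shiftpK. Qed.

Lemma shiftm_inj n a : injective (fun i : 'I_n => i -~ a).
Proof. by move=> i j /(congr1 (fun u => u +~ a)); rewrite !shiftmK. Qed.

Lemma shiftpC n (i : 'I_n) a b : (i +~ a) +~ b = (i +~ b) +~ a.
Proof. by rewrite !shiftpD addnC. Qed.

Lemma shiftmpC n (i : 'I_n) a b : (i -~ a) +~ b = (i +~ b) -~ a.
Proof. by apply: (@shiftp_inj _ a); rewrite shiftmK shiftpC shiftmK. Qed.

Lemma shiftm_le n (i : 'I_n) a b : (a <= b)%N -> (i +~ b) -~ a = i +~ (b - a).
Proof. by move=> ab; rewrite -{1}(subnK ab) -shiftpD shiftpK. Qed.

Lemma eq_shiftp n (i j : 'I_n) a : (j == i +~ a) = (i == j -~ a).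
Proof.
by apply/eqP/eqP => ->; rewrite ?shiftpK ?shiftmK.
Qed.

Lemma reindex_shiftm (K : nmodType) n a (F : 'I_n -> K) :
  \sum_i F i = \sum_i F (i -~ a).
Proof.
by apply: reindex_inj; apply: shiftm_inj.
Qed.

Section ShiftMatrix.
Variables (K : comNzRingType) (n : nat).
Implicit Types (M X Y : 'M[K]_n) (f : 'I_n -> K).

Definition Sh (l : nat) : 'M[K]_n := \matrix_(i, j) (j == i +~ l)%:R.

Definition dgf f : 'M[K]_n := diag_mx (\row_i f i).

Lemma dgfE f i j : dgf f i j = f i *+ (i == j).
Proof. by rewrite !mxE. Qed.

Lemma ShE l i j : Sh l i j = (j == i +~ l)%:R. Proof. by rewrite mxE. Qed.

Lemma mul_ShE l p (M : 'M[K]_(n, p)) i j : (Sh l *m M) i j = M (i +~ l) j.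
Proof.
rewrite mxE (bigD1 (i +~ l)) //= mxE eqxx mul1r big1 ?addr0 // => u ne.
by rewrite mxE (negPf ne) mul0r.
Qed.

Lemma mulmx_ShE l p (M : 'M[K]_(p, n)) i j : (M *m Sh l) i j = M i (j -~ l).
Proof.
rewrite mxE (bigD1 (j -~ l)) //= mxE shiftmK eqxx mulr1 big1 ?addr0 // => u ne.
by rewrite mxE eq_shiftp (negPf ne) mulr0.
Qed.

Lemma mul_dgfE f p (M : 'M[K]_(n, p)) i j : (dgf f *m M) i j = f i * M i j.
Proof. by rewrite mul_diag_mx !mxE. Qed.

Lemma mulmx_dgfE f p (M : 'M[K]_(p, n)) i j : (M *m dgf f) i j = M i j * f j.
Proof. by rewrite mul_mx_diag !mxE. Qed.

Lemma ShD a b : Sh a *m Sh b = Sh (a + b).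
Proof. by apply/matrixP=> i j; rewrite mul_ShE !mxE shiftpD. Qed.

Lemma Sh0 : Sh 0 = 1%:M.
Proof. by apply/matrixP=> i j; rewrite !mxE eq_sym. Qed.

Lemma Shn : Sh n = 1%:M.
Proof. by apply/matrixP=> i j; rewrite !mxE shiftpn eq_sym. Qed.

Lemma ShnM a : Sh (n * a) = 1%:M.
Proof. by apply/matrixP=> i j; rewrite !mxE shiftpnM eq_sym. Qed.

Lemma trSh_mul a : (Sh a)^T *m Sh a = 1%:M.
Proof. by apply/matrixP=> i j; rewrite mulmx_ShE !mxE shiftmK. Qed.

Lemma Sh_mul_tr a : Sh a *m (Sh a)^T = 1%:M.
Proof.
by apply/matrixP=> i j; rewrite mul_ShE !mxE (inj_eq (@shiftp_inj _ a)).
Qed.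

(** Backward shifts are forward shifts as well, so that [ShD] makes all matrices built from shifts
    and their transposes commute. *)
Lemma trSh_ShnM a : (Sh a)^T = Sh (n * a - a).
Proof.
case: (posnP n) => [n0|n0]; first by apply/matrixP => i j; exfalso; have := ltn_ord i; lia.
have e : Sh a *m Sh (n * a - a) = 1%:M.
  by rewrite ShD subnKC ?leq_pmull // ShnM.
by rewrite -[LHS]mulmx1 -e mulmxA trSh_mul mul1mx.
Qed.

Lemma mul_trShE l p (M : 'M[K]_(n, p)) i j : ((Sh l)^T *m M) i j = M (i -~ l) j.
Proof.
rewrite mxE (bigD1 (i -~ l)) //= !mxE shiftmK eqxx mul1r big1 ?addr0 // => u ne.
by rewrite !mxE eq_shiftp (negPf ne) mul0r.
Qed.

Lemma Sh_dgf l f : Sh l *m dgf f = dgf (fun i => f (i +~ l)) *m Sh l.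
Proof.
by apply/matrixP=> i j; rewrite mulmx_dgfE mul_dgfE !mxE eq_sym mulrC; case: eqP => [<-|]; rewrite ?mulr1 ?mulr0.
Qed.

Lemma dgfM f g : dgf f *m dgf g = dgf (fun i => f i * g i).
Proof. by apply/matrixP=> i j; rewrite mul_dgfE !dgfE mulrnAr. Qed.

Lemma dgfC f g : dgf f *m dgf g = dgf g *m dgf f.
Proof. by rewrite !dgfM; apply/matrixP=> i j; rewrite !dgfE mulrC. Qed.

Lemma dgf1 : dgf (fun=> 1) = 1%:M.
Proof. by apply/matrixP=> i j; rewrite dgfE !mxE. Qed.

Lemma eq_dgf f g : f =1 g -> dgf f = dgf g.
Proof. by move=> e; apply/matrixP=> i j; rewrite !dgfE e. Qed.

Lemma det_dgf f : \det (dgf f) = \prod_i f i.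
Proof. by rewrite det_diag; apply: eq_bigr => i _; rewrite mxE. Qed.

Lemma det_Sh_neq0 a : \det (Sh a) != 0.
Proof.
apply/eqP => d0; have := congr1 determinant (Sh_mul_tr a).
by rewrite det_mulmx d0 mul0r det1 => /esym/eqP; rewrite oner_eq0.
Qed.

(* The matrix whose determinant is the spectral polynomial, with
   [m = k - 1], [t ^+ n = - z] and [l = lambda t ^+ m]. *)
Definition Dmx (m : nat) (x y : 'I_n -> K) (l t : K) : 'M[K]_n :=
  1%:M - t *: Sh 1 + l *: (Sh m *m (dgf x + t *: (dgf y *m Sh 1))).

Lemma DmxE m x y l t i j :
  Dmx m x y l t i j = (j == i)%:R - t * (j == i +~ 1)%:R
    + l * (x (i +~ m) * (j == i +~ m)%:R + t * (y (i +~ m) * (j == i +~ m.+1)%:R)).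
Proof.
rewrite /Dmx mulmxDr [LHS]mxE [X in X + _]mxE [X in _ + X]mxE; congr (_ + _).
  by rewrite !mxE eq_sym.
rewrite mxE Sh_dgf mul_dgfE ShE -scalemxAr; congr (_ * (_ + _)).
by rewrite mxE mulmxA Sh_dgf -mulmxA mul_dgfE ShD addn1 ShE.
Qed.

End ShiftMatrix.

Lemma map_Dmx (K L : comNzRingType) (f : {rmorphism K -> L}) n m
    (x y : 'I_n -> K) l t :
  map_mx f (Dmx m x y l t) = Dmx m (f \o x) (f \o y) (f l) (f t).
Proof.
apply/matrixP => i j; rewrite mxE !DmxE !(rmorphD, rmorphB, rmorphM) /=.
by rewrite !rmorph_nat rmorphN rmorphM rmorph_nat.
Qed.

Lemma sum_delta (K : pzRingType) k (p : 'I_k) c (f : 'I_k -> K) :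
  \sum_b (c * (b == p)%:R) * f b = c * f p.
Proof.
rewrite (bigD1 p) //= eqxx mulr1 big1 ?addr0 // => b ne.
by rewrite (negPf ne) mulr0 mul0r.
Qed.

(** * The spectral determinant *)

HB.instance Definition _ (K : pzSemiRingType) k :=
  Monoid.isLaw.Build 'M[K]_k 1%:M (@mulmx K k k k)
    (@mulmxA K k k k k) (@mul1mx K k k) (@mulmx1 K k k).

Section Transfer.
Variables (K : idomainType) (n k : nat) (x y : 'I_n -> K) (l : K).
Hypotheses (hk : (2 <= k)%N) (hkn : (k <= n)%N).

(** [L_] over an arbitrary domain, so that evaluations at integers and at formal variables are
    treated together. *)
Definition Lax (i : 'I_n) : 'M[K]_k :=
  \matrix_(a < k, b < k)
    let u := a.+1 in
    let v := b.+1 in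
    if (k == 2)%N then
      if (u == 1)%N && (v == 1)%N then - l * x i
      else if (u == 1)%N && (v == 2)%N then x i + y i
      else if (u == 2)%N && (v == 1)%N then - l
      else 1
    else
      if (u == 1)%N && (v == k.-1)%N then x i
      else if (u == 1)%N && (v == k)%N then x i + y i
      else if (u == 2)%N && (v == 1)%N then - l
      else if (3 <= u)%N && (v == u.-1)%N then 1
      else if (u == k)%N && (v == k)%N then 1
      else 0.

(* One step of the recurrence
   [b_i = b_(i+1) - l (x_(i+k-1) b_(i+k-1) + y_(i+k-1) b_(i+k))]
   acting on the window [(b_(i+1), ..., b_(i+k))]. *)
Definition Companion (i : 'I_n) : 'M[K]_k :=
  \matrix_(a < k, b < k)
    if a == 0%N :> nat then
      (b == 0%N :> nat)%:R - l * x (i +~ k.-1) * (b == k.-2 :> nat)%:R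
        - l * y (i +~ k.-1) * (b == k.-1 :> nat)%:R
    else (b == a.-1 :> nat)%:R.

(* Sends the window [(b_i, ..., b_(i+k-1))] to the state on which the matrices
   [Lax] act. *)
Definition Gauge (i : 'I_n) : 'M[K]_k :=
  \matrix_(a < k, b < k)
    if a == k.-1 :> nat then (b == 0%N :> nat)%:R
    else (if a == 0%N :> nat then 1 else - l)
      * (x (i +~ a) * (b == a :> nat)%:R + y (i +~ a) * (b == a.+1 :> nat)%:R).

Let k0 : 'I_k := Ordinal (ltnW hk).

Let row2 (c1 c2 : K) (p1 p2 : 'I_k) (r f : 'I_k -> K) :
  (forall b, r b = c1 * (b == p1)%:R + c2 * (b == p2)%:R) ->
  \sum_b r b * f b = c1 * f p1 + c2 * f p2.
Proof.
move=> e; under eq_bigr do rewrite e mulrDl.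
by rewrite big_split !sum_delta.
Qed.

Let ordk p (hp : (p < k)%N) : {q : 'I_k | val q = p}.
Proof. by exists (Ordinal hp). Qed.

(** By the recurrence, the state at i + 1 ends with b_i - b_(i+1) and b_(i+1) when k > 2. The last
    row of [Lax i] adds them into b_i, and the first one forms x_i (b_i - b_(i+1)) + (x_i + y_i)
    b_(i+1) = x_i b_i + y_i b_(i+1). The second row multiplies entry 0 by [- l], whence that factor
    in [Gauge] for the later entries. For k = 2 the last but one entry is entry 0, which lacks
    [- l], and [Lax] supplies it in both rows. *)
Lemma Lax_Gauge i : Lax i *m Gauge (i +~ 1) = Gauge i *m Companion i.
Proof.
have [q2 e2] := @ordk k.-2 ltac:(lia); have [q1 e1] := @ordk k.-1 ltac:(lia).
have [qo eo] := @ordk 1%N ltac:(lia); have [q0 e0] := @ordk 0%N ltac:(lia).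
have E2 (c p : 'I_k) : (c == p) = (c == p :> nat) by [].
have GR (a b : 'I_k) : (Gauge i *m Companion i) a b =
  if a == k.-1 :> nat then Companion i q0 b else
  (if a == 0%N :> nat then 1 else - l) *
  (x (i +~ a) * Companion i a b + y (i +~ a) * (b == a :> nat)%:R).
  rewrite [LHS]mxE; case: ifP => ak.
    rewrite (row2 (c1 := 1) (c2 := 0) (p1 := q0) (p2 := q0)) ?mul1r ?mul0r ?addr0 //.
    by move=> c; rewrite mxE ak !E2 e0 mul0r addr0 mul1r.
  have [qa ea] := @ordk a.+1 ltac:(have := ltn_ord a; lia).
  set z := if _ then 1 else _.
  rewrite (row2 (c1 := z * x (i +~ a)) (c2 := z * y (i +~ a)) (p1 := a) (p2 := qa)).
    by rewrite [Companion _ qa b]mxE ea /=; ring.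
  by move=> c; rewrite mxE ak !E2 ea; rewrite /z; ring.
have sh1 p : i +~ 1 +~ p = i +~ p.+1 by rewrite shiftpD add1n.
apply/matrixP => a b; rewrite GR {GR}; case: (altP (k =P 2%N)) => [k2|k2].
  have k2b : (k == 2)%N by apply/eqP.
  have e1' : q1 = 1%N :> nat by rewrite e1; lia.
  have kp : k.-1 = 1%N by lia.
  have kpp : k.-2 = 0%N by lia.
  have l2 (c : 'I_k) : (c < 2)%N by have := ltn_ord c; lia.
  have -> : (Lax i *m Gauge (i +~ 1)) a b =
    - l * (if a == 0%N :> nat then x i else 1) * Gauge (i +~ 1) q0 b
    + (if a == 0%N :> nat then x i + y i else 1) * Gauge (i +~ 1) q1 b.
    rewrite [LHS]mxE; apply: row2 => c; rewrite mxE k2b !E2 e0 e1' /= ?eqSS.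
    move: (l2 a) (l2 c).
    case: (nat_of_ord a) => [|[|//]]; case: (nat_of_ord c) => [|[|//]] _ _ /=; ring.
  rewrite !mxE e0 e1' !sh1 ?kp ?kpp /=.
  move: (l2 a) (l2 b).
  case: (nat_of_ord a) => [|[|//]]; case: (nat_of_ord b) => [|[|//]] _ _ /=; rewrite ?shiftp0; ring.
have k3 : (2 < k)%N by lia.
case: (altP (a =P 0%N :> nat)) => a0.
  have -> : (Lax i *m Gauge (i +~ 1)) a b =
    x i * Gauge (i +~ 1) q2 b + (x i + y i) * Gauge (i +~ 1) q1 b.
    rewrite [LHS]mxE; apply: row2 => c; rewrite mxE (negPf k2) !E2 e2 e1 a0 /=.
    have -> : (c.+1 == k.-1) = (c == k.-2 :> nat) by lia.
    have -> : (c.+1 == k) = (c == k.-1 :> nat) by lia.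
    have -> : (1 == k)%N = false by lia.
    by case: eqP => [->|_]; case: eqP => //=; try lia; move=> *; ring.
  have ek : k.-2.+1 = k.-1 by lia.
  rewrite !mxE e0 e1 e2 !sh1 ek a0 !eqxx.
  have -> : (k.-2 == k.-1)%N = false by lia.
  have -> : (k.-2 == 0)%N = false by lia.
  have -> : (0 == k.-1)%N = false by lia.
  by rewrite shiftp0; ring.
case: (altP (a =P 1%N :> nat)) => a1.
  have -> : (Lax i *m Gauge (i +~ 1)) a b = - l * Gauge (i +~ 1) q0 b.
    rewrite [LHS]mxE (row2 (c1 := - l) (c2 := 0) (p1 := q0) (p2 := q0)) ?mul0r ?addr0 // => c.
    rewrite mxE (negPf k2) !E2 e0 a1 /= eqSS mul0r addr0.
    have -> : (2 == k)%N = false by lia.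
    by case: eqP => _; rewrite ?mulr1 ?mulr0.
  rewrite !mxE e0 a1 !sh1.
  have -> : (1 == k.-1)%N = false by lia.
  have -> : (0 == k.-1)%N = false by lia.
  by rewrite !eqxx /=; ring.
have [qa ea] := @ordk a.-1 ltac:(have := ltn_ord a; lia).
have -> : (Lax i *m Gauge (i +~ 1)) a b =
  1 * Gauge (i +~ 1) qa b + (a == k.-1 :> nat)%:R * Gauge (i +~ 1) q1 b.
  rewrite [LHS]mxE; apply: row2 => c; rewrite mxE; cbv zeta; rewrite (negPf k2) !E2 ea e1.
  have -> : (a.+1 == 1)%N = false by lia.
  have -> : (a.+1 == 2)%N = false by lia.
  have -> : (2 < a.+1)%N = true by lia.
  have -> : (c.+1 == a.+1.-1)%N = (c == a.-1 :> nat) by lia.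
  have -> : (c.+1 == k) = (c == k.-1 :> nat) by lia.
  have -> : (a.+1 == k) = (a == k.-1 :> nat) by lia.
  have [ak|ak] := altP (a =P k.-1 :> nat); have [ca|ca] := altP (c =P a.-1 :> nat) => /=;
    have [ck|ck] := altP (c =P k.-1 :> nat) => //=; try (exfalso; lia); ring.
rewrite !mxE ea e1 e0 eqxx !sh1 (negPf a0).
have -> : (a.-1 == k.-1)%N = false by have := ltn_ord a; lia.
have -> : (a.-1 == 0)%N = false by lia.
have -> : a.-1.+1 = a by lia.
have [ak|ak] := altP (a =P k.-1 :> nat).
  have -> : a.-1 = k.-2 by lia.
  by rewrite ak /=; ring.
by rewrite /=; ring.
Qed.

(** Once its last row is moved to the top, [Gauge i] is lower triangular with diagonal 1, y, - l y,
    ..., - l y. *)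
Lemma det_Gauge_neq0 i : l != 0 -> (forall j, y j != 0) -> \det (Gauge i) != 0.
Proof.
move=> l0 y0.
pose G := \matrix_(a < k, b < k)
    if a == 0%N :> nat then (b == 0%N :> nat)%:R
    else (if a == 1%N :> nat then 1 else - l)
      * (x (i +~ a.-1) * (b == a.-1 :> nat)%:R + y (i +~ a.-1) * (b == a :> nat)%:R).
have -> : Gauge i = Sh K k 1 *m G.
  apply/matrixP => a b; rewrite mul_ShE !mxE shiftp_val addn1.
  have [ak|ak] := altP (a =P k.-1 :> nat); first by rewrite ak prednK ?modnn //; lia.
  have ak1 : (a.+1 < k)%N by have := ltn_ord a; lia.
  by rewrite modn_small.
rewrite det_mulmx mulf_neq0 ?det_Sh_neq0 // det_trig.
  apply/prodf_neq0 => a _; rewrite mxE eqxx; have [a0|a0] := altP (a =P 0%N :> nat).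
    by rewrite oner_neq0.
  rewrite (_ : (a == a.-1 :> nat) = false) ?mulr0 ?add0r ?mulr1; last by lia.
  by rewrite mulf_neq0 ?y0 //; case: ifP => _; rewrite ?oner_neq0 // oppr_eq0.
apply/is_trig_mxP => a b ab; rewrite mxE.
have [a0|a0] := altP (a =P 0%N :> nat); first by rewrite (_ : (b == _ :> nat) = false) //; lia.
rewrite (_ : (b == a :> nat) = false); last by lia.
rewrite (_ : (b == a.-1 :> nat) = false); last by lia.
by rewrite !mulr0 addr0 mulr0.
Qed.

Let i0 : 'I_n := Ordinal (leq_trans (ltnW hk) hkn).

Lemma prod_ord (A : 'I_n -> 'M[K]_k) :
  \big[mulmx/1%:M]_(i < n) A i = \big[mulmx/1%:M]_(0 <= j < n) A (i0 +~ j).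
Proof.
rewrite big_mkord; apply: eq_bigr => i _; congr (A _); apply: val_inj.
by rewrite shiftp_val /= add0n modn_small.
Qed.

(** [Lax_Gauge] telescopes along the cycle, and [Gauge] takes the same value at both ends, so the
    two monodromy matrices are conjugate. *)
Lemma det_Lax_Companion w : l != 0 -> (forall j, y j != 0) ->
  \det (1%:M - w *: \big[mulmx/1%:M]_(i < n) Lax i) =
  \det (1%:M - w *: \big[mulmx/1%:M]_(i < n) Companion i).
Proof.
move=> l0 y0; rewrite !prod_ord.
have tel q : (\big[mulmx/1%:M]_(0 <= j < q) Lax (i0 +~ j)) *m Gauge (i0 +~ q)
    = Gauge i0 *m \big[mulmx/1%:M]_(0 <= j < q) Companion (i0 +~ j).
  elim: q => [|q IH]; first by rewrite !big_geq // mul1mx mulmx1.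
  rewrite !big_nat_recr //= mulmxA -IH -!mulmxA; congr (_ *m _).
  by rewrite -Lax_Gauge shiftpD addn1.
apply: (mulIf (det_Gauge_neq0 i0 l0 y0)).
rewrite -det_mulmx [RHS]mulrC -det_mulmx; congr (\det _).
move: (tel n); rewrite shiftpn => e.
by rewrite mulmxBl mulmxBr -scalemxAl e -scalemxAr mul1mx mulmx1.
Qed.

(* The cyclic band matrix of the recurrence, with the monodromy condition
   [b_(i+n) = w b_i]. *)
Definition Band (w : K) : 'M[K]_n :=
  \matrix_(i < n, j < n)
    (let c p := (j == p :> nat)%:R + w * (j + n == p)%N%:R in
     c i - c i.+1 + l * x (i +~ k.-1) * c (i + k.-1)%N
     + l * y (i +~ k.-1) * c (i + k)%N).

(** The matrix [B] collects the n recurrence equations [Om] and the k conditions b_(n+a) = w b_a on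
    the unknowns b_0, ..., b_(n+k-1). Eliminating the last k unknowns leaves [Band w]. Eliminating
    the first n instead, through the solutions [Phi] of the recurrence, leaves 1 - w times the
    monodromy, with a unitriangular complementary block. *)
Lemma det_Companion w :
  \det (1%:M - w *: \big[mulmx/1%:M]_(i < n) Companion i) = \det (Band w).
Proof.
pose BB p := \big[mulmx/1%:M]_(p <= j < n) Companion (i0 +~ j) : 'M[K]_k.
have q0P : (0 < k)%N by lia.
pose q0 := Ordinal q0P.
(* [bb c] expresses b_c linearly through the final window (b_n, ..., b_(n+k-1)). *)
pose bb c : 'rV[K]_k :=
  if (c < n)%N then row q0 (BB c) else \row_j (j + n == c)%N%:R.
have BBn : BB n = 1%:M by rewrite /BB big_geq.
have BBS p : (p < n)%N -> BB p = Companion (i0 +~ p) *m BB p.+1.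
  by move=> pn; rewrite /BB big_ltn.
have rowBB p (a : 'I_k) : (p <= n)%N -> row a (BB p) = bb (p + a)%N.
  elim: {p}(n - p)%N {-2}p (erefl (n - p)%N) a => [|u IH] p e a pn.
    have -> : p = n by lia.
    rewrite BBn /bb ltnNge leq_addr /=; apply/rowP => j; rewrite !mxE.
    by rewrite [(n + a)%N]addnC eqn_add2r eq_sym.
  have pn' : (p < n)%N by lia.
  case: (posnP a) => a0.
    by rewrite a0 addn0 /bb pn'; congr (row _ _); apply: val_inj.
  have a1 : (a.-1 < k)%N by have := ltn_ord a; lia.
  rewrite BBS // row_mul.
  have -> : row a (Companion (i0 +~ p)) = delta_mx 0 (Ordinal a1).
    apply/rowP => j; rewrite !mxE (_ : (a == 0%N :> nat) = false); last by lia.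
    by rewrite eqxx.
  rewrite -rowE IH //=; last by lia.
  by congr bb; lia.
have bbrec p : (p < n)%N -> bb p = bb p.+1 - (l * x (i0 +~ (p + k.-1))) *: bb (p + k.-1)%N
    - (l * y (i0 +~ (p + k.-1))) *: bb (p + k)%N.
  move=> pn; rewrite {1}/bb pn BBS // row_mul.
  have [q2 e2] := @ordk k.-2 ltac:(lia); have [q1 e1] := @ordk k.-1 ltac:(lia).
  have -> : row q0 (Companion (i0 +~ p)) = delta_mx 0 q0
     - (l * x (i0 +~ (p + k.-1))) *: delta_mx 0 q2 - (l * y (i0 +~ (p + k.-1))) *: delta_mx 0 q1.
    apply/rowP => j; rewrite !mxE /= shiftpD.
    by rewrite (_ : (j == q2) = (j == k.-2 :> nat)) -?e2 // (_ : (j == q1) = (j == k.-1 :> nat)) -?e1.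
  rewrite !mulmxBl -!scalemxAl -!rowE !rowBB //= e1 e2 addn0.
  by congr (_ - _ *: bb _ - _ *: bb _); lia.
pose Om : 'M[K]_(n, n + k) := \matrix_(i < n, c < n + k)
  ((c == i :> nat)%:R - (c == i.+1 :> nat)%:R
   + l * x (i +~ k.-1) * (c == (i + k.-1)%N :> nat)%:R
   + l * y (i +~ k.-1) * (c == (i + k)%N :> nat)%:R).
pose Phi : 'M[K]_(n + k, k) := \matrix_(c < n + k) bb c.
have OmPhi : Om *m Phi = 0.
  apply/row_matrixP => i; rewrite row_mul row0.
  have il := ltn_ord i.
  have oN p (hp : (p < n + k)%N) : {q : 'I_(n + k) | val q = p} by exists (Ordinal hp).
  have [c0 e0] := oN i ltac:(lia); have [c1 e1] := oN i.+1 ltac:(lia).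
  have [c2 e2] := oN (i + k.-1)%N ltac:(lia); have [c3 e3] := oN (i + k)%N ltac:(lia).
  have -> : row i Om = delta_mx 0 c0 - delta_mx 0 c1 + (l * x (i +~ k.-1)) *: delta_mx 0 c2
     + (l * y (i +~ k.-1)) *: delta_mx 0 c3.
    apply/rowP => j.
    have E c : (j == c) = (val j == val c) by [].
    by rewrite !mxE !E e0 e1 e2 e3.
  rewrite !(mulmxDl, mulNmx) -!scalemxAl -!rowE !rowK e0 e1 e2 e3 bbrec //.
  have -> : i0 +~ (i + k.-1) = i +~ k.-1.
    rewrite -shiftpD; congr (_ +~ _); apply: val_inj.
    by rewrite shiftp_val /= add0n modn_small.
  by apply/rowP => j; rewrite !mxE; ring.
pose J : 'M[K]_(k, n) := \matrix_(a < k, b < n) (b == a :> nat)%:R.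
pose B := col_mx Om (row_mx (- (w *: J)) 1%:M).
have E1 : \det B = \det (Band w).
  rewrite /B -[Om]hsubmxK -/(block_mx _ _ _ _).
  have -> : block_mx (lsubmx Om) (rsubmx Om) (- (w *: J)) 1%:M
    = block_mx 1%:M (rsubmx Om) 0 1%:M *m
      block_mx (lsubmx Om + rsubmx Om *m (w *: J)) 0 (- (w *: J)) 1%:M.
    rewrite mulmx_block !(mul1mx, mul0mx, mulmx1, mulmx0, add0r, addr0).
    by rewrite mulmxN addrK.
  rewrite det_mulmx det_ublock det_lblock !det1 !mul1r mulr1; congr (\det _).
  apply/matrixP => i j; rewrite -scalemxAr.
  have -> : (lsubmx Om + w *: (rsubmx Om *m J)) i j =
      Om i (lshift k j) + w * \sum_(c < k) Om i (rshift n c) * (j == c :> nat)%:R.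
    rewrite [LHS]mxE [in LHS]mxE; congr (_ + _); rewrite mxE mxE; congr (_ * _).
    by apply: eq_bigr => c _; rewrite !mxE.
  have -> : \sum_(c < k) Om i (rshift n c) * (j == c :> nat)%:R =
    0 - (j + n == i.+1)%N%:R
    + l * x (i +~ k.-1) * (j + n == (i + k.-1))%N%:R
    + l * y (i +~ k.-1) * (j + n == (i + k))%N%:R.
    have il := ltn_ord i.
    have [jk|jk] := ltnP j k.
      rewrite (bigD1 (Ordinal jk)) //= big1 ?addr0; last first.
        move=> c ne; rewrite (_ : (j == c :> nat) = false) ?mulr0 //.
        by apply: contra_neqF ne => /eqP e; apply: val_inj.
      rewrite eqxx mulr1 !mxE /= [(n + j)%N]addnC (_ : (j + n == i)%N = false); last by lia.
      by rewrite mulr0n.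
    rewrite big1; last first.
      move=> c _; rewrite (_ : (j == c :> nat) = false) ?mulr0 //; have := ltn_ord c; lia.
    rewrite (_ : (j + n == i.+1)%N = false); last by lia.
    rewrite (_ : (j + n == i + k.-1)%N = false); last by lia.
    rewrite (_ : (j + n == i + k)%N = false); last by lia.
    by rewrite !mulr0n; ring.
  rewrite !mxE /= (_ : (j + n == i)%N = false); last by have := ltn_ord i; lia.
  rewrite !mulr0n. by ring.
rewrite -E1 {E1}.
have Phi2 : dsubmx Phi = 1%:M.
  apply/matrixP => a b; rewrite !mxE /bb ltnNge leq_addr /= !mxE.
  by rewrite addnC eqn_add2l eq_sym.
have Phi1 : J *m usubmx Phi = \big[mulmx/1%:M]_(i < n) Companion i.
  rewrite prod_ord -/(BB 0%N); apply/row_matrixP => a.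
  rewrite row_mul rowBB //.
  have an : (a < n)%N by have := ltn_ord a; lia.
  have -> : row a J = delta_mx 0 (Ordinal an) by apply/rowP => j; rewrite !mxE.
  by rewrite -rowE; apply/rowP => j; rewrite !mxE /= add0n.
have -> : \det B = \det (B *m block_mx 1%:M (usubmx Phi) 0 1%:M).
  by rewrite det_mulmx det_ublock !det1 !mulr1.
rewrite /B -[Om]hsubmxK -/(block_mx _ _ _ _) mulmx_block.
rewrite !(mul1mx, mul0mx, mulmx1, mulmx0, add0r, addr0).
have -> : lsubmx Om *m usubmx Phi + rsubmx Om = 0.
  by rewrite -OmPhi -[in RHS](hsubmxK Om) -[in RHS](vsubmxK Phi) mul_row_col Phi2 mulmx1.
rewrite det_lblock mulNmx -scalemxAl Phi1 [_ + 1%:M]addrC.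
suff -> : \det (lsubmx Om) = 1 by rewrite mul1r.
rewrite -det_tr det_trig.
  rewrite big1 // => i _; rewrite !mxE /= eqxx.
  rewrite (_ : (i == i.+1 :> nat) = false); last by lia.
  rewrite (_ : (i == i + k.-1 :> nat)%N = false); last by lia.
  rewrite (_ : (i == i + k :> nat)%N = false); last by lia.
  by rewrite mulr1n !mulr0n subr0 !mulr0 !addr0.
apply/is_trig_mxP => i j ij; rewrite !mxE /=.
rewrite (_ : (i == j :> nat) = false); last by lia.
rewrite (_ : (i == j.+1 :> nat) = false); last by lia.
rewrite (_ : (i == j + k.-1 :> nat)%N = false); last by lia.
rewrite (_ : (i == j + k :> nat)%N = false); last by lia.
by rewrite !mulr0n; ring.
Qed.

(** Wrapping around the cycle costs t ^ n, which is the monodromy put into [Band]. *)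
Let expr_shift (t : K) (i j : 'I_n) a : (a <= n)%N ->
  t ^+ i * (t ^+ a * (j == i +~ a)%:R) =
  ((j == (i + a)%N :> nat)%:R + t ^+ n * (j + n == i + a)%N%:R) * t ^+ j.
Proof.
move=> an; rewrite mulrA -exprD -[j == _]/(val j == val _) shiftp_val.
have il := ltn_ord i; have jl := ltn_ord j.
have [ia|ia] := ltnP (i + a)%N n.
  rewrite modn_small // (_ : (j + n == i + a)%N = false); last by lia.
  by case: eqP => [->|_]; rewrite ?mulr0n ?mulr1n; ring.
have -> : ((i + a) %% n = i + a - n)%N.
  by rewrite -{1}(subnK ia) modnDr modn_small //; lia.
rewrite (_ : (j == i + a :> nat)%N = false); last by lia.
rewrite (_ : (j == i + a - n :> nat)%N = (j + n == i + a)%N); last by lia.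
by case: eqP => [<-|_]; rewrite ?mulr0n ?mulr1n ?exprD; ring.
Qed.

(** Conjugation by the diagonal matrix of the t ^ i spreads the monodromy t ^ n evenly over the
    cycle: a shift by a acquires the factor t ^ a, and lambda is thereby accompanied by t ^ (k -
    1). *)
Lemma det_Lax_Dmx t : l != 0 -> t != 0 -> (forall j, y j != 0) ->
  \det (1%:M - t ^+ n *: \big[mulmx/1%:M]_(i < n) Lax i) =
  \det (Dmx k.-1 x y (l * t ^+ k.-1) t).
Proof.
move=> l0 t0 y0; rewrite det_Lax_Companion // det_Companion.
have d0 : \det (dgf (fun i : 'I_n => t ^+ i)) != 0.
  by rewrite det_dgf; apply/prodf_neq0 => i _; rewrite expf_neq0.
apply: (mulIf d0); rewrite -det_mulmx mulrC -det_mulmx; congr (\det _).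
apply/matrixP => i j; rewrite mulmx_dgfE mul_dgfE mxE DmxE; cbv zeta.
have e0 := expr_shift t i j (leq0n n).
have e1 := expr_shift t i j (leq_trans (ltnW hk) hkn).
have e2 := @expr_shift t i j k.-1 ltac:(lia).
have e3 := @expr_shift t i j k hkn.
rewrite prednK; last by lia.
transitivity (t ^+ i * (t ^+ 0 * (j == i +~ 0)%:R) - t ^+ i * (t ^+ 1 * (j == i +~ 1)%:R)
  + l * x (i +~ k.-1) * (t ^+ i * (t ^+ k.-1 * (j == i +~ k.-1)%:R))
  + l * y (i +~ k.-1) * (t ^+ i * (t ^+ k * (j == i +~ k)%:R))).
  by rewrite e0 e1 e2 e3 addn0 addn1; ring.
rewrite shiftp0 expr0 expr1 [in t ^+ k](_ : k = k.-1.+1) ?exprS; last by lia.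
by ring.
Qed.

End Transfer.

(** * The structure matrix of the bracket *)

Section Circulant.
Variables (K : comNzRingType) (n m : nat).
Hypothesis hm : (0 < m)%N.

Definition Delta : 'M[K]_n := Sh K n m - 1%:M.

Definition Acirc : 'M[K]_n := \sum_(1 <= j < m) ((Sh K n j)^T - Sh K n j).

(** [Acirc] carries the shifts 1, ..., m - 1, common to the four kinds of brackets; the [Delta]
    terms add the shifts 0 and m, where they differ. *)
Definition Jmx : 'M[K]_(n + n) :=
  block_mx Acirc (Acirc + Delta^T) (Acirc - Delta) (Acirc + Delta^T - Delta).

Definition Nsum : 'M[K]_n := \sum_(1 <= j < m) Sh K n j.

Lemma trDelta : Delta^T = (Sh K n m)^T - 1%:M.
Proof. by rewrite raddfB /= trmx1. Qed.

Lemma trAcirc : Acirc^T = - Acirc.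
Proof.
rewrite /Acirc raddf_sum -sumrN; apply: eq_bigr => j _.
by rewrite raddfB /= trmxK opprB.
Qed.

Lemma trJmx : Jmx^T = - Jmx.
Proof.
rewrite /Jmx tr_block_mx opp_block_mx !(raddfB, raddfD, trAcirc) /= trmxK trAcirc.
by congr block_mx; move: Acirc Delta => A D; apply/matrixP => i j; rewrite !mxE; ring.
Qed.

Lemma ShC a b : Sh K n a *m Sh K n b = Sh K n b *m Sh K n a.
Proof. by rewrite !ShD addnC. Qed.

Lemma Sh_trC a b : Sh K n a *m (Sh K n b)^T = (Sh K n b)^T *m Sh K n a.
Proof. by rewrite trSh_ShnM ShC. Qed.

Lemma Sh_Delta a : Sh K n a *m Delta = Delta *m Sh K n a.
Proof. by rewrite mulmxBr mulmxBl ShC mulmx1 mul1mx. Qed.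

Lemma Sh_trDelta a : Sh K n a *m Delta^T = Delta^T *m Sh K n a.
Proof. by rewrite trDelta mulmxBr mulmxBl Sh_trC mulmx1 mul1mx. Qed.

Lemma Sh_Acirc a : Sh K n a *m Acirc = Acirc *m Sh K n a.
Proof.
rewrite mulmx_sumr mulmx_suml; apply: eq_bigr => j _.
by rewrite mulmxBr mulmxBl ShC Sh_trC.
Qed.

Lemma trSh_le a b : (a <= b)%N -> (Sh K n b)^T *m Sh K n a = (Sh K n (b - a))^T.
Proof.
by move=> ab; rewrite -{1}(subnKC ab) -ShD trmx_mul -mulmxA trSh_mul mulmx1.
Qed.

(** Going back by m and forth by j is going back by m - j. This divisibility by [Delta^T] gives both
    the rank of [Jmx] and the Hamiltonian fields of the spectral determinants. *)
Lemma Acirc_Delta : Acirc = Delta^T *m Nsum.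
Proof.
rewrite trDelta mulmxBl mul1mx /Acirc sumrB; congr (_ - _).
rewrite big_nat_rev /= /Nsum mulmx_sumr !big_nat; apply: eq_bigr => j /andP[j1 jm].
by rewrite trSh_le ?add1n ?subSS //; lia.
Qed.

(** Both sums defining [Acirc] telescope. The identity is needed because T_k shifts the
    x-coordinates one step further than the y-coordinates. *)
Lemma Sh1_Acirc : Sh K n 1 *m (Acirc + Delta^T) = Acirc - Delta.
Proof.
have tel (F : nat -> 'M[K]_n) : \sum_(1 <= j < m) (F j - F j.-1) = F m.-1 - F 0%N.
  rewrite -(telescope_sumr F (leq0n _)) -[in LHS](prednK hm) big_add1 /=.
  by [].
have e : Sh K n 1 *m Acirc - Acirc = (1%:M - (Sh K n m.-1)^T) - (Sh K n m - Sh K n 1).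
  rewrite {1}/Acirc mulmx_sumr /Acirc -sumrB.
  rewrite (eq_big_nat _ _ (F2 := fun j => ((- (Sh K n j)^T) - (- (Sh K n j.-1)^T)) - (Sh K n j.+1 - Sh K n j.-1.+1))).
    rewrite sumrB tel (tel (fun j => Sh K n j.+1)) prednK // Sh0 trmx1 opprK.
    by rewrite [- _ + 1%:M]addrC.
  move=> j /andP[j1 jm]; rewrite mulmxBr ShD add1n Sh_trC trSh_le // prednK // subn1.
  by apply/matrixP => u v; rewrite !mxE; ring.
rewrite mulmxDr; move/eqP: e; rewrite subr_eq => /eqP ->.
rewrite Sh_trDelta trDelta mulmxBl trSh_le // mul1mx subn1 /Delta.
by apply/matrixP => i j; rewrite !mxE; ring.
Qed.

Variables (p q : 'I_n -> K).
Hypothesis pq1 : forall i, p i + q i = 1.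

Let P := Sh K n m.
Let D := Delta.
Let D' := Delta^T.

(* With [p = x / s] and [q = y / s], [s = x + y], these are the logarithmic
   differentials of [x_j s_(j+m) / s_j] and of [y_j s_(j+m) / s_j]. *)
Definition W1 : 'M[K]_(n, n + n) := row_mx (1%:M + Delta *m dgf p) (Delta *m dgf q).
Definition W2 : 'M[K]_(n, n + n) := row_mx (Delta *m dgf p) (1%:M + Delta *m dgf q).

Let dpq : dgf p + dgf q = 1%:M :> 'M[K]_n.
Proof. by apply/matrixP => i j; rewrite mxE !dgfE -mulrnDl pq1 mxE. Qed.

Let PD' : P *m D' = - D.
Proof. by rewrite /D' trDelta mulmxBr Sh_mul_tr mulmx1 /D /Delta opprB. Qed.

Let DP' : D *m P^T = - D'.
Proof. by rewrite /D' trDelta /D mulmxBl Sh_mul_tr mul1mx opprB. Qed.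

Let X1 : 'M[K]_n := P *m Acirc - D *m dgf q *m D.

Let PE : P = 1%:M + D. Proof. by rewrite /D /Delta addrC subrK. Qed.
Let PE' : P^T = 1%:M + D'. Proof. by rewrite /D' trDelta addrC subrK. Qed.

Let rowJ : row_mx (dgf p) (dgf q) *m Jmx =
  row_mx (Acirc - dgf q *m D) (Acirc + D' - dgf q *m D).
Proof.
have e (X : 'M[K]_n) : dgf p *m X + dgf q *m (X - D) = X - dgf q *m D.
  by rewrite mulmxBr addrA -mulmxDl dpq mul1mx.
by rewrite mul_row_block !e.
Qed.

Let PA : P *m Acirc = Acirc + D *m Acirc.
Proof. by rewrite PE mulmxDl mul1mx. Qed.

Let DD' : D *m D' = - D - D'.
Proof. by rewrite -PD' PE mulmxDl mul1mx addrAC subrr add0r. Qed.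

Let W1J : W1 *m Jmx = row_mx X1 (X1 - D).
Proof.
have -> : W1 = row_mx 1%:M 0 + D *m row_mx (dgf p) (dgf q).
  by rewrite mul_mx_row add_row_mx add0r.
rewrite mulmxDl -mulmxA rowJ mul_row_block mul_mx_row !(mul1mx, mul0mx, addr0).
rewrite add_row_mx !(mulmxBr D) (mulmxDr D) DD' /X1 PA -mulmxA -/D -/D'.
move: (D *m Acirc) (D *m _) => X Y.
by congr row_mx;  move: D D' Acirc => U V A; apply/matrixP => i j; rewrite !mxE; ring.
Qed.

Let W2J : W2 *m Jmx = row_mx (X1 - D) (X1 - D - D).
Proof.
have -> : W2 = row_mx 0 1%:M + D *m row_mx (dgf p) (dgf q).
  by rewrite mul_mx_row add_row_mx add0r.
rewrite mulmxDl -mulmxA rowJ mul_row_block mul_mx_row !(mul1mx, mul0mx, add0r).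
rewrite add_row_mx !(mulmxBr D) (mulmxDr D) DD' /X1 PA -mulmxA -/D -/D'.
move: (D *m Acirc) (D *m _) => X Y.
by congr row_mx; move: D D' Acirc => U V A; apply/matrixP => i j; rewrite !mxE; ring.
Qed.

Let X1P : X1 *m P^T - D *m dgf q *m D' = Acirc.
Proof.
rewrite /X1 mulmxBl [P *m Acirc]Sh_Acirc -[Acirc *m _ *m _]mulmxA Sh_mul_tr mulmx1 -[_ *m D *m _]mulmxA DP'.
by rewrite mulmxN opprK addrK.
Qed.

Let X1D' : X1 *m D' = X1 *m P^T - X1.
Proof. by rewrite PE' mulmxDr mulmx1 addrAC subrr add0r. Qed.

Let trW (f : 'I_n -> K) : (D *m dgf f)^T = dgf f *m D'.
Proof. by rewrite trmx_mul tr_diag_mx. Qed.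

Let X1E : X1 *m P^T = Acirc + D *m dgf q *m D'.
Proof. by rewrite -[in RHS]X1P subrK. Qed.

Let pE : dgf p = 1%:M - dgf q.
Proof. by rewrite -dpq addrK. Qed.

Let pD' : dgf p *m D' = D' - dgf q *m D'.
Proof. by rewrite pE mulmxBl mul1mx. Qed.

Let expand1 (U W : 'M[K]_n) : U *m (1%:M + W) = U + U *m W.
Proof. by rewrite mulmxDr mulmx1. Qed.

Let expandB (U V W : 'M[K]_n) : U *m (V - W) = U *m V - U *m W.
Proof. exact: mulmxBr. Qed.

Let expandD (V : 'M[K]_n) :
  ((X1 - D) *m V = X1 *m V - D *m V)
  * ((X1 - D - D) *m V = X1 *m V - D *m V - D *m V).
Proof. by rewrite !mulmxBl. Qed.

(** This and the next three lemmas show that the dependence on p and q cancels, leaving [Jmx] with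
    its two off-diagonal blocks exchanged. The relative shift by one in [log_Jacobian_J] undoes the
    exchange, by [Sh1_Acirc]. *)
Lemma W1JW1 : W1 *m Jmx *m W1^T = Acirc.
Proof.
rewrite W1J /W1 tr_row_mx mul_row_col [(1%:M + _)^T]raddfD /= trmx1 !trW pD'.
rewrite !expandD ?expand1 ?expandB X1D' X1E !mulmxA.
move: (X1 *m _ *m D') (D *m _ *m D') => U V.
by apply/matrixP => i j; rewrite !mxE; ring.
Qed.

Lemma W1JW2 : W1 *m Jmx *m W2^T = Acirc - Delta.
Proof.
rewrite W1J /W2 tr_row_mx mul_row_col [(1%:M + _)^T]raddfD /= trmx1 !trW pD' -/D.
rewrite !expandD ?expand1 ?expandB X1D' X1E !mulmxA.
move: (X1 *m _ *m D') (D *m _ *m D') => U V.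
by apply/matrixP => i j; rewrite !mxE; ring.
Qed.

Lemma W2JW1 : W2 *m Jmx *m W1^T = Acirc + Delta^T.
Proof.
rewrite W2J /W1 tr_row_mx mul_row_col [(1%:M + _)^T]raddfD /= trmx1 !trW pD' -/D -/D'.
rewrite !expandD ?expand1 ?expandB X1D' X1E DD' !mulmxA.
move: (X1 *m _ *m D') (D *m _ *m D') => U V.
by apply/matrixP => i j; rewrite !mxE; ring.
Qed.

Lemma W2JW2 : W2 *m Jmx *m W2^T = Acirc + Delta^T - Delta.
Proof.
rewrite W2J /W2 tr_row_mx mul_row_col [(1%:M + _)^T]raddfD /= trmx1 !trW pD' -/D -/D'.
rewrite !expandD ?expand1 ?expandB X1D' X1E DD' !mulmxA.
move: (X1 *m _ *m D') (D *m _ *m D') => U V.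
by apply/matrixP => i j; rewrite !mxE; ring.
Qed.

Lemma log_Jacobian_J a :
  let Z := col_mx ((Sh K n a.+1)^T *m W1) ((Sh K n a)^T *m W2) in
  Z *m Jmx *m Z^T = Jmx.
Proof.
move=> Z; rewrite /Z tr_col_mx !trmx_mul !trmxK mul_col_mx mul_col_row.
have assoc (U Y : 'M[K]_n) (X : 'M[K]_(n, n + n)) (X' : 'M[K]_(n + n, n)) :
   U *m X *m Jmx *m (X' *m Y) = U *m (X *m Jmx *m X' *m Y) by rewrite !mulmxA.
rewrite !assoc W1JW1 W1JW2 W2JW1 W2JW2 -Sh1_Acirc.
have SD a' : (Acirc + Delta^T) *m Sh K n a' = Sh K n a' *m (Acirc + Delta^T).
  by rewrite mulmxDl mulmxDr Sh_Acirc Sh_trDelta.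
have conj b (X : 'M[K]_n) : X *m Sh K n b = Sh K n b *m X ->
    (Sh K n b)^T *m (X *m Sh K n b) = X.
  by move=> ->; rewrite mulmxA trSh_mul mul1mx.
congr block_mx; rewrite ?conj ?Sh_Acirc //.
- rewrite -[Sh K n 1 *m _ *m _]mulmxA SD [Sh K n 1 *m (_ *m _)]mulmxA ShD add1n.
  by rewrite mulmxA trSh_mul mul1mx.
- rewrite -Sh1_Acirc -add1n -ShD [(Acirc + _) *m (Sh K n 1 *m _)]mulmxA SD conj //.
  by rewrite -mulmxA SD !mulmxA ShC.
- by rewrite mulmxBl mulmxBr SD Sh_Delta.
Qed.

Let WE : col_mx W1 W2 = 1%:M + col_mx 1%:M 1%:M *m (D *m row_mx (dgf p) (dgf q)).
Proof.
rewrite mul_mx_row mul_col_row !mul1mx scalar_mx_block /block_mx add_col_mx.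
by rewrite !add_row_mx !add0r.
Qed.

(** Up to shifts the matrix is 1 + u D w with w u = 1, because p + q = 1. Its inverse is 1 + u D' w,
    since (1 + D) (1 + D') = S^m (S^m)^T = 1. Invertibility is what makes T_k dominant. *)
Lemma log_Jacobian_inv a :
  {Y | col_mx ((Sh K n a.+1)^T *m W1) ((Sh K n a)^T *m W2) *m Y = 1%:M}.
Proof.
have e : row_mx (dgf p) (dgf q) *m col_mx 1%:M 1%:M = 1%:M :> 'M[K]_n.
  by rewrite mul_row_col !mulmx1 dpq.
exists ((1%:M + col_mx 1%:M 1%:M *m (D' *m row_mx (dgf p) (dgf q)))
  *m block_mx (Sh K n a.+1) 0 0 (Sh K n a)).
have -> : col_mx ((Sh K n a.+1)^T *m W1) ((Sh K n a)^T *m W2) =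
  block_mx (Sh K n a.+1)^T 0 0 (Sh K n a)^T *m col_mx W1 W2.
  by rewrite mul_block_col !mul0mx addr0 add0r.
rewrite mulmxA -[_ *m _ *m (1%:M + _)]mulmxA WE.
set u := col_mx 1%:M 1%:M; set w := row_mx _ _.
have -> : (1%:M + u *m (D *m w)) *m (1%:M + u *m (D' *m w)) = 1%:M.
  rewrite mulmxDr mulmx1 mulmxDl mul1mx.
  have -> : u *m (D *m w) *m (u *m (D' *m w)) = u *m ((- D - D') *m w).
    by rewrite -DD' !mulmxA -[u *m D *m w *m u]mulmxA e mulmx1.
  rewrite -addrA -!mulmxDr -!mulmxDl.
  have -> : D + (D' + (- D - D')) = 0.
    by move: D D' => U V; apply/matrixP => i j; rewrite !mxE; ring.
  by rewrite mul0mx mulmx0 addr0.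
rewrite mulmx1 mulmx_block !(mul0mx, mulmx0, addr0, add0r) !trSh_mul.
by rewrite -scalar_mx_block.
Qed.
End Circulant.

(** * Rank of the structure matrix *)

Section Rank.
Variables (F : fieldType) (n m : nat).
Hypotheses (hm : (0 < m)%N) (hn : (0 < n)%N).

Let d := gcdn m n.

Lemma shift_gcd_inv (T : Type) (v : 'I_n -> T) :
  (forall i, v (i +~ m) = v i) -> forall i, v (i +~ d) = v i.
Proof.
move=> vm i.
have vmM a j : v (j +~ (a * m)) = v j.
  by elim: a j => [|a IH] j //; rewrite mulSn -shiftpD IH vm.
have [km kn e _] := egcdnP n hm.
by rewrite -[RHS](vmM km) e addnC -shiftpD mulnC shiftpnM.
Qed.

Let d0 : (0 < d)%N. Proof. by rewrite gcdn_gt0 hm. Qed.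

Lemma shift_gcd_mod (T : Type) (v : 'I_n -> T) :
  (forall i, v (i +~ m) = v i) ->
  forall i j : 'I_n, (i = j %[mod d])%N -> v i = v j.
Proof.
move=> /shift_gcd_inv vd.
have vdM a j : v (j +~ (a * d)) = v j.
  by elim: a j => [|a IH] j //; rewrite mulSn -shiftpD IH vd.
have base (i : 'I_n) : v i = v (Ordinal (leq_ltn_trans (leq_mod i d) (ltn_ord i))).
  rewrite -[RHS](vdM (i %/ d)%N); congr v; apply: val_inj.
  by rewrite shiftp_val /= addnC -divn_eq modn_small.
by move=> i j e; rewrite base [RHS]base; congr v; apply: val_inj.
Qed.

(** A vector in the left kernel is invariant under the shift by m, hence by Bezout under the shift
    by d. The kernel is thus spanned by the indicators of the d residue classes, the rows of [C]. *)
Lemma rank_Delta : \rank (Delta F n m) = (n - d)%N.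
Proof.
pose C : 'M[F]_(d, n) := \matrix_(c, j) (j %% d == c)%N%:R.
have dn : (d <= n)%N by rewrite dvdn_leq // dvdn_gcdr.
have CE : C *m \matrix_(j < n, c < d) (j == c :> nat)%:R = 1%:M.
  apply/matrixP => c c'; rewrite !mxE.
  have cn : (c' < n)%N by rewrite (leq_trans (ltn_ord c')).
  rewrite (bigD1 (Ordinal cn)) //= big1 ?addr0; last first.
    move=> j ne; rewrite !mxE (_ : (j == c' :> nat) = false) ?mulr0 //.
    by apply: contra_neqF ne => /eqP e; apply: val_inj.
  by rewrite !mxE eqxx mulr1 /= modn_small // eq_sym.
have rC : \rank C = d.
  by apply/eqP; apply/row_freeP; eexists; apply: CE.
suff e : (C == kermx (Delta F n m))%MS.
  by have := mxrank_ker (Delta F n m); rewrite -(eqmx_rank e) rC; have := rank_leq_row (Delta F n m); lia.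
apply/andP; split.
  apply/sub_kermxP; apply/matrixP => c j; rewrite mulmxBr mulmx1 [LHS]mxE mulmx_ShE !mxE.
  suff -> : ((j -~ m) %% d = j %% d)%N by rewrite subrr.
  rewrite -{2}(shiftmK j m) shiftp_val modn_dvdm ?dvdn_gcdr //.
  by rewrite -modnDmr (eqP (dvdn_gcdl m n)) addn0.
apply/row_subP => r; apply/submxP.
set v := row r _.
have : v *m Delta F n m = 0 by rewrite /v -row_mul mulmx_ker row0.
move=> v0.
have vm i : v 0 (i +~ m) = v 0 i.
  move/matrixP/(_ 0 (i +~ m)): v0; rewrite mulmxBr mulmx1 [LHS]mxE mulmx_ShE shiftpK !mxE.
  by move/eqP; rewrite subr_eq0 => /eqP.
exists (\row_(c < d) v 0 (Ordinal (leq_trans (ltn_ord c) dn))).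
apply/rowP => j; rewrite [RHS]mxE.
have jd : (j %% d < d)%N by rewrite ltn_mod.
rewrite (bigD1 (Ordinal jd)) //= big1 ?addr0; last first.
  move=> c ne; rewrite !mxE (_ : (j %% d == c)%N = false) ?mulr0 //.
  by apply: contra_neqF ne => /eqP e; apply: val_inj.
rewrite mxE [C _ _]mxE eqxx mulr1; apply: (shift_gcd_mod vm).
by rewrite /= modn_mod.
Qed.

(** By [Acirc_Delta], unimodular row and column operations reduce [Jmx] to the blocks - D and
    D^T. *)
Lemma rank_Jmx : \rank (Jmx F n m) = (2 * (n - d))%N.
Proof.
pose D := Delta F n m; pose A := Acirc F n m; pose N := Nsum F n m.
have -> : Jmx F n m = block_mx 1%:M 0 1%:M 1%:M *m (block_mx 0 1%:M 1%:M 0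
   *m block_mx (- D) 0 0 D^T) *m (block_mx 1%:M 0 N 1%:M *m block_mx 1%:M 1%:M 0 1%:M).
  rewrite !mulmx_block !(mul1mx, mulmx1, mul0mx, mulmx0, addr0, add0r).
  rewrite [D^T *m (_ + _)]mulmxDr mulmx1 -Acirc_Delta // -/D -/A /Jmx -/A -/D.
  by move: D A => U V; congr block_mx; apply/matrixP => i j; rewrite !mxE; ring.
have u1 (X : 'M[F]_n) : block_mx 1%:M 0 X 1%:M \in unitmx.
  by rewrite unitmxE det_lblock !det1 mulr1 unitr1.
have u2 : block_mx 1%:M 1%:M 0 1%:M \in (unitmx : {pred 'M[F]_(n + n)}).
  by rewrite unitmxE det_ublock !det1 mulr1 unitr1.
have u3 : block_mx 0 1%:M 1%:M 0 \in (unitmx : {pred 'M[F]_(n + n)}).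
  have : block_mx 0 1%:M 1%:M 0 *m block_mx 0 1%:M 1%:M 0 = 1%:M :> 'M[F]_(n + n).
    rewrite mulmx_block !(mul1mx, mulmx1, mul0mx, mulmx0, addr0, add0r).
    by rewrite -scalar_mx_block.
  by case/mulmx1_unit.
rewrite mxrankMfree ?row_free_unit ?unitmx_mul ?u1 //.
rewrite eqmxMfull ?row_full_unit //.
rewrite eqmxMfull ?row_full_unit //.
by rewrite rank_diag_block_mx mxrank_opp mxrank_tr rank_Delta mul2n addnn.
Qed.
End Rank.

(** * Quadratic brackets on rational functions *)

Lemma frac_numden (D : idomainType) (f : {fraction D}) :
  f = (\n_(repr f))%:F / (\d_(repr f))%:F.
Proof.
have dF (x : {ratio D}) : (\d_x)%:F != 0 :> {fraction D}.
  by rewrite tofrac_eq0 denom_ratioP.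
apply: (mulIf (dF (repr f))); rewrite divfK //.
rewrite -{1}[f]reprK; move: (repr f) => x; unlock FracField.tofrac.
rewrite -[LHS]FracField.pi_mul /FracField.mulf.
apply/eqmodP => /=; rewrite FracField.equivfE !numden_Ratio ?mulr1 ?mul1r ?oner_neq0 //.
  by rewrite mulrC.
- exact: denom_ratioP.
- exact: denom_ratioP.
Qed.

Lemma frac_ind (D : idomainType) (P : {fraction D} -> Prop) :
  (forall p q : D, q != 0 -> P (p%:F / q%:F)) -> forall f, P f.
Proof. by move=> h f; rewrite [f]frac_numden; apply: h; apply: denom_ratioP. Qed.

Lemma mpoly_alg_ind (R : comNzRingType) (N : nat) (P : {mpoly R[N]} -> Prop) :
  (forall c, P c%:MP) -> (forall a, P 'X_a) ->
  (forall p q, P p -> P q -> P (p + q)) ->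
  (forall p q, P p -> P q -> P (p * q)) -> forall p, P p.
Proof.
move=> hC hX hD hM; elim/mpolyind => [|c m p _ _ hp]; first by rewrite -mpolyC0.
apply: (hD) => //; rewrite -mul_mpolyC; apply: (hM) => //.
rewrite mpolyXE_id; elim/big_ind: _ => [|p' q'|i _]; [by rewrite -mpolyC1|exact: hM|].
elim: (m i) => [|e IH]; first by rewrite expr0 -mpolyC1.
by rewrite exprS; apply: hM.
Qed.

Lemma addr_cross_cancel (V : zmodType) (X Y u v w : V) :
  X + u + (v + w) = Y + v + (u + w) -> X = Y.
Proof.
move=> e; apply: (addIr (u + (v + w))).
by rewrite addrA e -addrA; congr (_ + _); rewrite addrCA.
Qed.

Section FieldIdentities.
Variable F : fieldType.

Lemma quotient_rule_add (p q p' q' dp dq dp' dq' : F) : q != 0 -> q' != 0 ->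
  (((dp * q' + p * dq') + (dp' * q + p' * dq)) * (q * q')
    - (p * q' + p' * q) * (dq * q' + q * dq')) / (q * q') ^+ 2
  = (dp * q - p * dq) / q ^+ 2 + (dp' * q' - p' * dq') / q' ^+ 2.
Proof. by move=> q0 q'0; field; rewrite q0 q'0. Qed.

Lemma quotient_rule_mul (p q p' q' dp dq dp' dq' : F) : q != 0 -> q' != 0 ->
  ((dp * p' + p * dp') * (q * q') - p * p' * (dq * q' + q * dq')) / (q * q') ^+ 2
  = (dp * q - p * dq) / q ^+ 2 * (p' / q') + p / q * ((dp' * q' - p' * dq') / q' ^+ 2).
Proof. by move=> q0 q'0; field; rewrite q0 q'0. Qed.

Lemma quotient_rule_of_mul (f g df dg : F) : g != 0 ->
  df = ((df * g + f * dg) * g - f * g * dg) / g ^+ 2.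
Proof. by move=> g0; field. Qed.

End FieldIdentities.

Section LogBracket.
Variables (K : fieldType) (N : nat) (D : 'I_N -> {additive K -> K}).
Hypothesis DM : forall a f g, D a (f * g) = D a f * g + f * D a g.
Hypothesis D_comm : forall a b f, D a (D b f) = D b (D a f).
Variable A : 'M[int]_N.
Hypothesis skewA : A^T = - A.

Definition ham f b : K := \sum_a D a f *~ A a b.

Definition logbr f g : K := \sum_b ham f b * D b g.

Lemma logbrE f g : logbr f g = \sum_a \sum_b (A a b)%:~R * (D a f * D b g).
Proof.
rewrite /logbr /ham exchange_big; apply: eq_bigr => b _.
by rewrite mulr_suml; apply: eq_bigr => a _; rewrite -mulrzl mulrA.
Qed.

Let skew a b : A b a = - A a b.
Proof. by have := congr1 (fun M : 'M_N => M a b) skewA; rewrite !mxE. Qed.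

Lemma logbr_skew f g : logbr f g = - logbr g f.
Proof.
rewrite !logbrE [in RHS]exchange_big -sumrN; apply: eq_bigr => a _.
rewrite -sumrN; apply: eq_bigr => b _.
by rewrite skew mulrNz; ring.
Qed.

Lemma ham_leibniz f g h : ham (f * g) h = f * ham g h + ham f h * g.
Proof.
rewrite /ham mulr_sumr mulr_suml -big_split; apply: eq_bigr => a _.
by rewrite DM mulrzDl mulrzAl mulrzAr addrC.
Qed.

Lemma hamD f g b : ham (f + g) b = ham f b + ham g b.
Proof. by rewrite /ham -big_split; apply: eq_bigr => a _; rewrite raddfD mulrzDl. Qed.

Lemma logbrD f g h : logbr (f + g) h = logbr f h + logbr g h.
Proof. by rewrite /logbr -big_split; apply: eq_bigr => b _; rewrite hamD mulrDl. Qed.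

Lemma logbr_leibniz f g h : logbr (f * g) h = f * logbr g h + logbr f h * g.
Proof.
rewrite /logbr mulr_sumr mulr_suml -big_split; apply: eq_bigr => b _.
by rewrite ham_leibniz /=; ring.
Qed.

Lemma logbr_const c h : (forall a, D a c = 0) -> logbr c h = 0.
Proof.
move=> Dc; rewrite /logbr big1 // => b _; rewrite /ham big1 ?mul0r // => a _.
by rewrite Dc mul0rz.
Qed.

(** Second derivative of h along the Hamiltonian fields of f and g, with the derivatives of these
    fields left out. It is symmetric in f and g because the [D a] commute, so the differences in
    [jac1] cancel in the cyclic sum. *)
Let S f g h := \sum_b \sum_c ham f b * ham g c * D b (D c h).

Let S_sym f g h : S f g h = S g f h.
Proof.
rewrite /S exchange_big; apply: eq_bigr => b _; apply: eq_bigr => c _.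
by rewrite D_comm; ring.
Qed.

Let jac1 f g h : logbr f (logbr g h) = S f g h - S f h g.
Proof.
rewrite {1}/logbr.
have e b : D b (logbr g h) = \sum_c ham g c * D b (D c h) - \sum_c ham h c * D b (D c g).
  have -> : \sum_c ham h c * D b (D c g) = - logbr (D b g) h.
    by rewrite -logbr_skew /logbr; apply: eq_bigr => c _; rewrite D_comm.
  rewrite opprK /logbr raddf_sum -big_split; apply: eq_bigr => c _.
  rewrite DM addrC; congr (_ + _ * _).
  by rewrite /ham raddf_sum; apply: eq_bigr => d _; rewrite raddfMz D_comm.
rewrite /S -sumrB; apply: eq_bigr => b _; rewrite e mulrBr !mulr_sumr.
by congr (_ - _); apply: eq_bigr => c _; rewrite mulrA.
Qed.

Lemma logbr_jacobi f g h :
  logbr f (logbr g h) + logbr g (logbr h f) + logbr h (logbr f g) = 0.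
Proof. by rewrite !jac1 (S_sym g f) (S_sym h f) (S_sym h g); ring. Qed.

End LogBracket.

Section Euler.
Variables (R : realType) (N : nat).
Local Notation Pol := {mpoly R[N]}.
Local Notation K := (ratfun R N).
Implicit Types (p q : Pol) (f g h : K) (a b c : 'I_N).

(** With respect to the derivations u_a d/du_a, which commute, the quadratic bracket has constant
    coefficients. *)
Definition euler a p : Pol := 'X_a * p^`M(a).

Lemma eulerD a p q : euler a (p + q) = euler a p + euler a q.
Proof. by rewrite /euler mderivD mulrDr. Qed.

Lemma eulerM a p q : euler a (p * q) = euler a p * q + p * euler a q.
Proof. by rewrite /euler mderivM; ring. Qed.

Lemma eulerC a (x : R) : euler a x%:MP = 0.
Proof. by rewrite /euler mderivC mulr0. Qed.

Lemma mderivXU a b : ('X_b : Pol)^`M(a) = (a == b)%:R.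
Proof.
rewrite mderivX mnm1E eq_sym; case: eqP => [->|_]; last by rewrite scale0r.
rewrite (_ : (U_(b) - U_(b))%MM = 0%MM) ?mpolyX0 ?scale1r //.
by apply/mnmP => i; rewrite mnmBE subnn mnm0E.
Qed.

Lemma euler_X a b : euler a 'X_b = 'X_b *+ (a == b).
Proof. by rewrite /euler mderivXU mulr_natr; case: eqP => [->|]. Qed.

Lemma euler_comm a b p : euler a (euler b p) = euler b (euler a p).
Proof.
rewrite /euler !mderivM !mderivXU mderiv_comm.
have [->|ne] := eqVneq a b; first by [].
by rewrite !mulr0n; ring.
Qed.

Fact Dr_key : unit. Proof. by []. Qed.

(* Locked, since the arithmetic of [K] is itself convertible to quotients. *)
Definition Dr a f : K := locked_with Dr_key
  (let p := \n_(repr f) in let q := \d_(repr f) in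
  (euler a p * q - p * euler a q)%:F / (q%:F) ^+ 2).

Let qF q : q != 0 -> q%:F != 0 :> K.
Proof. by rewrite tofrac_eq0. Qed.

Lemma Dr_frac a p q : q != 0 ->
  Dr a (p%:F / q%:F) = (euler a p * q - p * euler a q)%:F / (q%:F) ^+ 2.
Proof.
move=> q0; rewrite /Dr unlock; set f := p%:F / q%:F.
have : f = (\n_(repr f))%:F / (\d_(repr f))%:F by apply: frac_numden.
have : \d_(repr f) != 0 by apply: denom_ratioP.
move: \n_(repr f) \d_(repr f) => p' q' q'0; rewrite /f => /eqP.
rewrite eqr_div ?qF // -!tofracM tofrac_eq => /eqP e.
have e' := congr1 (euler a) e; rewrite !eulerM in e'.
apply/eqP; rewrite eqr_div ?expf_neq0 ?qF // -!tofracXn -!tofracM tofrac_eq.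
rewrite -subr_eq0.
set dp' := euler a p' in e' *; set dq' := euler a q' in e' *.
set dp := euler a p in e' *; set dq := euler a q in e' *.
have -> : (dp' * q' - p' * dq') * q ^+ 2 - (dp * q - p * dq) * q' ^+ 2 =
   q * q' * ((dp' * q + p' * dq) - (dp * q' + p * dq'))
   - (p' * q - p * q') * (q * dq' + q' * dq) by ring.
by rewrite e' e [p' * q]mulrC !subrr mulr0 mul0r subr0.
Qed.

Lemma DrF a p : Dr a p%:F = (euler a p)%:F.
Proof.
have := Dr_frac a p (oner_neq0 Pol).
by rewrite tofrac1 divr1 expr1n divr1 mulr1 -mpolyC1 eulerC mulr0 subr0.
Qed.

Lemma DrD a f g : Dr a (f + g) = Dr a f + Dr a g.
Proof.
elim/frac_ind: f => p q q0; elim/frac_ind: g => p' q' q'0.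
rewrite addf_div ?qF // -!tofracM -tofracD !Dr_frac ?mulf_neq0 //.
rewrite !eulerD !eulerM !(tofracB, tofracD, tofracM).
by apply: quotient_rule_add; apply: qF.
Qed.

Lemma DrM a f g : Dr a (f * g) = Dr a f * g + f * Dr a g.
Proof.
elim/frac_ind: f => p q q0; elim/frac_ind: g => p' q' q'0.
rewrite mulf_div -!tofracM !Dr_frac ?mulf_neq0 //.
rewrite !eulerM !(tofracB, tofracD, tofracM).
by apply: quotient_rule_mul; apply: qF.
Qed.

Lemma DrC a (x : R) : Dr a (ratC N x) = 0.
Proof. by rewrite /ratC DrF eulerC tofrac0. Qed.

Lemma Dr0 a : Dr a 0 = 0.
Proof. by have := DrC a 0; rewrite /ratC mpolyC0 tofrac0. Qed.

Lemma DrN a f : Dr a (- f) = - Dr a f.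
Proof. by apply/eqP; rewrite -addr_eq0 -DrD addNr Dr0. Qed.

Lemma DrB a : zmod_morphism (Dr a).
Proof. by move=> f g; rewrite DrD DrN. Qed.

HB.instance Definition _ a := GRing.isZmodMorphism.Build K K (Dr a) (DrB a).

(** The claim holds for polynomials; differentiating f q = p twice and cancelling the symmetric
    cross terms carries it over to f. *)
Lemma Dr_comm a b f : Dr a (Dr b f) = Dr b (Dr a f).
Proof.
elim/frac_ind: f => p q q0; set f := _ / _.
have e : f * q%:F = p%:F by rewrite /f divfK ?qF.
clearbody f.
have : Dr a (Dr b (f * q%:F)) = Dr b (Dr a (f * q%:F)).
  by rewrite e !DrF euler_comm.
rewrite !DrM !DrD !DrM !DrF [euler a (euler b q)]euler_comm => h.
apply: (mulIf (qF q0)).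
exact: addr_cross_cancel h.
Qed.

Lemma Dr_coord a b : Dr a (Defs.coord R b) = Defs.coord R b *+ (a == b).
Proof. by rewrite /coord DrF euler_X tofracMn. Qed.

Lemma Dr_div a f g : g != 0 -> Dr a (f / g) = (Dr a f * g - f * Dr a g) / g ^+ 2.
Proof.
move=> g0; have e : f = f / g * g by rewrite divfK.
move: (f / g) e => h ->; rewrite DrM; exact: quotient_rule_of_mul.
Qed.

Lemma coord_neq0 a : Defs.coord R a != 0.
Proof.
rewrite tofrac_eq0; apply/eqP => /(congr1 (meval (fun=> 1))).
by rewrite mevalXU meval0 => /eqP; rewrite oner_eq0.
Qed.

Definition DrA (a : 'I_N) : {additive K -> K} := Dr a.

Definition pbr (A : 'M[int]_N) : K -> K -> K := logbr DrA A.

Section Bracket.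
Variable A : 'M[int]_N.

Lemma pbrE f g :
  pbr A f g = \sum_a \sum_b (A a b)%:~R * (Dr a f * Dr b g).
Proof. exact: logbrE. Qed.

Lemma pbr_poisson : A^T = - A -> poisson_bracket (pbr A).
Proof.
move=> skewA; split=> [c f g h|f g|f g h|f g h].
- rewrite /pbr logbrD logbr_leibniz; last exact: DrM.
  by rewrite [logbr _ _ (ratC N c) h]logbr_const ?mul0r ?addr0 // => a; apply: DrC.
- exact: logbr_skew.
- by apply: logbr_leibniz; apply: DrM.
- by apply: logbr_jacobi => // *; [apply: DrM|apply: Dr_comm].
Qed.

Lemma pbr_coord a b :
  pbr A (Defs.coord R a) (Defs.coord R b) = (A a b)%:~R * (Defs.coord R a * Defs.coord R b).
Proof.
rewrite pbrE (bigD1 a) //= (bigD1 b) //= !Dr_coord !eqxx !big1 ?addr0 //.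
  move=> a' ne; rewrite big1 // => b' _.
  by rewrite Dr_coord (negPf ne) mulr0n mul0r mulr0.
by move=> b' ne; rewrite Dr_coord (negPf ne) mulr0n !mulr0.
Qed.

End Bracket.
End Euler.

Lemma factor_sub (A : comNzRingType) (z a b c d : A) :
  z * a * b - c * (z * d) = z * (a * b - c * d).
Proof. by ring. Qed.

(** * Invariance of the bracket *)

Section Pullback.
Variables (R : realType) (N : nat) (T : 'I_N -> ratfun R N).
Local Notation Pol := {mpoly R[N]}.
Local Notation K := (ratfun R N).
Local Notation pc := (poly_comp T).
Local Notation rc := (rat_comp T).
Implicit Types (p q : Pol) (f g : K) (a b c : 'I_N).

Let pcE p : pc p = mmap (@FracField.tofrac Pol \o @mpolyC N R) T p.
Proof. by []. Qed.

Lemma poly_compD p q : pc (p + q) = pc p + pc q.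
Proof. by rewrite !pcE rmorphD. Qed.

Lemma poly_compN p : pc (- p) = - pc p.
Proof. by rewrite !pcE rmorphN. Qed.

Lemma poly_compM p q : pc (p * q) = pc p * pc q.
Proof. by rewrite !pcE rmorphM. Qed.

Lemma poly_compC (x : R) : pc x%:MP = ratC N x.
Proof. by rewrite pcE mmapC. Qed.

Lemma poly_compX a : pc 'X_a = T a.
Proof. by rewrite pcE mmapX mmap1U. Qed.

Lemma poly_comp1 : pc 1 = 1.
Proof. by rewrite -mpolyC1 poly_compC /ratC mpolyC1 tofrac1. Qed.

Variable Z : 'M[K]_N.
Hypothesis DT : forall a c, Dr c (T a) = T a * Z a c.

Lemma Dr_poly_comp c p : Dr c (pc p) = \sum_a Z a c * pc (euler a p).
Proof.
elim/mpoly_alg_ind: p => [x|b|p q hp hq|p q hp hq].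
- rewrite poly_compC DrC big1 // => a _.
  by rewrite eulerC -mpolyC0 poly_compC /ratC mpolyC0 tofrac0 mulr0.
- rewrite poly_compX DT (bigD1 b) //= euler_X eqxx mulr1n poly_compX.
  rewrite big1 ?addr0; first by rewrite mulrC.
  move=> a ne; rewrite euler_X (negPf ne) mulr0n -mpolyC0 poly_compC /ratC.
  by rewrite mpolyC0 tofrac0 mulr0.
- rewrite poly_compD DrD hp hq -big_split; apply: eq_bigr => a _.
  by rewrite eulerD poly_compD mulrDr.
- rewrite poly_compM DrM hp hq mulr_suml mulr_sumr -big_split.
  apply: eq_bigr => a _.
  rewrite eulerM poly_compD !poly_compM mulrDr -mulrA; congr (_ + _).
  exact: mulrCA.
Qed.

Hypothesis T0 : forall a, T a != 0.
Variable Y : 'M[K]_N.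
Hypothesis ZY : Z *m Y = 1%:M.

Lemma msize_mderiv a p d : (msize p <= d.+1)%N -> (msize p^`M(a) <= d)%N.
Proof.
move=> pd; rewrite msizeE; apply/bigmax_leqP_seq => m hm _.
have : (m + U_(a))%MM \in msupp p.
  apply: contraTT hm; rewrite -!mcoeff_eq0 mcoeff_deriv => /eqP ->.
  by rewrite mul0rn.
by move/msize_mdeg_lt; rewrite mdegD mdeg1 addn1 => /leq_trans/(_ pd).
Qed.

Lemma mderiv_eq0_const p : (forall a, p^`M(a) = 0) -> p = (p@_0)%:MP.
Proof.
move=> p0; apply/mpolyP => m; rewrite mcoeffC.
have [->|m0] := eqVneq m 0%MM; first by rewrite mulr1.
rewrite mulr0.
have [a ma] : exists a, m a != 0%N.
  apply/existsP; rewrite -negb_forall; apply: contra m0 => /forallP h.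
  by apply/eqP/mnmP => a; rewrite mnm0E; apply/eqP.
have := congr1 (mcoeff (m - U_(a))) (p0 a); rewrite mcoeff_deriv mcoeff0.
rewrite submK; last by rewrite lep1mP.
move/eqP; rewrite -mulr_natr mulf_eq0 => /orP[/eqP //|].
by rewrite Num.Theory.pnatr_eq0.
Qed.

(* An annihilating polynomial of minimal degree would have derivatives that
   annihilate [T] as well. *)
Lemma poly_comp_inj p : pc p = 0 -> p = 0.
Proof.
move: {2}(msize p) (leqnn (msize p)) => d; elim: d p => [|d IH] p.
  by rewrite leqn0 msize_poly_eq0 => /eqP.
move=> pd p0.
have v0 : \row_a pc (euler a p) = 0.
  rewrite -[LHS]mulmx1 -ZY mulmxA; suff -> : (\row_a pc (euler a p)) *m Z = 0.
    by rewrite mul0mx.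
  apply/rowP => c; rewrite !mxE.
  transitivity (Dr c (pc p)); last by rewrite p0 Dr0.
  by rewrite Dr_poly_comp; apply: eq_bigr => a _; rewrite mxE mulrC.
have dp a : p^`M(a) = 0.
  apply: IH; first exact: msize_mderiv.
  have := congr1 (fun v : 'rV_N => v 0 a) v0; rewrite !mxE poly_compM poly_compX.
  by move/eqP; rewrite mulf_eq0 (negPf (T0 a)) => /eqP.
move: p0; rewrite (mderiv_eq0_const dp) poly_compC /ratC => /eqP.
by rewrite tofrac_eq0 => /eqP.
Qed.

Lemma poly_comp_neq0 p : p != 0 -> pc p != 0.
Proof. by apply: contra_neq; apply: poly_comp_inj. Qed.

(** Independence of the chosen representative: the cross-multiplied equality is transported by [pc],
    and no denominator is annihilated by [poly_comp_inj]. *)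
Lemma rat_comp_frac p q : q != 0 -> rc (p%:F / q%:F) = pc p / pc q.
Proof.
move=> q0; rewrite /rat_comp; set f := p%:F / q%:F.
have : f = (\n_(repr f))%:F / (\d_(repr f))%:F by apply: frac_numden.
have : \d_(repr f) != 0 by apply: denom_ratioP.
move: \n_(repr f) \d_(repr f) => p' q' q'0; rewrite /f => /eqP.
rewrite eqr_div ?tofrac_eq0 // -!tofracM tofrac_eq => /eqP e.
by apply/eqP; rewrite eqr_div ?poly_comp_neq0 // -!poly_compM e.
Qed.

Lemma rat_compF p : rc p%:F = pc p.
Proof.
by have := rat_comp_frac p (oner_neq0 Pol); rewrite tofrac1 poly_comp1 !divr1.
Qed.

Lemma rat_compD f g : rc (f + g) = rc f + rc g.
Proof.
elim/frac_ind: f => p q q0; elim/frac_ind: g => p' q' q'0.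
rewrite addf_div ?tofrac_eq0 // -!tofracM -tofracD !rat_comp_frac ?mulf_neq0 //.
by rewrite addf_div ?poly_comp_neq0 // poly_compD !poly_compM.
Qed.

Lemma rat_compM f g : rc (f * g) = rc f * rc g.
Proof.
elim/frac_ind: f => p q q0; elim/frac_ind: g => p' q' q'0.
rewrite mulf_div -!tofracM !rat_comp_frac ?mulf_neq0 //.
by rewrite mulf_div !poly_compM.
Qed.

Lemma rat_comp0 : rc 0 = 0.
Proof. by rewrite -tofrac0 rat_compF -mpolyC0 poly_compC /ratC mpolyC0. Qed.

Lemma rat_compN f : rc (- f) = - rc f.
Proof. by apply/eqP; rewrite -addr_eq0 -rat_compD addNr rat_comp0. Qed.

Lemma rat_comp_int (z : int) : rc z%:~R = z%:~R.
Proof.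
have e1 : rc 1 = 1 by rewrite -tofrac1 rat_compF poly_comp1 tofrac1.
have en m : rc m%:R = m%:R.
  by elim: m => [|m IH]; rewrite ?rat_comp0 // -natr1 rat_compD IH e1.
by case: z => m; rewrite ?NegzE ?mulrNz ?rat_compN -pmulrn ?en.
Qed.

Lemma rat_comp_sum I (r : seq I) (F : I -> K) :
  rc (\sum_(i <- r) F i) = \sum_(i <- r) rc (F i).
Proof. exact: (big_morph rc rat_compD rat_comp0). Qed.

Lemma Dr_rat_comp c f : Dr c (rc f) = \sum_a Z a c * rc (Dr a f).
Proof.
elim/frac_ind: f => p q q0; rewrite rat_comp_frac // Dr_div ?poly_comp_neq0 //.
have qF : q%:F != 0 :> K by rewrite tofrac_eq0.
rewrite !Dr_poly_comp mulr_sumr mulr_suml -sumrB mulr_suml.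
apply: eq_bigr => a _; rewrite Dr_frac // -tofracXn rat_comp_frac ?expf_neq0 //.
rewrite poly_compD poly_compN !poly_compM -expr2 [RHS]mulrA.
by congr (_ / _); apply: factor_sub.
Qed.

Lemma pbr_invariant (A : 'M[int]_N) :
  Z *m map_mx intr A *m Z^T = map_mx intr A -> bracket_invariant T (pbr A).
Proof.
move=> hA f g; rewrite !pbrE rat_comp_sum.
have -> : \sum_b \sum_c (A b c)%:~R * (Dr b (rc f) * Dr c (rc g)) =
  \sum_a \sum_a' (Z *m map_mx intr A *m Z^T) a a' * (rc (Dr a f) * rc (Dr a' g)).
  pose F := \row_a rc (Dr a f); pose G := \col_a rc (Dr a g).
  transitivity ((F *m Z *m map_mx intr A *m (Z^T *m G)) 0 0).
    rewrite mxE exchange_big; apply: eq_bigr => c _; rewrite mxE mulr_suml.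
    apply: eq_bigr => b _; rewrite !mxE !Dr_rat_comp.
    have -> : \sum_a Z a b * rc (Dr a f) = \sum_j F 0 j * Z j b.
      by apply: eq_bigr => a _; rewrite mxE mulrC.
    have -> : \sum_a Z a c * rc (Dr a g) = \sum_j Z^T c j * G j 0.
      by apply: eq_bigr => a _; rewrite !mxE.
    by rewrite mulrA [_%:~R * _]mulrC.
  rewrite mulmxA -[F *m Z *m _]mulmxA -[F *m _ *m _]mulmxA.
  rewrite [LHS]mxE exchange_big; apply: eq_bigr => a' _; rewrite mxE mulr_suml.
  apply: eq_bigr => a _; rewrite [F 0 a]mxE [G a' 0]mxE.
  by rewrite [rc _ * _ a a']mulrC mulrA.
rewrite hA; apply: eq_bigr => a _; rewrite rat_comp_sum; apply: eq_bigr => b _.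
by rewrite mxE !rat_compM rat_comp_int.
Qed.

End Pullback.

Lemma dlog_quotient (F : fieldType) (X u v dX du dv lX lu lv : F) :
  v != 0 -> dX = X * lX -> du = u * lu -> dv = v * lv ->
  dX * (u / v) + X * ((du * v - u * dv) / v ^+ 2) = X * (u / v) * (lX + lu - lv).
Proof. by move=> v0 -> -> ->; field. Qed.

Lemma index_arith k : (2 <= k)%N -> (r'_ k + (r_ k).+1 = k.-1)%N.
Proof. by rewrite /r'_ /r_; lia. Qed.

Lemma map_Jmx (K L : comNzRingType) (f : {rmorphism K -> L}) n m :
  map_mx f (Jmx K n m) = Jmx L n m.
Proof.
have hS l : map_mx f (Sh K n l) = Sh L n l.
  by apply/matrixP => i j; rewrite !mxE rmorph_nat.
have hD : map_mx f (Delta K n m) = Delta L n m.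
  by rewrite /Delta map_mxB hS map_mx1.
have hA : map_mx f (Acirc K n m) = Acirc L n m.
  rewrite /Acirc raddf_sum; apply: eq_bigr => l _ /=.
  by rewrite map_mxB -map_trmx hS.
rewrite /Jmx; move: (Acirc K n m) (Delta K n m) hA hD => A D hA hD.
by rewrite map_block_mx !map_mxB !map_mxD -map_trmx hA hD.
Qed.

Section TMap.
Variables (R : realType) (k n : nat).
Hypothesis hk : (2 <= k)%N.
Local Notation K := (ratfun R (n + n)).
Local Notation x := (@rx R n).
Local Notation y := (@ry R n).
Let m := k.-1.

Definition ssum i : K := x i + y i.

Lemma ssum_neq0 i : ssum i != 0.
Proof.
rewrite /ssum /rx /ry -tofracD tofrac_eq0; apply/eqP.
move/(congr1 (meval (fun c => (c == lshift n i)%:R))).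
rewrite mevalD !mevalXU eqxx (_ : (rshift n i == lshift n i) = false).
  by rewrite addr0 meval0 => /eqP; rewrite oner_eq0.
by rewrite eq_sym eq_lrshift.
Qed.

Definition px' i := x i / ssum i.
Definition py' i := y i / ssum i.

Lemma px'_py' i : px' i + py' i = 1.
Proof. by rewrite -mulrDl divff ?ssum_neq0. Qed.

Definition Zmx : 'M[K]_(n + n) :=
  col_mx ((Sh K n (r'_ k).+1)^T *m W1 m px' py') ((Sh K n (r'_ k))^T *m W2 m px' py').

Lemma Dr_x c i : Dr c (x i) = x i * (c == lshift n i)%:R.
Proof. by rewrite [LHS]Dr_coord mulr_natr. Qed.

Lemma Dr_y c i : Dr c (y i) = y i * (c == rshift n i)%:R.
Proof. by rewrite [LHS]Dr_coord mulr_natr. Qed.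

Definition dlog_s c i : K :=
  px' i * (c == lshift n i)%:R + py' i * (c == rshift n i)%:R.

Lemma Dr_ssum c i : Dr c (ssum i) = ssum i * dlog_s c i.
Proof.
rewrite /ssum DrD Dr_x Dr_y -/(ssum i) /dlog_s mulrDr.
by rewrite /px' /py' !mulrA ![ssum i * _]mulrC !mulfK ?ssum_neq0.
Qed.

(** As r' + 1 + r = k - 1, both factors s are indexed from the same j at distance m: up to a cyclic
    relabelling the new coordinate is x_j s_(j+m) / s_j. *)
Lemma xstarE i : xstar R k i =
  x (i -~ (r'_ k).+1) * (ssum (i -~ (r'_ k).+1 +~ m) / ssum (i -~ (r'_ k).+1)).
Proof.
rewrite /xstar -/(ssum _) -/(ssum _); congr (_ * (ssum _ / _)).
by rewrite shiftmpC shiftm_le; [congr (_ +~ _)|]; have := index_arith hk; lia.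
Qed.

Lemma ystarE i : ystar R k i =
  y (i -~ r'_ k) * (ssum (i -~ r'_ k +~ m) / ssum (i -~ r'_ k)).
Proof.
rewrite /ystar -/(ssum _) -/(ssum _); congr (_ * (ssum _ / _)).
by rewrite shiftmpC shiftm_le; [congr (_ +~ _)|]; have := index_arith hk; lia.
Qed.

Lemma T_l i : T_ R k (lshift n i) = xstar R k i.
Proof. by rewrite /T_ (unsplitK (inl i)). Qed.

Lemma T_r i : T_ R k (rshift n i) = ystar R k i.
Proof. by rewrite /T_ (unsplitK (inr i)). Qed.

Lemma split_ord_ind (P : 'I_(n + n) -> Prop) :
  (forall i, P (lshift n i)) -> (forall i, P (rshift n i)) -> forall a, P a.
Proof. by move=> hl hr a; rewrite -(splitK a); case: (split a). Qed.

Let Delta_dgf (f : 'I_n -> K) j c :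
  (Delta K n m *m dgf f) j c = f (j +~ m) * (c == j +~ m)%:R - f j * (c == j)%:R.
Proof.
rewrite mulmx_dgfE !mxE [j == c]eq_sym mulrBl; congr (_ - _).
  by case: eqP => [->|_]; rewrite ?mulr0n ?mul0r ?mulr0 // mulr1n mul1r mulr1.
by case: eqP => [->|_]; rewrite ?mulr0n ?mul0r ?mulr0 // mulr1n mul1r mulr1.
Qed.

Lemma Dr_T (a c : 'I_(n + n)) : Dr c (T_ R k a) = T_ R k a * Zmx a c.
Proof.
elim/split_ord_ind: a => i.
  rewrite T_l xstarE DrM Dr_div ?ssum_neq0 //.
  rewrite (dlog_quotient (ssum_neq0 _) (Dr_x c _) (Dr_ssum c _) (Dr_ssum c _)).
  congr (_ * _); rewrite /Zmx col_mxEu mul_trShE /W1 -addrA; move: (i -~ _) => j.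
  rewrite /dlog_s; elim/split_ord_ind: c => c.
    rewrite row_mxEl [RHS]mxE Delta_dgf !mxE !eq_lshift !eq_lrshift !mulr0 !addr0.
    by rewrite [c == j]eq_sym.
  by rewrite row_mxEr Delta_dgf ?eq_rshift ?eq_rlshift !mulr0 !add0r.
rewrite T_r ystarE DrM Dr_div ?ssum_neq0 //.
rewrite (dlog_quotient (ssum_neq0 _) (Dr_y c _) (Dr_ssum c _) (Dr_ssum c _)).
congr (_ * _); rewrite /Zmx col_mxEd mul_trShE /W2 -addrA; move: (i -~ _) => j.
rewrite /dlog_s; elim/split_ord_ind: c => c.
  by rewrite row_mxEl Delta_dgf ?eq_lshift ?eq_lrshift !mulr0 !addr0 add0r.
rewrite row_mxEr [RHS]mxE Delta_dgf !mxE ?eq_rshift ?eq_rlshift !mulr0 !add0r.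
by rewrite [c == j]eq_sym.
Qed.

Lemma T_neq0 (a : 'I_(n + n)) : T_ R k a != 0.
Proof.
have xy0 b : Defs.coord R b != 0 :> K by apply: coord_neq0.
elim/split_ord_ind: a => i; rewrite ?T_l ?T_r ?xstarE ?ystarE !mulf_neq0 ?invr_eq0 ?ssum_neq0 //.
  exact: xy0.
exact: xy0.
Qed.

Lemma Zmx_inv : {Y | Zmx *m Y = 1%:M}.
Proof. by apply: log_Jacobian_inv; apply: px'_py'. Qed.

Lemma Zmx_Jmx : Zmx *m Jmx K n m *m Zmx^T = Jmx K n m.
Proof. by apply: log_Jacobian_J; [rewrite /m; lia|apply: px'_py']. Qed.

Lemma T_bracket_invariant : bracket_invariant (@T_ R k n) (@pbr R _ (Jmx int n m)).
Proof.
have [Y hY] := Zmx_inv.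
apply: (pbr_invariant Dr_T T_neq0 hY).
by rewrite map_Jmx Zmx_Jmx.
Qed.

Lemma rat_comp_T_F p : rat_comp (@T_ R k n) p%:F = poly_comp (@T_ R k n) p.
Proof.
have [Y hY] := Zmx_inv.
exact: (rat_compF Dr_T T_neq0 hY).
Qed.

End TMap.

(** * Invariance of the spectral polynomial *)

(** Sylvester's identity, by factoring one block matrix in two ways. *)
Lemma det_1sub_mulmxC (K : comNzRingType) n (a b : 'M[K]_n) :
  \det (1%:M - a *m b) = \det (1%:M - b *m a).
Proof.
have e : block_mx (1%:M - a *m b) a 0 1%:M *m block_mx 1%:M 0 b 1%:M =
  block_mx 1%:M 0 b 1%:M *m block_mx 1%:M a 0 (1%:M - b *m a).
  by rewrite !mulmx_block !(mul1mx, mulmx1, mul0mx, mulmx0, addr0, add0r) subrK subrKC.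
have := congr1 determinant e; rewrite !det_mulmx !det_ublock !det_lblock !det1.
by rewrite !mulr1 !mul1r.
Qed.

Section Refactorization.
Variables (K : fieldType) (n m r r' : nat) (x y xs ys : 'I_n -> K) (l t : K).
Hypothesis hr : (r' + r.+1 = m)%N.
Let s i := x i + y i.
Hypotheses (s0 : forall i, s i != 0) (y0 : forall i, y i != 0).
Hypothesis xsE : forall i, xs (i +~ r'.+1) = x i * (s (i +~ m) / s i).
Hypothesis ysE : forall i, ys (i +~ r') = y i * (s (i +~ m) / s i).

(* Writing [D = A + N (s - y A)] with [A = 1 - t R] and [N = l R^m], the matrix
   [D s^-1 = P + N - N y P], [P = A s^-1], has the same determinant as
   [P + N - P y N], whose conjugate by [R^r] is the matrix of [(xs, ys)]. *)
Lemma det_Dmx_refactor : \det (Dmx m xs ys l t) = \det (Dmx m x y l t).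
Proof.
set S := Sh K n; pose A := 1%:M - t *: S 1; pose N := l *: S m.
pose Y := dgf y; pose si := dgf (fun i => (s i)^-1).
pose P := A *m si.
have ssi : si *m dgf s = 1%:M.
  by rewrite dgfM -[RHS]dgf1; apply: eq_dgf => i; rewrite mulVf.
have sis : dgf s *m si = 1%:M by rewrite dgfC.
have dsi : \det (dgf s) != 0.
  by rewrite det_dgf; apply/prodf_neq0.
have dY : \det Y != 0 by rewrite det_dgf; apply/prodf_neq0.
have DE : Dmx m x y l t = (P + N - N *m Y *m P) *m dgf s.
  rewrite /Dmx -/S -/Y; have -> : dgf x + t *: (Y *m S 1) = dgf s - Y *m A.
    rewrite /A mulmxBr mulmx1 -scalemxAr.
    by apply/matrixP => i j; rewrite !mxE mulrnDl; ring.
  rewrite -/A scalemxAl -/N mulmxBl mulmxDl /P -!mulmxA ssi mulmx1.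
  by rewrite mulmxBr addrA.
have PN : \det (P + N - N *m Y *m P) = \det (P + N - P *m Y *m N).
  apply: (mulfI dY); rewrite -!det_mulmx.
  (* After multiplication by Y the expression is 1 minus a product of two factors, so exchanging P
     and N amounts to exchanging these factors under Sylvester's identity. *)
  have e (U V : 'M[K]_n) : Y *m (U + V - U *m Y *m V) =
      1%:M - (1%:M - Y *m U) *m (1%:M - Y *m V).
    rewrite [LHS]mulmxBr [Y *m (U + V)]mulmxDr [(1%:M - Y *m U) *m _]mulmxBl mul1mx [Y *m U *m (_ - _)]mulmxBr mulmx1 !mulmxA.
    by move: (Y *m U *m Y *m V) (Y *m U) (Y *m V) => a b c; apply/matrixP => i j; rewrite !mxE; ring.
  by rewrite [P + N]addrC e det_1sub_mulmxC -e [N + P]addrC.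
rewrite DE det_mulmx PN -det_mulmx.
apply: (mulIf (det_Sh_neq0 K n r)); rewrite [RHS]mulrC -!det_mulmx; congr (\det _).
have -> : (P + N - P *m Y *m N) *m dgf s =
  A + (si *m dgf x *m N *m dgf s + t *: (S 1 *m (si *m Y *m N *m dgf s))).
  have -> : si *m dgf x = 1%:M - si *m Y.
    by rewrite -ssi -mulmxBr; congr (_ *m _); apply/matrixP => i j; rewrite !mxE mulrnDl; ring.
  rewrite mulmxBl mulmxDl /P -[A *m si *m dgf s]mulmxA ssi mulmx1.
  rewrite [(1%:M - si *m Y) *m N]mulmxBl [(_ - si *m Y *m N) *m _]mulmxBl !mul1mx.
  rewrite -[A *m si *m Y]mulmxA.
  have -> : A *m (si *m Y) *m N *m dgf s =
    si *m Y *m N *m dgf s - t *: (S 1 *m (si *m Y *m N *m dgf s)).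
    by rewrite -!mulmxA {1}/A mulmxBl mul1mx -[t *: S 1 *m _]scalemxAl.
  move: (si *m Y *m N *m dgf s) (N *m dgf s) => b c; move: (S 1 *m b) => a.
  by apply/matrixP => i j; rewrite !mxE; ring.
have cN (f : 'I_n -> K) : si *m dgf f *m N *m dgf s =
  l *: (dgf (fun i => f i * (s (i +~ m) / s i)) *m S m).
  rewrite /N -scalemxAr -scalemxAl; congr (_ *: _).
  rewrite -mulmxA Sh_dgf mulmxA !dgfM; congr (_ *m _); apply: eq_dgf => i.
  by ring.
rewrite !cN /Dmx -/S -/A [LHS]mulmxDl [RHS]mulmxDr; congr (_ + _).
  by rewrite mulmxBl mulmxBr mul1mx mulmx1 -scalemxAl -scalemxAr ShC.
have lE (U V : 'M[K]_n) :
    l *: U + t *: (S 1 *m (l *: V)) = l *: (U + t *: (S 1 *m V)).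
  by rewrite -scalemxAr scalerA [t * l]mulrC -scalerA scalerDr.
rewrite lE -[LHS]scalemxAl -[RHS]scalemxAr; congr (_ *: _).
rewrite [S m *m _]mulmxDr [LHS]mulmxDl [RHS]mulmxDr -[S m *m (t *: _)]scalemxAr.
rewrite -[_ *: _ *m S r]scalemxAl -[S r *m (_ *: _)]scalemxAr; congr (_ + _ *: _).
  rewrite mulmxA !Sh_dgf -!mulmxA !ShD addnC; congr (_ *m _).
  by apply: eq_dgf => i; rewrite -xsE shiftpD; congr (xs (_ +~ _)); lia.
rewrite !mulmxA !Sh_dgf -!mulmxA !ShD.
rewrite [S 1 *m (_ *m _)]mulmxA Sh_dgf -mulmxA ShD mulmxA Sh_dgf -mulmxA ShD.
congr (_ *m Sh K n _); last by lia.
by apply: eq_dgf => i; rewrite -ysE !shiftpD; congr (ys (_ +~ _)); lia.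
Qed.

End Refactorization.

Lemma poly_inf_roots (K : idomainType) (u : nat -> K) (p : {poly K}) :
  injective u -> (forall i, p.[u i] = 0) -> p = 0.
Proof.
move=> u_inj hp; apply/eqP/negPn/negP => p0.
have := max_poly_roots p0 (rs := [seq u i | i <- iota 0 (size p)]).
rewrite map_inj_uniq // iota_uniq size_map size_iota ltnn => h.
by suff: false by []; apply: h => //; apply/allP => z /mapP[i _ ->]; apply/rootP.
Qed.

Lemma poly2_inf_roots (K : idomainType) (u v : nat -> K) (p : {poly {poly K}}) :
  injective u -> injective v ->
  (forall a b, p.[(u b)%:P].[v a] = 0) -> p = 0.
Proof.
move=> u_inj v_inj hp; apply: (@poly_inf_roots _ (fun b => (u b)%:P)).
  by move=> a b /polyC_inj/u_inj.
by move=> b; apply: (poly_inf_roots v_inj) => a; apply: hp.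
Qed.

Section Spectral.
Variables (R : realType) (n k : nat).
Hypotheses (hk : (2 <= k)%N) (hkn : (k <= n)%N).
Local Notation Pol := {mpoly R[n + n]}.
Local Notation K := (ratfun R (n + n)).

Lemma py_neq0 i : py R i != 0 :> Pol.
Proof. by have := coord_neq0 R (rshift n i); rewrite tofrac_eq0. Qed.

Lemma map_L_ (B : idomainType) (g : {rmorphism {poly Pol} -> B}) i :
  map_mx g (L_ R k i) = Lax k (fun i => g (px R i)%:P) (fun i => g (py R i)%:P) (g 'X) i.
Proof.
apply/matrixP => a b; rewrite !mxE; cbv zeta.
case: ifP => _; do 2![case: ifP => _; first by rewrite ?rmorphM ?rmorphN ?rmorphD].
  case: ifP => _; first by rewrite rmorphN.
  by rewrite rmorph1.
case: ifP => _; first by rewrite rmorphN.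
by do 2![case: ifP => _; first by rewrite rmorph1]; rewrite rmorph0.
Qed.

Lemma spectral_morph (B : idomainType) (h : {rmorphism {poly {poly Pol}} -> B}) :
  h (spectral R n k) = \det (1%:M + h 'X *: \big[mulmx/1%:M]_(i < n)
    Lax k (fun i => h (px R i)%:P%:P) (fun i => h (py R i)%:P%:P) (h 'X%:P) i).
Proof.
rewrite /spectral -det_map_mx map_mxD map_mx1 map_mxZ /M_; congr (\det (_ + _ *: _)).
have LE i : map_mx h (map_mx polyC (L_ R k i)) =
    Lax k (fun i => h (px R i)%:P%:P) (fun i => h (py R i)%:P%:P) (h 'X%:P) i.
  by rewrite -map_mx_comp (map_L_ (h \o polyC)).
elim: (index_enum _) => [|i s IH]; first by rewrite !big_nil !map_mx1.
by rewrite !big_cons !map_mxM IH LE.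
Qed.

(** The morphism h may be an evaluation, as in [spectral_Dmx], or the formal substitution [zsub],
    which gives access to the coefficients. *)
Lemma spectral_morph_Dmx (B : idomainType) (h : {rmorphism {poly {poly Pol}} -> B})
    (x y : 'I_n -> B) (l t : B) : l != 0 -> t != 0 -> (forall i, y i != 0) ->
  (forall i, h (px R i)%:P%:P = x i) -> (forall i, h (py R i)%:P%:P = y i) ->
  h 'X%:P = l -> h 'X = - t ^+ n ->
  h (spectral R n k) = \det (Dmx k.-1 x y (l * t ^+ k.-1) t).
Proof.
move=> l0 t0 y0 /boolp.funext hx /boolp.funext hy hl ht.
pose F (X Y : 'I_n -> B) (L Z : B) := \det (1%:M + Z *: \big[mulmx/1%:M]_(i < n) Lax k X Y L i).
have E : _ = F x y l (- t ^+ n) := f_equal4 F hx hy hl ht.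
apply: (etrans (spectral_morph h)); apply: (etrans E).
by rewrite -(@det_Lax_Dmx _ n k x y l hk hkn t l0 t0 y0) /F scaleNr.
Qed.

Lemma spectral_Dmx (l t : Pol) : l != 0 -> t != 0 ->
  (spectral R n k).[(- t ^+ n)%:P].[l] =
  \det (Dmx k.-1 (@px R n) (@py R n) (l * t ^+ k.-1) t).
Proof.
move=> l0 t0.
pose ev : {rmorphism {poly {poly Pol}} -> Pol} :=
  horner_eval l \o horner_eval (- t ^+ n)%:P.
have evC c : ev (c%:P) = c.[l] by rewrite /ev /= /horner_eval hornerC.
apply: (@spectral_morph_Dmx _ ev _ _ l t l0 t0 py_neq0).
- by move=> i; rewrite evC hornerC.
- by move=> i; rewrite evC hornerC.
- by rewrite evC hornerX.
- by rewrite /ev /= /horner_eval hornerX hornerC.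
Qed.

Lemma ratfun_natr_neq0 (i : nat) : i.+1%:R != 0 :> K.
Proof.
rewrite -(rmorph_nat (@FracField.tofrac Pol)) tofrac_eq0 -mpolyC_nat mpolyC_eq0.
by rewrite Num.Theory.pnatr_eq0.
Qed.

Lemma Pol_natr_neq0 (i : nat) : i.+1%:R != 0 :> Pol.
Proof. by rewrite -mpolyC_nat mpolyC_eq0 Num.Theory.pnatr_eq0. Qed.

Lemma ratfun_natr_inj : injective (fun i : nat => i.+1%:R : K).
Proof.
move=> i j /eqP; wlog ij : i j / (i <= j)%N => [wl|].
  by case: (leqP i j) => [/wl//|/ltnW/wl h /eqP/esym/eqP/h].
rewrite eq_sym -subr_eq0 -natrB ?ltnS // subSS.
by case e : (j - i)%N => [|d]; [lia|rewrite (negPf (ratfun_natr_neq0 d))].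
Qed.

(** Interpolation nodes for z = - t ^ n; the offset c makes it possible to discard finitely many of
    them. *)
Lemma ratfun_pow_inj c : injective (fun i : nat => - (i + c).+1%:R ^+ n : K).
Proof.
move=> i j /oppr_inj; rewrite -!natrX => e.
have n0 : (0 < n)%N by lia.
have : ((i + c).+1 ^ n).-1 = ((j + c).+1 ^ n).-1.
  by apply: ratfun_natr_inj; rewrite !prednK ?expn_gt0.
move/(congr1 S); rewrite !prednK ?expn_gt0 //.
by move/eqP; rewrite eqn_exp2r // => /eqP; lia.
Qed.

Lemma map_horner2 (A B : comNzRingType) (f : {rmorphism A -> B})
    (p : {poly {poly A}}) (a b : A) :
  (map_poly (map_poly f) p).[(f b)%:P].[f a] = f p.[b%:P].[a].
Proof. by rewrite -map_polyC horner_map horner_map. Qed.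

Lemma I_coef (B : comNzRingType) (f : {rmorphism Pol -> B}) i j :
  (map_poly (map_poly f) (spectral R n k))`_j`_i = f (I_ R k n i j).
Proof. by rewrite coef_map coef_map. Qed.

Lemma I_invariant i j :
  rat_comp (@T_ R k n) (I_ R k n i j)%:F = (I_ R k n i j)%:F.
Proof.
rewrite (rat_comp_T_F hk).
pose pc : {rmorphism Pol -> K} :=
  mmap (@FracField.tofrac Pol \o @mpolyC (n + n) R) (@T_ R k n).
(* The spectral polynomials of T_k(x, y) and of (x, y) are compared at integer nodes, where both are
   determinants related by [det_Dmx_refactor]. *)
suff e : map_poly (map_poly pc) (spectral R n k) =
    map_poly (map_poly (@FracField.tofrac Pol)) (spectral R n k).
  by rewrite -[LHS](I_coef pc) e (I_coef (@FracField.tofrac Pol)).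
apply/eqP; rewrite -subr_eq0; apply/eqP.
apply: (poly2_inf_roots (@ratfun_pow_inj 0) ratfun_natr_inj) => a b.
rewrite hornerD hornerN hornerD hornerN.
have ev (f : {rmorphism Pol -> K}) :
    (map_poly (map_poly f) (spectral R n k)).[(- (b + 0).+1%:R ^+ n)%:P].[a.+1%:R]
    = \det (Dmx k.-1 (f \o @px R n) (f \o @py R n) (a.+1%:R * (b + 0).+1%:R ^+ k.-1) (b + 0).+1%:R).
  rewrite -!(rmorph_nat f) -rmorphXn -rmorphN map_horner2 spectral_Dmx ?Pol_natr_neq0 //.
  by rewrite -det_map_mx map_Dmx rmorphM rmorphXn.
rewrite (ev pc) (ev (@FracField.tofrac Pol)); apply/eqP; rewrite subr_eq0; apply/eqP.
apply: (det_Dmx_refactor (r := r_ k) (r' := r'_ k)).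
- exact: index_arith.
- exact: ssum_neq0.
- by move=> u; rewrite tofrac_eq0 py_neq0.
- move=> u; rewrite -[LHS]/(poly_comp (@T_ R k n) _) poly_compX T_l (xstarE _ hk).
  by rewrite shiftpK.
- move=> u; rewrite -[LHS]/(poly_comp (@T_ R k n) _) poly_compX T_r (ystarE _ hk).
  by rewrite shiftpK.
Qed.

End Spectral.

(** * Involution *)

Section JacobiFormula.
Variables (K : comNzRingType) (L : comNzRingType) (f : {rmorphism K -> L}).
Variable (d : {additive K -> L}).
Hypothesis dM : forall a b, d (a * b) = d a * f b + f a * d b.

Let d1 : d 1 = 0.
Proof.
by have := dM 1 1; rewrite mulr1 rmorph1 mulr1 mul1r => /eqP; rewrite -subr_eq0 opprD addrA subrr sub0r oppr_eq0 => /eqP.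
Qed.

Lemma der_prod (I : eqType) (r : seq I) (F : I -> K) : uniq r ->
  d (\prod_(i <- r) F i) =
  \sum_(i <- r) \prod_(j <- r) (if j == i then d (F j) else f (F j)).
Proof.
elim: r => [|a r IH] /=; first by rewrite !big_nil d1.
case/andP => ar ur; rewrite !big_cons dM IH //; congr (_ + _).
  rewrite eqxx rmorph_prod; congr (_ * _); rewrite !big_seq; apply: eq_bigr => j jr.
  by case: eqP => // ja; rewrite -ja jr in ar.
rewrite mulr_sumr !big_seq; apply: eq_bigr => i ir; rewrite big_cons.
by case: eqP => // ai; rewrite ai ir in ar.
Qed.

Lemma der_sign (b : bool) a : d ((-1) ^+ b * a) = (-1) ^+ b * d a.
Proof. by case: b; rewrite ?expr1 ?expr0 ?mulN1r ?mul1r ?raddfN. Qed.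

(** Jacobi's formula for a derivation along a ring morphism f. With f the identity it serves the
    brackets, with f an evaluation it serves tangent vectors at a point. *)
Lemma der_det n (M : 'M[K]_n) :
  d (\det M) = \tr (\adj (map_mx f M) *m map_mx d M).
Proof.
pose N i := \matrix_(a, b) (if a == i then d (M a b) else f (M a b)).
transitivity (\sum_i \det (N i)).
  rewrite /determinant raddf_sum exchange_big; apply: eq_bigr => s _ /=.
  rewrite der_sign der_prod ?index_enum_uniq // mulr_sumr; apply: eq_bigr => i _.
  by congr (_ * _); apply: eq_bigr => j _; rewrite mxE.
rewrite mxtrace_mulC /mxtrace; apply: eq_bigr => i _.
rewrite (expand_det_row _ i) mxE; apply: eq_bigr => j _.
rewrite !mxE eqxx; congr (_ * _); rewrite /cofactor; congr (_ * \det _).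
by apply/matrixP => a b; rewrite !mxE eq_sym (negPf (neq_lift _ _)).
Qed.

End JacobiFormula.

Section TwistedProjection.
Variables (K : fieldType) (n : nat) (rho : K).
Implicit Types X Y : 'M[K]_n.

Let e (i j : 'I_n) : nat := ((i + (n - j)) %% n)%N.

(* For [rho = t' / t], [Pi] turns multiplication by [t' S] into multiplication by
   [t S], up to a correction that only involves a diagonal ([Pi_Sh], [Sh_Pi]). *)
Definition Pi X : 'M[K]_n := \matrix_(i, j) (rho ^+ e i j * X i j).

Definition dg X : 'M[K]_n := dgf (fun i => X i i).

Let kap := 1 - rho ^+ n.

Let e_shift a i j : e (i +~ a) (j +~ a) = e i j.
Proof.
have il := ltn_ord i; have jl := ltn_ord j.
suff : ((j +~ a) + ((i +~ a) + (n - (j +~ a))) = (j +~ a) + (i + (n - j)) %[mod n])%N.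
  move/eqP; rewrite eqn_modDl => /eqP h; exact: h.
have jl' := ltn_ord (j +~ a).
have -> : ((j +~ a) + ((i +~ a) + (n - (j +~ a))) = (i +~ a) + n)%N by lia.
rewrite modnDr [in LHS]shiftp_val modn_mod [val (j +~ a)]shiftp_val modnDml.
have -> : (j + a + (i + (n - j)) = i + a + n)%N by lia.
by rewrite modnDr.
Qed.

Let e0 i : e i i = 0%N.
Proof. by rewrite /e subnKC ?modnn // ltnW. Qed.

(** Shifting the column index back raises the exponent by one, except that it falls from n - 1 to 0
    on reaching the diagonal. This is the source of the correction with factor [kap] = 1 - rho ^
    n. *)
Let e_pred i j : e i (j -~ 1) = if j -~ 1 == i then 0%N else (e i j).+1.
Proof.
case: eqP => [->|ne]; first exact: e0.
have [j' jE] : {j' | j = j' +~ 1} by exists (j -~ 1); rewrite shiftmK.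
subst j.
rewrite shiftpK in ne *.
have il := ltn_ord i; have jl := ltn_ord j'.
have ne' : i <> j' :> nat by move=> h; apply: ne; apply: val_inj; rewrite /= h.
rewrite /e shiftp_val.
have [j1|j1] := ltnP (j' + 1) n.
  rewrite [((j' + 1) %% n)%N]modn_small //.
  have [ij|ij] := ltnP i j'.
    by rewrite !modn_small; lia.
  have -> : (i + (n - j') = (i - j') + n)%N by lia.
  have -> : (i + (n - (j' + 1)) = (i - j' - 1) + n)%N by lia.
  by rewrite !modnDr !modn_small; lia.
have -> : (j' + 1 = n)%N by lia.
by rewrite modnn subn0 modnDr !modn_small; lia.
Qed.

Let e_last i j : j -~ 1 = i -> (e i j).+1 = n.
Proof.
move=> <-; have [j' ->] : {j' | j = j' +~ 1} by exists (j -~ 1); rewrite shiftmK.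
rewrite shiftpK /e shiftp_val; have jl := ltn_ord j'.
have [j1|j1] := ltnP (j' + 1) n.
  by rewrite [((j' + 1) %% n)%N]modn_small // modn_small; lia.
have -> : (j' + 1 = n)%N by lia.
by rewrite modnn subn0 modnDr modn_small; lia.
Qed.

Lemma PiD X Y : Pi (X + Y) = Pi X + Pi Y.
Proof. by apply/matrixP => i j; rewrite !mxE mulrDr. Qed.

Lemma PiZ c X : Pi (c *: X) = c *: Pi X.
Proof. by apply/matrixP => i j; rewrite !mxE mulrCA. Qed.

Lemma PiB X Y : Pi (X - Y) = Pi X - Pi Y.
Proof. by rewrite PiD -scaleN1r PiZ scaleN1r. Qed.

Lemma Pi_dgfl f X : Pi (dgf f *m X) = dgf f *m Pi X.
Proof. by apply/matrixP => i j; rewrite mxE !mul_dgfE mxE mulrCA. Qed.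

Lemma Pi_dgfr f X : Pi (X *m dgf f) = Pi X *m dgf f.
Proof. by apply/matrixP => i j; rewrite mxE !mulmx_dgfE mxE mulrA. Qed.

Lemma Pi_conj a X : Pi ((Sh K n a)^T *m X *m Sh K n a) = (Sh K n a)^T *m Pi X *m Sh K n a.
Proof.
apply/matrixP => i j; rewrite mxE !mulmx_ShE !mul_trShE mxE; congr (_ ^+ _ * _).
by rewrite -(e_shift a (i -~ a)) !shiftmK.
Qed.

Lemma Pi_Sh X : Pi X *m Sh K n 1 = rho *: Pi (X *m Sh K n 1) + kap *: (dg X *m Sh K n 1).
Proof.
apply/matrixP => i j.
transitivity (rho * (rho ^+ e i j * X i (j -~ 1)) + kap * (X i i *+ (i == j -~ 1))).
  rewrite mulmx_ShE mxE e_pred [i == _]eq_sym.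
  case: eqP => [ij|_]; last by rewrite mulr0n mulr0 addr0 exprS mulrA.
  by rewrite mulr1n mulrA -exprS (e_last ij) ij /kap; ring.
rewrite [RHS]mxE; congr (_ + _); rewrite [RHS]mxE; congr (_ * _).
  by rewrite mxE mulmx_ShE.
by rewrite mulmx_ShE dgfE.
Qed.

Lemma Sh_Pi X : Sh K n 1 *m Pi X = rho *: Pi (Sh K n 1 *m X) + kap *: (Sh K n 1 *m dg X).
Proof.
apply/matrixP => i j.
transitivity (rho * (rho ^+ e i j * X (i +~ 1) j) + kap * (X j j *+ (i +~ 1 == j))).
  rewrite mul_ShE mxE -{1}[j](shiftmK j 1) e_shift e_pred.
  have -> : (i +~ 1 == j) = (j -~ 1 == i) by rewrite eq_sym eq_shiftp eq_sym.
  case: eqP => [ij|_]; last by rewrite mulr0n mulr0 addr0 exprS mulrA.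
  by rewrite mulr1n mulrA -exprS (e_last ij) -ij shiftmK /kap; ring.
rewrite [RHS]mxE; congr (_ + _); rewrite [RHS]mxE; congr (_ * _).
  by rewrite mxE mul_ShE.
by rewrite mul_ShE dgfE; case: eqP => [->|].
Qed.

Lemma tr_Pi X : \tr (Pi X) = \tr X.
Proof. by apply: eq_bigr => i _; rewrite mxE e0 expr0 mul1r. Qed.

End TwistedProjection.

Section Gradient.
Variables (K : fieldType) (n m : nat).
Hypothesis hm : (0 < m)%N.
Variables (x y : 'I_n -> K) (l t : K).
Let D := Dmx m x y l t.
Hypothesis uD : D \in unitmx.
Let g := invmx D.
Let S := Sh K n.

(* The logarithmic derivatives of [\det D] with respect to [x_i] and [y_i]. *)
Definition gradx : 'cV[K]_n := \col_i (l * x i * (g *m S m) i i).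
Definition grady : 'cV[K]_n := \col_i (l * t * y i * (S 1 *m g *m S m) i i).

Definition diag0 : 'cV[K]_n := \col_i g i i.
Definition diag1 : 'cV[K]_n := \col_i (t * g (i +~ 1) i).

Definition Dvar (a b : 'I_n -> K) : 'M[K]_n :=
  l *: (S m *m (dgf a + t *: (dgf b *m S 1))).

Lemma mxtrace_Dvar a b :
  \tr (g *m Dvar a b) =
  \sum_i (a i * (l * (g *m S m) i i) + b i * (l * t * (S 1 *m g *m S m) i i)).
Proof.
rewrite /Dvar -scalemxAr mxtraceZ mulmxA mulmxDr mxtraceD.
have -> : \tr (g *m S m *m (t *: (dgf b *m S 1))) = t * \tr (S 1 *m g *m S m *m dgf b).
  by rewrite -scalemxAr mxtraceZ mulmxA mxtrace_mulC !mulmxA.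
rewrite big_split mulrDr mulrA; congr (_ + _).
  by rewrite mulr_sumr; apply: eq_bigr => i _; rewrite mulmx_dgfE; ring.
by rewrite mulr_sumr; apply: eq_bigr => i _; rewrite mulmx_dgfE; ring.
Qed.

Let DE : D = 1%:M - t *: S 1 + Dvar x y. Proof. by []. Qed.

Lemma Dmx_mulE (M : 'M[K]_n) i j : (D *m M) i j =
  M i j - t * M (i +~ 1) j
  + l * (x (i +~ m) * M (i +~ m) j + t * (y (i +~ m) * M (i +~ m +~ 1) j)).
Proof.
have e1 : (t *: S 1 *m M) i j = t * M (i +~ 1) j by rewrite -scalemxAl mxE mul_ShE.
have e2 : (Dvar x y *m M) i j =
  l * (x (i +~ m) * M (i +~ m) j + t * (y (i +~ m) * M (i +~ m +~ 1) j)).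
  rewrite /Dvar -scalemxAl mxE -mulmxA mul_ShE mulmxDl mxE mul_dgfE.
  by rewrite -scalemxAl mxE -mulmxA mul_dgfE mul_ShE.
rewrite DE mulmxDl mulmxBl mul1mx [LHS]mxE e2; congr (_ + _).
by rewrite [LHS]mxE; congr (_ + _); rewrite [LHS]mxE e1.
Qed.

Lemma mul_DmxE (M : 'M[K]_n) i j : (M *m D) i j =
  M i j - t * M i (j -~ 1)
  + l * ((M *m S m) i j * x j + t * ((M *m S m) i (j -~ 1) * y (j -~ 1))).
Proof.
have e1 : (M *m (t *: S 1)) i j = t * M i (j -~ 1) by rewrite -scalemxAr mxE mulmx_ShE.
have e2 : (M *m Dvar x y) i j =
  l * ((M *m S m) i j * x j + t * ((M *m S m) i (j -~ 1) * y (j -~ 1))).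
  have e3 : (M *m S m *m (t *: (dgf y *m S 1))) i j = t * ((M *m S m) i (j -~ 1) * y (j -~ 1)).
    by rewrite -scalemxAr mxE mulmxA mulmx_ShE mulmx_dgfE.
  by rewrite /Dvar -scalemxAr mxE mulmxA mulmxDr mxE mulmx_dgfE e3.
rewrite DE mulmxDr mulmxBr mulmx1 [LHS]mxE e2; congr (_ + _).
by rewrite [LHS]mxE; congr (_ + _); rewrite [LHS]mxE e1.
Qed.

Let gxE i : gradx i 0 = l * x i * g i (i -~ m).
Proof. by rewrite mxE mulmx_ShE. Qed.

Let gyE i : grady i 0 = l * t * y i * g (i +~ 1) (i -~ m).
Proof. by rewrite mxE mulmx_ShE mul_ShE. Qed.

Let d0E i : diag0 i 0 = g i i. Proof. by rewrite mxE. Qed.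
Let d1E i : diag1 i 0 = t * g (i +~ 1) i. Proof. by rewrite mxE. Qed.

(** Read off the diagonal of D g = 1, just as [colrel] is read off the diagonal of g D = 1. *)
Let rowrel i : diag0 i 0 - diag1 i 0 + (gradx + grady) (i +~ m) 0 = 1.
Proof.
have := congr1 (fun M : 'M_n => M i i) (mulmxV uD).
rewrite -/g Dmx_mulE [RHS]mxE eqxx mulr1n => <-.
rewrite d0E d1E [(gradx + grady) (i +~ m) 0]mxE gxE gyE shiftpK.
by ring.
Qed.

Let colrel i : diag0 (i +~ 1) 0 - diag1 i 0 + gradx (i +~ 1) 0 + grady i 0 = 1.
Proof.
have := congr1 (fun M : 'M_n => M (i +~ 1) (i +~ 1)) (mulVmx uD).
rewrite -/g mul_DmxE [RHS]mxE eqxx mulr1n => <-.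
by rewrite d0E d1E gxE gyE !mulmx_ShE !shiftpK; ring.
Qed.

Let w : 'cV[K]_n := gradx + grady.

Let tele : S 1 *m Nsum K n m - Nsum K n m = S m - S 1.
Proof.
rewrite /Nsum mulmx_sumr -sumrB.
rewrite (eq_bigr (fun j => Sh K n j.+1 - Sh K n j)); last first.
  by move=> j _; rewrite ShD add1n.
by rewrite telescope_sumr.
Qed.

Lemma trDelta_mulE (c : 'cV[K]_n) i : ((Delta K n m)^T *m c) i 0 = c (i -~ m) 0 - c i 0.
Proof. by rewrite trDelta mulmxBl mul1mx [LHS]mxE mul_trShE [X in _ + X]mxE. Qed.

Let Deltac (c : 'cV[K]_n) i : (Delta K n m *m c) i 0 = c (i +~ m) 0 - c i 0.
Proof. by rewrite mulmxBl mul1mx [LHS]mxE mul_ShE [X in _ + X]mxE. Qed.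

Let colB (a b : 'cV[K]_n) i : (a - b) i 0 = a i 0 - b i 0.
Proof. by rewrite [LHS]mxE [X in _ + X]mxE. Qed.

Let colD (a b : 'cV[K]_n) i : (a + b) i 0 = a i 0 + b i 0.
Proof. by rewrite [LHS]mxE. Qed.

Let diag0E : (Delta K n m)^T *m (Nsum K n m *m w + grady) = (Delta K n m)^T *m diag0.
Proof.
(* The difference of [colrel] and [rowrel] at i says that c is invariant under the shift by one,
   hence killed by [Delta^T]. The sums in [Nsum] are there to make this difference telescope. *)
pose c : 'cV[K]_n := diag0 - (Nsum K n m *m w + grady).
have Sc : S 1 *m c = c.
  apply/eqP; rewrite -subr_eq0; apply/eqP.
  have -> : S 1 *m c - c = (S 1 *m diag0 - diag0) - ((S m - S 1) *m w + (S 1 *m grady - grady)).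
    rewrite -tele /c !mulmxBr mulmxDr mulmxBl !mulmxA.
    by move: (S 1 *m _) (S 1 *m _ *m w) (Nsum K n m *m w) (S 1 *m _) => a b d e; apply/matrixP => i j; rewrite !mxE; ring.
  apply/colP => i; rewrite mulmxBl !colB [(_ - _ + _ : 'cV_n) i 0]colD !colB.
  rewrite !mul_ShE /w !(colD gradx) [RHS]mxE.
  have := colrel i; have := rowrel i; rewrite colD.
  move: (diag0 (i +~ 1) 0) (diag0 i 0) (diag1 i 0) (gradx (i +~ m) 0)
    (grady (i +~ m) 0) (gradx (i +~ 1) 0) (grady i 0) (grady (i +~ 1) 0).
  move=> a b d p q u v r e1 e2.
  transitivity ((a - d + u + v) - (b - d + (p + q))); first by ring.
  by rewrite e1 e2 subrr.
have Smc a : S a *m c = c.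
  elim: a => [|a IH]; first by rewrite /S Sh0 mul1mx.
  by rewrite /S -(add1n a) -ShD -mulmxA -/(S a) IH Sc.
have : (Delta K n m)^T *m c = 0.
  by rewrite trDelta mulmxBl mul1mx -{1}(Smc m) mulmxA trSh_mul mul1mx subrr.
by rewrite /c mulmxBr => /eqP; rewrite subr_eq0 => /eqP.
Qed.

(** In logarithmic coordinates this is, up to sign, the Hamiltonian field of log det D: differences,
    at distance m, of the entries of D^-1 on the diagonal and next to it. *)
Lemma Jmx_gradient : Jmx K n m *m col_mx gradx grady =
  col_mx ((Delta K n m)^T *m diag0) ((Delta K n m)^T *m diag1).
Proof.
have e1 : Acirc K n m *m gradx + (Acirc K n m + (Delta K n m)^T) *m grady =
    (Delta K n m)^T *m diag0.
  rewrite -diag0E mulmxDl addrA -mulmxDr [in LHS]Acirc_Delta // -!mulmxA -mulmxDr.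
  by [].
rewrite mul_block_col e1; congr col_mx.
have -> : (Acirc K n m - Delta K n m) *m gradx
   + (Acirc K n m + (Delta K n m)^T - Delta K n m) *m grady =
   (Delta K n m)^T *m diag0 - Delta K n m *m w.
  have gen (F G H : 'M[K]_n) (u v : 'cV[K]_n) :
      (F - G) *m u + (H - G) *m v = F *m u + H *m v - G *m (u + v).
    by rewrite !mulmxBl mulmxDr opprD addrACA.
  by rewrite gen e1.
apply/colP => i; rewrite colB !trDelta_mulE Deltac.
have := rowrel i; have := rowrel (i -~ m); rewrite shiftmK -/w.
move: (diag0 _ 0) (diag0 i 0) (diag1 _ 0) (diag1 i 0) (w i 0) (w _ 0) => a b c d u v e1' e2'.
apply/eqP; rewrite -subr_eq0; apply/eqP.
by transitivity ((a - c + u) - (b - d + v)); [ring|rewrite e1' e2' subrr].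
Qed.

(* [\sum_i (gradx_i {log x_i, h} + grady_i {log y_i, h})] is a trace. *)
Lemma gradient_trace (a b : 'cV[K]_n) :
  (col_mx gradx grady)^T *m col_mx a b =
  (\tr (g *m Dvar (fun i => x i * a i 0) (fun i => y i * b i 0)))%:M.
Proof.
rewrite tr_col_mx mul_row_col mxtrace_Dvar; apply/matrixP => i j.
rewrite !ord1 [RHS]mxE eqxx mulr1n mxE [X in X + _]mxE [X in _ + X]mxE -big_split.
by apply: eq_bigr => u _; rewrite ![(_^T) _ _]mxE mxE [grady _ _]mxE /=; ring.
Qed.

End Gradient.

Section Involution.
Variables (K : fieldType) (n m : nat).
Variables (x y : 'I_n -> K) (l t l' t' : K).
Let S := Sh K n.
Let D : 'M[K]_n := Dmx m x y l t.
Let D' : 'M[K]_n := Dmx m x y l' t'.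
Hypotheses (uD : D \in unitmx) (uD' : D' \in unitmx).
Hypotheses (l'0 : l' != 0) (t0 : t != 0).
Let rho := t' / t.
Hypothesis rho1 : rho ^+ n != 1.
Let g : 'M[K]_n := invmx D.
Let g' : 'M[K]_n := invmx D'.
Let kap := 1 - rho ^+ n.
Let A : 'M[K]_n := 1%:M - t *: S 1.
Let A' : 'M[K]_n := 1%:M - t' *: S 1.
Let Q : 'M[K]_n := dgf x + t *: (dgf y *m S 1).
Let Q' : 'M[K]_n := dgf x + t' *: (dgf y *m S 1).
Let P : 'M[K]_n -> 'M[K]_n := @Pi K n rho.

Let trho : t * rho = t'.
Proof. by rewrite /rho mulrC divfK. Qed.

Let P_A X : P X *m A = P (X *m A') - (t * kap) *: (dg X *m S 1).
Proof.
rewrite /P /A /A' !mulmxBr !mulmx1 PiB -!scalemxAr Pi_Sh PiZ scalerDr !scalerA trho.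
by rewrite opprD addrA.
Qed.

Let A_P X : A *m P X = P (A' *m X) - (t * kap) *: (S 1 *m dg X).
Proof.
rewrite /P /A /A' !mulmxBl !mul1mx PiB -!scalemxAl Sh_Pi PiZ scalerDr !scalerA trho.
by rewrite opprD addrA.
Qed.

Let P_Q X : P X *m Q = P (X *m Q') + (t * kap) *: (dg X *m dgf y *m S 1).
Proof.
rewrite /P /Q /Q' !mulmxDr PiD Pi_dgfr -addrA; congr (_ + _).
rewrite -!scalemxAr PiZ !mulmxA -trho -scalerA -[t * kap *: _]scalerA -scalerDr.
congr (_ *: _); rewrite -Pi_dgfr Pi_Sh; congr (_ + _ *: (_ *m _)).
by rewrite /dg dgfM; apply: eq_dgf => i; rewrite mulmx_dgfE.
Qed.

Let Q_P X : Q *m P X = P (Q' *m X) + (t * kap) *: (dgf y *m S 1 *m dg X).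
Proof.
rewrite /P /Q /Q' !mulmxDl PiD Pi_dgfl -addrA; congr (_ + _).
rewrite -!scalemxAl PiZ -!mulmxA -trho -scalerA -[t * kap *: _]scalerA -scalerDr.
by congr (_ *: _); rewrite Pi_dgfl Sh_Pi mulmxDr -!scalemxAr.
Qed.

Let d0 := diag0 m x y l' t'.
Let d1 := diag1 m x y l' t'.
Let ha i := d0 (i -~ m) 0 - d0 i 0.
Let hb i := d1 (i -~ m) 0 - d1 i 0.

(** Origin of U and V: A' g' and g' A' intertwine A', as A' g' A' has two readings, and also S^m Q',
    by [comm_B']. The map [Pi] carries these relations from t' to t up to diagonal terms.
    Subtracting [kap *: dg g'] makes the first relation exact ([UA]), so that the whole defect
    appears in the second one ([UB]). *)
Let U : 'M[K]_n := P (A' *m g') - kap *: dg g'.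
Let V : 'M[K]_n := P (g' *m A') - kap *: dg g'.

Let subZ_mul (X Y Z : 'M[K]_n) c : (X - c *: Y) *m Z = X *m Z - c *: (Y *m Z).
Proof. by rewrite mulmxBl scalemxAl. Qed.

Let mul_subZ (X Y Z : 'M[K]_n) c : Z *m (X - c *: Y) = Z *m X - c *: (Z *m Y).
Proof. by rewrite mulmxBr scalemxAr. Qed.

Let mxD (X Y : 'M[K]_n) i j : (X + Y) i j = X i j + Y i j.
Proof. by rewrite mxE. Qed.

Let mxN (X : 'M[K]_n) i j : (- X) i j = - X i j.
Proof. by rewrite mxE. Qed.

Let mxZ c (X : 'M[K]_n) i j : (c *: X) i j = c * X i j.
Proof. by rewrite mxE. Qed.

Let entries := (mxD, mxN, mxZ, mul_dgfE, dgfE).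

Let dgg' : dg g' = dgf (fun i => d0 i 0).
Proof. by apply: eq_dgf => i; rewrite mxE. Qed.

Let dgA'g' : dg (A' *m g') = dgf (fun i => d0 i 0 - d1 i 0).
Proof.
apply: eq_dgf => i; rewrite /A' mulmxBl mul1mx -scalemxAl !entries mul_ShE.
by rewrite /d0 /d1 [in RHS]mxE [X in _ = _ - X]mxE.
Qed.

Let dgg'A' : dg (g' *m A') = dgf (fun i => d0 i 0 - d1 (i -~ 1) 0).
Proof.
apply: eq_dgf => i; rewrite /A' mulmxBr mulmx1 -scalemxAr !entries mulmx_ShE.
by rewrite /d0 /d1 [in RHS]mxE [X in _ = _ - X]mxE shiftmK.
Qed.

Let UA : U *m A = A *m V.
Proof.
rewrite /U /V [LHS]subZ_mul [A *m (P _ - _)]mul_subZ P_A A_P mulmxA dgg' dgA'g' dgg'A' !Sh_dgf.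
have e1 f : dgf f *m A = dgf f - t *: (dgf f *m S 1).
  by rewrite mul_subZ mulmx1.
have e2 f : A *m dgf f = dgf f - t *: (dgf (fun i => f (i +~ 1)) *m S 1).
  by rewrite subZ_mul mul1mx Sh_dgf.
rewrite e1 e2; move: (P _) => X; apply/matrixP => i j; rewrite !entries shiftpK.
by ring.
Qed.

Let D'E : D' = A' + l' *: (S m *m Q'). Proof. by []. Qed.
Let DE : D = A + l *: (S m *m Q). Proof. by []. Qed.

(** With B' = S^m Q', so that l' B' = D' - A', both sides times l' equal A' - A' g' A'. *)
Let comm_B' : A' *m g' *m (S m *m Q') = S m *m Q' *m (g' *m A').
Proof.
have e1 : l' *: (g' *m (S m *m Q')) = 1%:M - g' *m A'.
  have : g' *m D' = 1%:M by apply: mulVmx.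
  by rewrite D'E mulmxDr -scalemxAr => <-; rewrite addrAC subrr add0r.
have e2 : l' *: (S m *m Q' *m g') = 1%:M - A' *m g'.
  have : D' *m g' = 1%:M by apply: mulmxV.
  by rewrite D'E mulmxDl -scalemxAl => <-; rewrite addrAC subrr add0r.
apply: (scalerI l'0).
rewrite -mulmxA scalemxAr e1 [in RHS]mulmxA scalemxAl e2.
by rewrite [LHS]mulmxBr [RHS]mulmxBl mulmx1 mul1mx mulmxA.
Qed.

Let conj_dgf f : (S m)^T *m dgf f *m S m = dgf (fun i => f (i -~ m)).
Proof.
apply/matrixP => i j; rewrite mulmx_ShE mul_trShE !dgfE.
by rewrite (inj_eq (@shiftm_inj _ m)).
Qed.

(** By [comm_B'] the main terms under [P] agree. The diagonal corrections of U pass through S^m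
    while those of V do not, which leaves the differences [ha] and [hb] between i - m and i, the
    field found in [Jmx_gradient]. *)
Let UB : U *m (S m *m Q) - S m *m Q *m V =
  - kap *: (S m *m (dgf (fun i => x i * ha i) + t *: (dgf (fun i => y i * hb i) *m S 1))).
Proof.
pose Y' := (S m)^T *m (A' *m g') *m S m.
have conjU : (S m)^T *m U *m S m = P Y' - kap *: dgf (fun i => d0 (i -~ m) 0).
  rewrite /U mul_subZ subZ_mul -[P Y']/(P ((S m)^T *m _ *m S m)) /P Pi_conj.
  by rewrite dgg' conj_dgf.
have dgY' : dg Y' = dgf (fun i => d0 (i -~ m) 0 - d1 (i -~ m) 0).
  rewrite -(conj_dgf (fun i => d0 i 0 - d1 i 0)) -dgA'g' conj_dgf.
  by apply: eq_dgf => i; rewrite /Y' mulmx_ShE mul_trShE.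
have Y'Q' : Y' *m Q' = Q' *m (g' *m A').
  by rewrite /Y' -!mulmxA [A' *m (g' *m _)]mulmxA comm_B' -!mulmxA mulmxA trSh_mul mul1mx.
have -> : U *m (S m *m Q) = S m *m ((S m)^T *m U *m S m *m Q).
  by rewrite !mulmxA Sh_mul_tr mul1mx.
rewrite -[S m *m Q *m V]mulmxA -mulmxBr scalemxAr; congr (_ *m _).
rewrite conjU subZ_mul P_Q Y'Q' dgY' /V [Q *m _]mul_subZ Q_P dgg'A' dgg'.
move: (P _) => X.
rewrite /Q mulmxDr mulmxDl -[dgf y *m S 1 *m _]mulmxA -!scalemxAr -!scalemxAl.
rewrite -[dgf y *m S 1 *m _]mulmxA !Sh_dgf !mulmxA !dgfM.
apply/matrixP => i j; rewrite !entries shiftpK /ha /hb.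
by ring.
Qed.

(* The flow of [\det D'] moves [D] along [U D - D V], where [\tr U = \tr V]. *)
Lemma trace_flow : \tr (g *m Dvar m l t (fun i => x i * ha i) (fun i => y i * hb i)) = 0.
Proof.
have e : U *m D - D *m V = - kap *: Dvar m l t (fun i => x i * ha i) (fun i => y i * hb i).
  rewrite DE [U *m (A + _)]mulmxDr [(A + _) *m V]mulmxDl UA -scalemxAr -scalemxAl opprD addrACA subrr add0r.
  by rewrite -scalerBr UB /Dvar !scalerA mulrC.
have k0 : - kap != 0 by rewrite oppr_eq0 subr_eq0 eq_sym.
have trP (X Y : 'M[K]_n) c : \tr (P X - c *: Y) = \tr X - c * \tr Y.
  by rewrite raddfB /= mxtraceZ tr_Pi.
have e1 : \tr (g *m (U *m D)) = \tr U.
  by rewrite mxtrace_mulC -mulmxA mulmxV // mulmx1.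
have e2 : \tr (g *m (D *m V)) = \tr V by rewrite mulmxA mulVmx // mul1mx.
apply: (mulfI k0); rewrite mulr0 -mxtraceZ scalemxAr -e mulmxBr raddfB /= e1 e2.
by rewrite /U /V !trP [\tr (A' *m g')]mxtrace_mulC subrr.
Qed.

End Involution.

Lemma DvarE (K : fieldType) n m (l t : K) (a b : 'I_n -> K) i j :
  Dvar m l t a b i j =
  l * (a (i +~ m) * (j == i +~ m)%:R + t * (b (i +~ m) * (j == i +~ m.+1)%:R)).
Proof.
have e : Dmx m a b l t i j = (1%:M - t *: Sh K n 1) i j + Dvar m l t a b i j.
  by rewrite [LHS]mxE.
have e1 : (1%:M - t *: Sh K n 1) i j = (j == i)%:R - t * (j == i +~ 1)%:R.
  by rewrite !mxE eq_sym.
by move: e; rewrite DmxE e1 => /addrI.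
Qed.

Section LogInvolution.
Variables (K : fieldType) (n m : nat) (D : 'I_(n + n) -> {additive K -> K}).
Hypothesis DM : forall c f g, D c (f * g) = D c f * g + f * D c g.
Hypothesis hm : (0 < m)%N.
Variables x y : 'I_n -> K.
Hypothesis Dx : forall c i, D c (x i) = x i * (c == lshift n i)%:R.
Hypothesis Dy : forall c i, D c (y i) = y i * (c == rshift n i)%:R.

Let D1 c : D c 1 = 0.
Proof.
have := DM c 1 1; rewrite !mulr1 !mul1r => /eqP.
by rewrite -subr_eq0 opprD addrA subrr sub0r oppr_eq0 => /eqP.
Qed.

Let D0 c (b : bool) : D c b%:R = 0.
Proof. by case: b; rewrite ?D1 ?raddf0. Qed.

Lemma D_det l t c : (forall c, D c l = 0) -> (forall c, D c t = 0) ->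
  Dmx m x y l t \in unitmx ->
  D c (\det (Dmx m x y l t)) = \det (Dmx m x y l t)
    * (col_mx (gradx m x y l t) (grady m x y l t)) c 0.
Proof.
move=> Dl Dt uD.
have DM' a b : D c (a * b) = D c a * idfun b + idfun a * D c b by apply: DM.
rewrite (der_det DM') map_mx_id //.
have -> : map_mx (D c) (Dmx m x y l t) =
    Dvar m l t (fun i => D c (x i)) (fun i => D c (y i)).
  apply/matrixP => i j; rewrite mxE DmxE DvarE.
  have DD (a b : K) : D c (a + b) = D c a + D c b by exact: raddfD.
  have DN (a : K) : D c (- a) = - D c a by exact: raddfN.
  rewrite !(DD, DN, D0, DM, Dt, Dl).
  by rewrite !(mul0r, mulr0, addr0, add0r, oppr0).
have -> : \adj (Dmx m x y l t) = \det (Dmx m x y l t) *: invmx (Dmx m x y l t).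
  rewrite /invmx uD scalerA mulfV ?scale1r //.
  by rewrite -unitfE -unitmxE.
rewrite -scalemxAl mxtraceZ mxtrace_Dvar; congr (_ * _).
elim/split_ord_ind: c {DM'} => c.
  rewrite col_mxEu mxE (bigD1 c) //= big1 ?addr0.
    by rewrite Dx Dy eqxx eq_lrshift mulr0 mul0r addr0 mulr1; ring.
  move=> i ic; rewrite Dx Dy eq_lshift eq_lrshift [c == i]eq_sym (negPf ic).
  by rewrite !mulr0 !mul0r addr0.
rewrite col_mxEd mxE (bigD1 c) //= big1 ?addr0.
  by rewrite Dx Dy eqxx eq_rlshift mulr0 mul0r add0r mulr1; ring.
move=> i ic; rewrite Dx Dy eq_rshift eq_rlshift [c == i]eq_sym (negPf ic).
by rewrite !mulr0 !mul0r addr0.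
Qed.

Lemma logbr_det l t l' t' :
  (forall c, D c l = 0) -> (forall c, D c t = 0) ->
  (forall c, D c l' = 0) -> (forall c, D c t' = 0) ->
  Dmx m x y l t \in unitmx -> Dmx m x y l' t' \in unitmx ->
  l' != 0 -> t != 0 -> (t' / t) ^+ n != 1 ->
  logbr D (Jmx int n m) (\det (Dmx m x y l t)) (\det (Dmx m x y l' t')) = 0.
Proof.
move=> Dl Dt Dl' Dt' uD uD' l'0 t0 rho1; rewrite logbrE.
set F := \det _; set F' := \det _.
pose G := col_mx (gradx m x y l t) (grady m x y l t).
pose G' := col_mx (gradx m x y l' t') (grady m x y l' t').
have eF a : D a F = F * G a 0 by apply: D_det.
have eF' a : D a F' = F' * G' a 0 by apply: D_det.
have eJ a b : (Jmx int n m a b)%:~R = Jmx K n m a b.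
  have := congr1 (fun M : 'M_(n + n) => M a b) (map_Jmx (intr : {rmorphism int -> K}) n m).
  by rewrite mxE.
clearbody F F'.
have -> : \sum_a \sum_b (Jmx int n m a b)%:~R * (D a F * D b F')
    = F * F' * (G^T *m (Jmx K n m *m G')) 0 0.
  rewrite mxE mulr_sumr; apply: eq_bigr => a _; rewrite [(_ *m _) a 0]mxE !mulr_sumr.
  apply: eq_bigr => b _; rewrite eF eF' eJ [G^T 0 a]mxE.
  by ring.
rewrite Jmx_gradient // gradient_trace [_%:M 0 0]mxE eqxx mulr1n.
set T := \tr _; suff -> : T = 0 by rewrite mulr0.
apply: (etrans _ (trace_flow uD uD' l'0 t0 rho1)); rewrite /T.
congr (\tr (_ *m _)); apply/matrixP => i j.
by rewrite !DvarE !trDelta_mulE.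
Qed.

End LogInvolution.

Lemma det_1sub_Sh (K : comNzRingType) n (t : K) :
  (1%:M - t *: Sh K n 1) *m (\sum_(0 <= j < n) t ^+ j *: Sh K n j) = (1 - t ^+ n)%:M.
Proof.
rewrite mulmx_sumr (eq_bigr (fun j => - (t ^+ j.+1 *: Sh K n j.+1) - - (t ^+ j *: Sh K n j))).
  rewrite telescope_sumr // expr0 scale1r Sh0 Shn opprK scalemx1.
  by rewrite addrC -raddfB.
move=> j _; rewrite mulmxBl mul1mx -scalemxAl -scalemxAr ShD add1n scalerA -exprS.
by rewrite opprK addrC.
Qed.

(** For a map that is merely additive, such as a bracket with a fixed function, integer evaluation
    points are essential here. *)
Lemma map_horner_additive (A B : comNzRingType) (f : {additive A -> B})
    (p : {poly A}) (z : int) : (map_poly f p).[z%:~R] = f p.[z%:~R].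
Proof.
rewrite (@horner_coef_wide _ (size p)) ?size_poly // horner_coef raddf_sum.
apply: eq_bigr => i _ /=; rewrite coef_map_id0 ?raddf0 //.
by rewrite -!rmorphXn /= !mulrzr raddfMz.
Qed.

Lemma map_horner2_additive (A B : comNzRingType) (f : {additive A -> B})
    (p : {poly {poly A}}) (z1 z2 : int) :
  (map_poly (map_poly f) p).[(z1%:~R)%:P].[z2%:~R] = f p.[(z1%:~R)%:P].[z2%:~R].
Proof.
have e (C : comNzRingType) : (z1%:~R : C)%:P = z1%:~R by rewrite rmorph_int.
by rewrite !e (map_horner_additive (map_poly f)) map_horner_additive.
Qed.

Section Involutive.
Variables (R : realType) (n k : nat).
Hypotheses (hk : (2 <= k)%N) (hkn : (k <= n)%N).
Local Notation Pol := {mpoly R[n + n]}.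
Local Notation K := (ratfun R (n + n)).
Let m := k.-1.
Let A : 'M[int]_(n + n) := Jmx int n m.

(** Here t = b + 2. The value t = 1 is avoided because 1 - S is singular, whereas [specF_neq0] tests
    the determinant at x = y = 0, where D is 1 - t S. *)
Definition specF (a b : nat) : Pol := (spectral R n k).[(- b.+2%:R ^+ n)%:P].[a.+1%:R].

Let specF_Dmx a b :
  specF a b = \det (Dmx m (@px R n) (@py R n) (a.+1%:R * b.+2%:R ^+ m) b.+2%:R).
Proof. by rewrite /specF spectral_Dmx ?Pol_natr_neq0. Qed.

Let pow_neq b b' : b != b' -> b.+1%:R ^+ n != b'.+1%:R ^+ n :> R.
Proof.
move=> bb; rewrite -!natrX Num.Theory.eqr_nat eqn_exp2r ?eqSS //.
by lia.
Qed.

Lemma specF_neq0 a b : specF a b != 0.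
Proof.
apply/eqP => /(congr1 (meval (fun=> 0))); rewrite specF_Dmx meval0.
rewrite -(det_map_mx (meval (fun=> 0))) map_Dmx.
set M := Dmx _ _ _ _ _; have -> : M = 1%:M - b.+2%:R *: Sh R n 1.
  apply/matrixP => i j; rewrite /M DmxE /= !mevalXU !mul0r mulr0 addr0 mulr0 addr0.
  by rewrite !mxE eq_sym rmorph_nat.
move=> d0; have := congr1 determinant (@det_1sub_Sh R n b.+2%:R).
rewrite det_mulmx d0 mul0r det_scalar => /esym/eqP; rewrite expf_eq0 => /andP[_].
rewrite subr_eq0 => /eqP e; have := @pow_neq b.+1 0%N isT.
by rewrite -e expr1n eqxx.
Qed.

Let specF_F a b : (specF a b)%:F =
  \det (Dmx m (@rx R n) (@ry R n) (a.+1%:R * b.+2%:R ^+ m) b.+2%:R).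
Proof.
rewrite specF_Dmx -(det_map_mx (@FracField.tofrac Pol)) map_Dmx.
by rewrite rmorphM rmorphXn !rmorph_nat.
Qed.

Let Dr_nat c i : DrA R c (i%:R : K) = 0.
Proof. by have := DrC c (i%:R : R); rewrite /ratC mpolyC_nat rmorph_nat. Qed.

Lemma pbr_specF a b a' b' : b != b' -> pbr A (specF a b)%:F (specF a' b')%:F = 0.
Proof.
move=> bb; rewrite /pbr !specF_F.
have u a0 b0 : Dmx m (@rx R n) (@ry R n) (a0.+1%:R * b0.+2%:R ^+ m) b0.+2%:R \in unitmx.
  by rewrite unitmxE unitfE -specF_F tofrac_eq0 specF_neq0.
have Dl a0 b0 c : DrA R c (a0.+1%:R * b0.+2%:R ^+ m : K) = 0.
  by rewrite -natrX -natrM Dr_nat.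
apply: (logbr_det (D := @DrA R (n + n))) => //.
- exact: DrM.
- by rewrite /m; lia.
- exact: Dr_x.
- exact: Dr_y.
- by rewrite mulf_neq0 ?expf_neq0 ?ratfun_natr_neq0.
- exact: ratfun_natr_neq0.
rewrite expr_div_n; apply/eqP => e.
have t0 : b.+2%:R ^+ n != 0 :> K by rewrite expf_neq0 ?ratfun_natr_neq0.
have := congr1 (fun u => u * b.+2%:R ^+ n) e; rewrite divfK // mul1r => e'.
have := @ratfun_pow_inj R n k hk hkn 1%N b' b; rewrite !addn1 e' => /(_ erefl) bE.
by rewrite bE eqxx in bb.
Qed.

Let skewA : A^T = - A. Proof. by apply: trJmx; rewrite /m; lia. Qed.

Let pbrB h : zmod_morphism (fun p : Pol => pbr A p%:F h).
Proof.
move=> p q; rewrite rmorphB /pbr logbrD; congr (_ + _).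
apply/eqP; rewrite -addr_eq0 -logbrD addNr.
apply/eqP; apply: logbr_const => a; exact: Dr0.
Qed.

Let intE (B : comNzRingType) (i : nat) : (- i%:R ^+ n : B) = (- (i%:Z ^+ n))%:~R.
Proof. by rewrite rmorphN rmorphXn /= -pmulrn. Qed.

(** Interpolation from the nodes b >= c only, which leaves room to avoid finitely many of them. *)
Let I_of_specF c (f : {additive Pol -> K}) :
  (forall a b, (c <= b)%N -> f (specF a b) = 0) -> forall i j, f (I_ R k n i j) = 0.
Proof.
move=> hf i j; suff e : map_poly (map_poly f) (spectral R n k) = 0.
  have := congr1 (fun p : {poly {poly K}} => p`_j`_i) e.
  by rewrite !coef_map_id0 ?raddf0 // !coef0.
apply: (poly2_inf_roots (@ratfun_pow_inj R n k hk hkn c.+1)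
  (@ratfun_natr_inj R n k hk hkn)) => a b.
rewrite intE [a.+1%:R]pmulrn map_horner2_additive -intE -pmulrn.
have := hf a (b + c)%N (leq_addl b c).
by rewrite /specF addnS.
Qed.

Lemma I_involutive i j i' j' :
  pbr A (I_ R k n i j)%:F (I_ R k n i' j')%:F = 0.
Proof.
pose phi h : {additive Pol -> K} :=
  HB.pack (fun p : Pol => pbr A p%:F h) (GRing.isZmodMorphism.Build _ _ _ (pbrB h)).
(* Only nodes b' > b are used in the first argument, so the excluded case b' = b never occurs. The
   second argument then needs no restriction. *)
have h1 a b : pbr A (I_ R k n i j)%:F (specF a b)%:F = 0.
  apply: (@I_of_specF b.+1 (phi (specF a b)%:F)) => a' b' bb.
  by apply: pbr_specF; lia.
rewrite /pbr logbr_skew // -/(pbr A _ _).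
rewrite [pbr _ _ _](@I_of_specF 0 (phi (I_ R k n i j)%:F)) ?oppr0 // => a b _.
by have := h1 a b; rewrite /pbr logbr_skew // => /eqP; rewrite oppr_eq0 => /eqP.
Qed.

End Involutive.

(** * Brackets of the coordinates and the Poisson tensor *)

Lemma eq_shiftp2 n (i : 'I_n) a b : (a < n)%N -> (b < n)%N -> (i +~ a == i +~ b) = (a == b).
Proof.
move=> an bn; apply/eqP/eqP => [/(congr1 val)|->] //.
rewrite !shiftp_val => /eqP; rewrite eqn_modDl => /eqP.
by rewrite !modn_small.
Qed.

Lemma shiftp_eq_diag n (i : 'I_n) c l : (c < n)%N -> (0 < l < n)%N -> (i == i +~ c +~ l) = (c + l == n)%N.
Proof.
move=> cn /andP[l0 ln]; have [e|ne] := altP (c + l =P n)%N.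
  by rewrite shiftpD e shiftpn eqxx.
rewrite shiftpD; have [lt|ge] := ltnP (c + l) n.
  by rewrite -[i in LHS]shiftp0 eq_shiftp2 //; lia.
rewrite -(subnK ge) -shiftpD shiftpn -[i in LHS]shiftp0 eq_shiftp2 //; lia.
Qed.

Lemma shift_ex n (i j : 'I_n) : exists2 c, (c < n)%N & j = i +~ c.
Proof.
have il := ltn_ord i; have jl := ltn_ord j; have [ij|ij] := leqP i j.
  exists (j - i)%N; first lia.
  by apply: val_inj; rewrite shiftp_val subnKC // modn_small.
exists (n + j - i)%N; first lia.
apply: val_inj; rewrite shiftp_val (_ : i + (n + j - i) = j + n)%N; last lia.
by rewrite modnDr modn_small.
Qed.

Section CirculantEntries.
Variables (n m : nat).
Hypotheses (hm : (0 < m)%N) (hmn : (m < n)%N).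
Implicit Types (i j : 'I_n) (c l : nat).

Lemma Acirc_shift i c : (c < n)%N ->
  Acirc int n m i (i +~ c) = (n - c < m)%N%:Z - ((0 < c) && (c < m))%N%:Z.
Proof.
move=> cn; rewrite /Acirc summxE.
have sumE b : \sum_(1 <= l < m) (l == b)%:Z = ((0 < b) && (b < m))%N%:Z.
  have [bm|bm] := boolP ((0 < b) && (b < m))%N.
    rewrite (bigD1_seq b) ?mem_index_iota ?iota_uniq //= eqxx big1 ?addr0 //.
    by move=> l /negPf ->.
  rewrite big1_seq // => l /andP[_]; rewrite mem_index_iota => lm.
  by case: eqP => // lb; rewrite -lb lm in bm.
rewrite (eq_big_nat _ _ (F2 := fun l => (l == n - c)%N%:Z - (l == c)%N%:Z)).
  by rewrite sumrB !sumE subn_gt0 cn.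
move=> l /andP[l1 lm]; rewrite !mxE shiftp_eq_diag ?cn //; last by lia.
rewrite eq_shiftp2 //; last by lia.
rewrite (_ : (c + l == n)%N = (l == n - c)%N); last by lia.
by rewrite [c == l]eq_sym !natz.
Qed.

Lemma Delta_shift i c : (c < n)%N ->
  Delta int n m i (i +~ c) = (c == m)%N%:Z - (c == 0)%N%:Z.
Proof.
move=> cn; rewrite !mxE eq_shiftp2 // !natz.
by rewrite -[X in X == i +~ c]shiftp0 eq_shiftp2 ?[0%N == _]eq_sym //; lia.
Qed.

Lemma trDelta_shift i c : (c < n)%N ->
  (Delta int n m)^T i (i +~ c) = (c + m == n)%N%:Z - (c == 0)%N%:Z.
Proof.
move=> cn; rewrite !mxE shiftp_eq_diag ?hm // !natz.
by rewrite -[X in _ - Posz (_ == X)]shiftp0 eq_shiftp2 //; lia.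
Qed.

End CirculantEntries.

Section Standard.
Variables (R : realType) (n k : nat).
Hypotheses (hk : (2 <= k)%N) (hkn : (k <= n)%N).
Local Notation K := (ratfun R (n + n)).
Let m := k.-1.
Let A : 'M[int]_(n + n) := Jmx int n m.

Let hm : (0 < m)%N. Proof. by rewrite /m; lia. Qed.
Let hmn : (m < n)%N. Proof. by rewrite /m; lia. Qed.

Lemma pbr_xx i c : (c < n)%N -> pbr A (rx R i) (rx R (i +~ c)) =
  ((n - c < m)%N%:Z - ((0 < c) && (c < m))%N%:Z)%:~R * (rx R i * rx R (i +~ c)).
Proof.
by move=> cn; rewrite /rx /px [LHS]pbr_coord /A /Jmx block_mxEul (Acirc_shift hm hmn).
Qed.

Lemma pbr_yx i c : (c < n)%N -> pbr A (ry R i) (rx R (i +~ c)) =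
  ((n - c < m)%N%:Z + (c == 0%N)%:Z - ((0 < c) && (c <= m))%N%:Z)%:~R
  * (ry R i * rx R (i +~ c)).
Proof.
move=> cn; rewrite /rx /px /ry /py [LHS]pbr_coord /A /Jmx block_mxEdl.
congr (_%:~R * _); rewrite mxE [X in _ + X]mxE (Acirc_shift hm hmn) // (Delta_shift hm hmn) //.
by lia.
Qed.

Lemma pbr_yy i c : (c < n)%N -> pbr A (ry R i) (ry R (i +~ c)) =
  ((n - c <= m)%N%:Z - ((0 < c) && (c <= m))%N%:Z)%:~R * (ry R i * ry R (i +~ c)).
Proof.
move=> cn; rewrite /ry /py [LHS]pbr_coord /A /Jmx block_mxEdr.
congr (_%:~R * _); rewrite mxE [X in _ + X]mxE [X in X + _]mxE.
rewrite (Acirc_shift hm hmn) // (Delta_shift hm hmn) // (trDelta_shift hm hmn) //.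
by lia.
Qed.

(** The bound n >= 2k - 1 = 2m + 1 keeps the forward range 0 < c <= m and the backward range n - c
    <= m disjoint; for smaller n their contributions overlap and may cancel. *)
Lemma pbr_standard : (2 * k - 1 <= n)%N -> standard_bracket k (@pbr R _ A).
Proof.
move=> hn2; split.
- move=> i l hl; rewrite pbr_xx; last by lia.
  by rewrite (_ : _ - _ = -1) ?mulrN1z ?mulN1r //; rewrite /m; lia.
- move=> i l hl; rewrite pbr_yy; last by lia.
  by rewrite (_ : _ - _ = -1) ?mulrN1z ?mulN1r //; rewrite /m; lia.
- move=> i l hl; rewrite pbr_yx; last by lia.
  by rewrite (_ : _ - _ = -1) ?mulrN1z ?mulN1r //; rewrite /m; lia.
- move=> i l hl.
  have [c cn e] := shift_ex i (i -~ l).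
  have cE : c = if l == 0%N then 0%N else (n - l)%N.
    apply/eqP; rewrite -(eq_shiftp2 i) -?e //; last by case: ifP; lia.
    apply/eqP/(@shiftp_inj _ l); rewrite shiftmK.
    case: eqP => [->//|l0]; rewrite shiftpD subnK ?shiftpn //; lia.
  rewrite e pbr_yx // (_ : _ - _ = 1) ?mulr1z ?mul1r //.
  by rewrite cE /m; case: ifP; lia.
- move=> i j hij; have [c cn jE] := shift_ex i j.
  rewrite jE pbr_xx // (_ : _ - _ = 0) ?mulr0z ?mul0r //.
  have h1 : ~~ ((0 < c) && (c < m))%N.
    apply/negP => h; have [] := hij c ltac:(rewrite /m in h; lia).
    by rewrite jE.
  have h2 : ~~ (n - c < m)%N.
    apply/negP => h; have [_] := hij (n - c)%N ltac:(rewrite /m in h; lia).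
    by rewrite jE shiftpD subnKC ?shiftpn // ltnW.
  by rewrite (negPf h1) (negPf h2).
- move=> i j hij; have [c cn jE] := shift_ex i j.
  rewrite jE pbr_yy // (_ : _ - _ = 0) ?mulr0z ?mul0r //.
  have h1 : ~~ ((0 < c) && (c <= m))%N.
    apply/negP => h; have [] := hij c ltac:(rewrite /m in h; lia).
    by rewrite jE.
  have h2 : ~~ (n - c <= m)%N.
    apply/negP => h; have [_] := hij (n - c)%N ltac:(rewrite /m in h; lia).
    by rewrite jE shiftpD subnKC ?shiftpn // ltnW.
  by rewrite (negPf h1) (negPf h2).
move=> i j h1 h2; have [c cn jE] := shift_ex i j.
rewrite jE pbr_yx // (_ : _ - _ = 0) ?mulr0z ?mul0r //.
have h3 : ~~ ((0 < c) && (c <= m))%N.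
  by apply/negP => h; apply: (h1 c) => //; rewrite /m in h; lia.
have h4 : ~~ (n - c < m)%N.
  apply/negP => h; apply: (h2 (n - c)%N); first by rewrite /m in h; lia.
  by apply: (@shiftp_inj _ (n - c)); rewrite shiftmK jE shiftpD subnKC ?shiftpn // ltnW.
have h5 : c != 0%N.
  by apply/eqP => h; apply: (h2 0%N) => //; rewrite jE h.
by rewrite (negPf h3) (negPf h4) (negPf h5).
Qed.

Definition Ptensor : 'M[{mpoly R[n + n]}]_(n + n) :=
  \matrix_(a, b) ((A a b)%:~R * ('X_a * 'X_b)).

Lemma pbr_tensor : poisson_tensor (@pbr R _ A) Ptensor.
Proof. by move=> a b; rewrite pbr_coord [Ptensor a b]mxE !tofracM rmorph_int. Qed.

Lemma Ptensor_rank : generic_rank Ptensor (2 * (n - gcdn (k - 1) n))%N.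
Proof.
exists (\prod_a 'X_a).
  by apply/prodf_neq0 => a _; rewrite -tofrac_eq0; apply: (coord_neq0 R a).
move=> v; rewrite rmorph_prod => /prodf_neq0 v0.
have v0' a : v a != 0 by have := v0 a isT; rewrite /= mevalXU.
have -> : map_mx (meval v) Ptensor = dgf v *m Jmx R n m *m dgf v.
  apply/matrixP => a b; rewrite mulmx_dgfE mul_dgfE mxE [Ptensor a b]mxE.
  have -> : Jmx R n m a b = (A a b)%:~R.
    by rewrite -(map_Jmx (intr : {rmorphism int -> R})) mxE.
  by rewrite !mevalM !mevalXU rmorph_int mulrCA mulrA.
have du : dgf v \in unitmx.
  by rewrite unitmxE det_dgf unitfE; apply/prodf_neq0.
rewrite mxrankMfree ?row_free_unit // eqmxMfull ?row_full_unit //.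
rewrite rank_Jmx //; last by lia.
by congr (2 * (n - gcdn _ _))%N; rewrite /m; lia.
Qed.

End Standard.

(** * Independence *)

Lemma size_det_le (A : idomainType) n (M : 'M[{poly A}]_n) :
  (forall i j, size (M i j) <= 2)%N -> (size (\det M) <= n.+1)%N.
Proof.
move=> hM; apply: (leq_trans (size_sum _ _ _)); apply/bigmax_leqP => s _.
rewrite size_Msign; apply: (leq_trans (size_prod_leq _ _)).
have : (\sum_(i < n) size (M i (s i)) <= \sum_(i < n) 2)%N by apply: leq_sum.
by rewrite sum_nat_const card_ord leq_subLR addnS ltnS addnn -muln2.
Qed.

Lemma coef_comp_scaleX (A : comNzRingType) (p : {poly A}) c i :
  (p \Po (c *: 'X))`_i = p`_i * c ^+ i.
Proof.
rewrite comp_polyE coef_sum.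
have e (j : 'I_(size p)) : (p`_j *: (c *: 'X) ^+ j)`_i = if i == j then p`_i * c ^+ i else 0.
  rewrite exprZn scalerA coefZ coefXn.
  by have [->|_] := altP (i =P j :> nat); rewrite ?mulr1 ?mulr0.
rewrite (eq_bigr _ (fun j _ => e j)) -big_mkcond.
have [ip|ip] := ltnP i (size p).
  by rewrite (big_pred1 (Ordinal ip)) // => j; rewrite eq_sym.
rewrite big_pred0 ?nth_default ?mul0r // => j; have := ltn_ord j.
by have [E|_] := altP (i =P j :> nat) => //; rewrite -E ltnNge ip.
Qed.

Section SizeDet.
Variables (B : idomainType) (n m : nat) (x y : 'I_n -> B) (c : B).

Let size_lin (u v : B) : (size (u%:P + v *: 'X)%R <= 2)%N.
Proof.
apply: (leq_trans (size_polyD _ _)); rewrite geq_max.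
rewrite (leq_trans (size_polyC_leq1 _)) //=.
by apply: (leq_trans (size_scale_leq _ _)); rewrite size_polyX.
Qed.

Lemma size_det_Dmx_l :
  (size (\det (Dmx m (fun i => (x i)%:P) (fun i => (y i)%:P) 'X c%:P)) <= n.+1)%N.
Proof.
apply: size_det_le => u v; rewrite DmxE.
rewrite (_ : _ + _ = ((v == u)%:R - c * (v == u +~ 1)%:R)%:P +
  (x (u +~ m) * (v == u +~ m)%:R + c * (y (u +~ m) * (v == u +~ m.+1)%:R)) *: 'X).
  exact: size_lin.
rewrite -mul_polyC !(rmorphD, rmorphB, rmorphM, rmorphN, rmorph_nat) /=.
by rewrite [_ * 'X]mulrC.
Qed.

Lemma size_det_Dmx_t :
  (size (\det (Dmx m (fun i => (x i)%:P) (fun i => (y i)%:P) c%:P 'X)) <= n.+1)%N.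
Proof.
apply: size_det_le => u v; rewrite DmxE.
rewrite (_ : _ + _ = ((v == u)%:R + c * (x (u +~ m) * (v == u +~ m)%:R))%:P +
  (c * (y (u +~ m) * (v == u +~ m.+1)%:R) - (v == u +~ 1)%:R) *: 'X).
  exact: size_lin.
rewrite -mul_polyC !(rmorphD, rmorphB, rmorphM, rmorphN, rmorph_nat) /=.
by ring.
Qed.

End SizeDet.

Section BivDet.
Variables (B : idomainType) (n m : nat) (x y : 'I_n -> B).

Definition bivDet : {poly {poly B}} :=
  \det (Dmx m (fun i => (x i)%:P%:P) (fun i => (y i)%:P%:P) 'X 'X%:P).

Let swap_bivDet : swapXY bivDet =
  \det (Dmx m (fun i => (x i)%:P%:P) (fun i => (y i)%:P%:P) 'X%:P 'X).
Proof.
rewrite /bivDet -(det_map_mx (swapXY : {rmorphism _ -> _})); congr (\det _); apply/matrixP => u v.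
rewrite mxE !DmxE !(rmorphD, rmorphM, rmorphN, rmorph_nat) /=.
by rewrite swapXY_X swapXY_Y !swapXY_polyC !map_polyC.
Qed.

(** The entries of [Dmx] are affine in l for fixed t and affine in t for fixed l, which bounds each
    degree by the size n. *)
Lemma bivDet_eq0 i c : (n < i)%N || (n < c)%N -> bivDet`_i`_c = 0.
Proof.
case/orP => [ni|nc].
  by rewrite (nth_default _ (leq_trans (size_det_Dmx_l _ _ _ _) ni)) coef0.
rewrite -coef_swapXY swap_bivDet.
by rewrite (nth_default _ (leq_trans (size_det_Dmx_t _ _ _ _) nc)) coef0.
Qed.

Lemma bivDet_comp : \det (Dmx m (fun i => (x i)%:P%:P) (fun i => (y i)%:P%:P)
    ('X * 'X%:P ^+ m) 'X%:P) = bivDet \Po (('X ^+ m) *: 'X).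
Proof.
have -> : 'X * 'X%:P ^+ m = 'X ^+ m *: 'X :> {poly {poly B}}.
  by rewrite -polyC_exp mulrC mul_polyC.
pose f : {rmorphism {poly {poly B}} -> {poly {poly B}}} := comp_poly ('X ^+ m *: 'X).
rewrite -[RHS]/(f _) -(det_map_mx f); congr (\det _).
apply/matrixP => u v.
rewrite [RHS]mxE !DmxE !(rmorphD, rmorphM, rmorphN, rmorph_nat) /=.
by rewrite !comp_polyC comp_polyX.
Qed.

End BivDet.

Section Substitution.
Variables (B : comNzRingType) (n : nat).

(* The substitution [z = - t ^+ n], where [t] is the new inner variable and
   [lambda] becomes the outer one. *)
Definition zsub : {rmorphism {poly {poly B}} -> {poly {poly B}}} :=
  horner_eval (- 'X%:P ^+ n) \o map_poly (map_poly (@polyC B)).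

Lemma zsubC q : zsub q%:P = map_poly (@polyC B) q.
Proof. by rewrite /zsub /= /horner_eval map_polyC hornerC. Qed.

Lemma zsubCC (b : B) : zsub b%:P%:P = b%:P%:P.
Proof. by rewrite zsubC map_polyC. Qed.

Lemma zsubXC : zsub 'X%:P = 'X.
Proof. by rewrite zsubC map_polyX. Qed.

Lemma zsubX : zsub 'X = - 'X%:P ^+ n.
Proof. by rewrite /zsub /= /horner_eval map_polyX hornerX. Qed.

Lemma coef_zsub (p : {poly {poly B}}) i e : (0 < n)%N ->
  (zsub p)`_i`_e = if (n %| e)%N then (-1) ^+ (e %/ n) * p`_(e %/ n)`_i else 0.
Proof.
move=> n0; rewrite /zsub /= /horner_eval.
rewrite (@horner_coef_wide _ (size p)) ?size_poly // !coef_sum.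
have term (j : 'I_(size p)) : ((map_poly (map_poly (@polyC B)) p)`_j
     * (- 'X%:P ^+ n) ^+ j)`_i`_e = if (e == n * j)%N then (-1) ^+ j * p`_j`_i else 0.
  have -> : (- 'X%:P ^+ n) ^+ j = ((-1) ^+ j *: 'X ^+ (n * j))%:P :> {poly {poly B}}.
    rewrite -mul_polyC polyCM !polyC_exp !polyCN !polyC1 -polyC_exp exprNn exprM.
    by rewrite !polyC_exp.
  rewrite coefMC coef_map coef_map /= coefCM coefZ coefXn.
  by case: eqP => _; rewrite ?mulr1 ?mulr0 // mulrC.
rewrite (eq_bigr _ (fun j _ => term j)) -big_mkcond /=.
case: ifP => [/dvdnP[j eE]|ne].
  rewrite eE mulnK //; have [jp|jp] := ltnP j (size p).
    rewrite (big_pred1 (Ordinal jp)) // => u.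
    by rewrite mulnC eqn_pmul2l // eq_sym.
  rewrite [p`_j]nth_default // coef0 mulr0 big_pred0 // => u.
  rewrite mulnC eqn_pmul2l //; apply/negP => /eqP h.
  by have := ltn_ord u; rewrite -h ltnNge jp.
rewrite big_pred0 // => j; apply/negP => /eqP eE.
by rewrite eE dvdn_mulr in ne.
Qed.

End Substitution.

Section NewtonPolygon.
Variables (R : realType) (n k : nat).
Hypotheses (hk : (2 <= k)%N) (hkn : (k <= n)%N).
Local Notation Pol := {mpoly R[n + n]}.
Let m := k.-1.

(* Bivariate form of the spectral polynomial: the outer variable stands for
   [lambda t ^+ m], the inner one for [t]. *)
Definition specLT : {poly {poly Pol}} := bivDet m (@px R n) (@py R n).

Let X (i : 'I_n) : {poly {poly Pol}} := (px R i)%:P%:P.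
Let Y (i : 'I_n) : {poly {poly Pol}} := (py R i)%:P%:P.

Lemma specLT_eq0 i c : (n < i)%N || (n < c)%N -> specLT`_i`_c = 0.
Proof. exact: bivDet_eq0. Qed.

(** The monomial (lambda t ^ m) ^ i t ^ c has t-exponent c + m i, and t occurs only through z = - t
    ^ n. Hence each i in 1, ..., n has one c in 1, ..., n, and c = 0 is possible when n divides m i,
    which happens d times: n + d coefficients in all. *)
Lemma specLT_coef i c : specLT`_i`_c =
  if (n %| c + m * i)%N then (-1) ^+ ((c + m * i) %/ n) * I_ R k n i ((c + m * i) %/ n) else 0.
Proof.
pose S := {poly {poly Pol}}; pose T : S := 'X%:P.
have hspec : zsub Pol n (spectral R n k) = specLT \Po (('X : {poly Pol}) ^+ m *: 'X).
  have Y0 i' : Y i' != 0 by rewrite !polyC_eq0 (py_neq0 R).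
  have X0 : ('X : S) != 0 by rewrite polyX_eq0.
  have T0 : T != 0 by rewrite polyC_eq0 polyX_eq0.
  transitivity (\det (Dmx m X Y ('X * T ^+ m) T)); last exact: bivDet_comp.
  apply: (@spectral_morph_Dmx R n k hk hkn _ (zsub Pol n) X Y 'X T X0 T0 Y0).
  - by move=> u; apply: zsubCC.
  - by move=> u; apply: zsubCC.
  - exact: zsubXC.
  - exact: zsubX.
have := congr1 (fun p : S => p`_i`_(c + m * i)) hspec.
rewrite coef_comp_scaleX -exprM coefMXn ltnNge leq_addl /= addnK => <-.
by apply: coef_zsub; lia.
Qed.

End NewtonPolygon.

(* [z_e = \tr (C adj(H) G ^ e N)] satisfies
   [z_e + X z_(e+1) = \det H \tr (C G ^ e N)], and [\det H] is 1 at [X = 0]. *)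
Lemma krylov (K : fieldType) n (G C N : 'M[K]_n) :
  \tr (map_mx polyC C *m \adj (1%:M + 'X *: map_mx polyC G) *m map_mx polyC N) = 0 ->
  forall e, \tr (C *m G ^+ e *m N) = 0.
Proof.
set H := 1%:M + _ => h0.
pose P (M : 'M[K]_n) := \tr (map_mx polyC C *m \adj H *m map_mx polyC M).
have step M : P M = 0 -> P (G *m M) = 0 /\ \tr (C *m M) = 0.
  move=> PM.
  have e : P M + 'X * P (G *m M) = \det H * (\tr (C *m M))%:P.
    rewrite /P map_mxM -mxtraceZ -mxtraceD scalemxAr scalemxAl -mulmxDr.
    rewrite -[X in _ *m (X + _)]mul1mx -mulmxDl -/H !mulmxA -[_ *m \adj H *m H]mulmxA.
    rewrite mul_adj_mx mul_mx_scalar -scalemxAl mxtraceZ -map_mxM; congr (_ * _).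
    by rewrite trace_map_mx.
  rewrite PM add0r in e.
  have dH : (\det H).[0] = 1.
    rewrite -horner_evalE -det_map_mx -[RHS](det1 K n); congr (\det _).
    apply/matrixP => i j; rewrite !mxE rmorphD rmorph_nat rmorphM /= !horner_evalE hornerX mul0r addr0.
    by [].
  have t0 : \tr (C *m M) = 0.
    have := congr1 (horner^~ 0) e; rewrite !hornerM hornerX mul0r dH mul1r hornerC.
    by move=> /esym.
  split=> //; move/eqP: e; rewrite t0 mulr0 mulf_eq0 polyX_eq0 /=.
  by move/eqP.
have key e : P (G ^+ e *m N) = 0.
  elim: e => [|e IH]; first by rewrite expr0 mul1mx.
  by rewrite exprS -mulmxA; case: (step _ IH).
by move=> e; rewrite -mulmxA; case: (step _ (key e)).
Qed.

Lemma der_polyC (A B : comNzRingType) (d : {additive A -> B}) c :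
  map_poly d c%:P = (d c)%:P.
Proof. by apply/polyP => i; rewrite coef_map !coefC; case: ifP => // _; rewrite raddf0. Qed.

Lemma dirmxE (B : comNzRingType) n m (t : B) (a b : 'I_n -> B) i j :
  (Sh B n m *m (dgf a + t *: (dgf b *m Sh B n 1))) i j =
  a (i +~ m) *+ (j == i +~ m) + t * (b (i +~ m) *+ (j == i +~ m +~ 1)).
Proof.
rewrite mul_ShE [LHS]mxE [X in _ + X]mxE mulmx_ShE !dgfE.
by rewrite [i +~ m == j]eq_sym -eq_shiftp.
Qed.

(* [l varDet] is the derivative of [\det (Dmx m x y l t)] in the direction
   [(a, b)]. *)
Definition varDet (B : comNzRingType) n m (x y : 'I_n -> B) (l t : B) (a b : 'I_n -> B) : B :=
  \tr (\adj (Dmx m x y l t) *m (Sh B n m *m (dgf a + t *: (dgf b *m Sh B n 1)))).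

Lemma map_varDet (B C : comNzRingType) (g : {rmorphism B -> C}) n m
    (x y a b : 'I_n -> B) l t (x' y' a' b' : 'I_n -> C) l' t' :
  g l = l' -> g t = t' ->
  (forall i, g (x i) = x' i) -> (forall i, g (y i) = y' i) ->
  (forall i, g (a i) = a' i) -> (forall i, g (b i) = b' i) ->
  g (varDet m x y l t a b) = varDet m x' y' l' t' a' b'.
Proof.
move=> <- <- /boolp.funext <- /boolp.funext <- /boolp.funext <- /boolp.funext <-.
rewrite /varDet -trace_map_mx map_mxM map_mx_adj map_Dmx; congr (\tr (_ *m _)).
by apply/matrixP => i j; rewrite mxE !dirmxE rmorphD rmorphM !rmorphMn.
Qed.

Lemma varDet_t0 (B : comNzRingType) n m (x y a b : 'I_n -> B) l :
  varDet m x y l 0 a b = \tr (dgf a *m \adj (1%:M + l *: (Sh B n m *m dgf x)) *m Sh B n m).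
Proof.
rewrite /varDet /Dmx !scale0r subr0 !addr0 [RHS]mxtrace_mulC !mulmxA.
by rewrite mxtrace_mulC mulmxA.
Qed.

(* At [y = - x] the matrix [Dmx] factors as [(1 + l Sh m x) (1 - t Sh 1)], and
   [\sum_j t ^ j Sh j] inverts the second factor up to [1 - t ^ n]. *)
Lemma varDet_opp (B : idomainType) n m (x b : 'I_n -> B) (l t : B) : t != 0 ->
  \det (Dmx m x (fun i => - x i) l t) != 0 ->
  varDet m x (fun i => - x i) l t (fun=> 0) b = 0 ->
  \tr (dgf b *m (Sh B n 1 *m \sum_(0 <= j < n) t ^+ j *: Sh B n j) *m
    \adj (1%:M + l *: (Sh B n m *m dgf x)) *m Sh B n m) = 0.
Proof.
move=> t0; set D := Dmx _ _ _ _ _; set H := 1%:M + l *: _; set E := \sum_(_ <= _ < _) _.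
move=> dD; rewrite /varDet -/D => h.
have DE : D = H *m (1%:M - t *: Sh B n 1).
  rewrite /D /Dmx /H mulmxDl mul1mx -scalemxAl; congr (_ + _ *: _).
  rewrite -mulmxA; congr (_ *m _); apply/matrixP => i j.
  rewrite mulmxBr mulmx1 -scalemxAr.
  by rewrite [LHS]mxE [X in _ + X]mxE [RHS]mxE [X in _ = _ + X]mxE [X in _ = _ - X]mxE !mul_dgfE; ring.
have aH : ((1 - t ^+ n) * \det H) *: \adj D = \det D *: (E *m \adj H).
  have e : (1 - t ^+ n) *: (\adj D *m H) = \det D *: E.
    rewrite -[RHS]mul_scalar_mx -mul_adj_mx [X in _ *m X *m _]DE mulmxA -[RHS]mulmxA.
    by rewrite det_1sub_Sh mul_mx_scalar.
  by rewrite [in RHS]scalemxAl -e -scalemxAl -mulmxA mul_mx_adj mul_mx_scalar scalerA.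
have := congr1 (fun M => \tr (M *m (Sh B n m *m (dgf (fun=> 0) + t *: (dgf b *m Sh B n 1))))) aH.
rewrite -!scalemxAl !mxtraceZ h mulr0 => /esym/eqP.
rewrite mulf_eq0 (negPf dD) /= => /eqP.
have -> : dgf (fun=> 0) = 0 :> 'M[B]_n by apply/matrixP => i j; rewrite dgfE mul0rn mxE.
rewrite add0r -!scalemxAr mxtraceZ => /eqP; rewrite mulf_eq0 (negPf t0) /= => /eqP <-.
transitivity (\tr ((dgf b *m Sh B n 1) *m (E *m \adj H *m Sh B n m))).
  by rewrite !mulmxA.
by rewrite mxtrace_mulC !mulmxA.
Qed.

Lemma sum_eq_shiftp (B : comNzRingType) n (i j : 'I_n) :
  \sum_(0 <= c < n) (j == i +~ c)%:R = 1 :> B.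
Proof.
have [c0 c0n ->] := shift_ex i j; rewrite big_mkord (bigD1 (Ordinal c0n)) //= eqxx.
rewrite big1 ?addr0 // => c ne.
rewrite eq_shiftp2 // eq_sym.
by rewrite -val_eqE /= in ne; rewrite (negPf ne).
Qed.

(** Specialization at t = 1, where the geometric sum of shifts becomes the matrix of ones. D is
    singular there, so [varDet_opp] has to cancel its determinant before t is specialized. *)
Lemma varDet_opp1 (B : idomainType) (C : comNzRingType) (g : {rmorphism B -> C}) n m
    (x b : 'I_n -> B) (l t : B) (x' b' : 'I_n -> C) (l' : C) : t != 0 ->
  \det (Dmx m x (fun i => - x i) l t) != 0 ->
  varDet m x (fun i => - x i) l t (fun=> 0) b = 0 ->
  g t = 1 -> g l = l' -> (forall i, g (x i) = x' i) -> (forall i, g (b i) = b' i) ->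
  \tr (dgf b' *m const_mx 1 *m \adj (1%:M + l' *: (Sh C n m *m dgf x')) *m Sh C n m) = 0.
Proof.
move=> t0 D0 v0 gt <- gx gb.
have := congr1 g (varDet_opp t0 D0 v0); rewrite rmorph0 => h; apply: etrans h.
have map_Sh c : map_mx g (Sh B n c) = Sh C n c.
  by apply/matrixP => i j; rewrite mxE !ShE rmorph_nat.
have map_dgf v v' : (forall i, g (v i) = v' i) -> map_mx g (dgf v) = dgf v'.
  by move=> vE; apply/matrixP => i j; rewrite mxE !dgfE rmorphMn vE.
rewrite -trace_map_mx !map_mxM map_mx_adj map_mxD map_mx1 map_mxZ map_mxM !map_Sh.
rewrite (map_dgf _ _ _ gx) (map_dgf _ _ _ gb); congr (\tr (_ *m _ *m _ *m _)).
have gtc c : g (t ^+ c) = 1 by rewrite rmorphXn gt expr1n.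
apply/matrixP => i j; rewrite mul_ShE !raddf_sum summxE mxE -(sum_eq_shiftp C (i +~ 1) j).
by apply: eq_bigr => c _; rewrite /= map_mxZ map_Sh gtc scale1r ShE.
Qed.

Section PolyDerivation.
Variables (A B : comNzRingType) (f : {rmorphism A -> B}) (d : {additive A -> B}).
Hypothesis dM : forall a b, d (a * b) = d a * f b + f a * d b.

Lemma map_poly_derM p q : map_poly d (p * q) =
  map_poly d p * map_poly f q + map_poly f p * map_poly d q.
Proof.
apply/polyP => i; rewrite coef_map /= coefM coefD !coefM raddf_sum -big_split.
by apply: eq_bigr => j _; rewrite /= !coef_map dM.
Qed.

Lemma der_nat c : d c%:R = 0.
Proof.
have d1 : d 1 = 0.
  have := dM 1 1; rewrite mulr1 rmorph1 mulr1 mul1r => /eqP.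
  by rewrite -subr_eq0 opprD addrA subrr sub0r oppr_eq0 => /eqP.
by rewrite raddfMn d1 mul0rn.
Qed.

Lemma der_polyX : map_poly d 'X = 0.
Proof. by apply/polyP => i; rewrite coef_map coefX der_nat coef0. Qed.

Lemma der2_polyC c : map_poly (map_poly d) c%:P%:P = (d c)%:P%:P.
Proof. exact: (etrans (der_polyC (map_poly d) _) (congr1 polyC (der_polyC d _))). Qed.

Lemma der_Dmx n m x y l t (i j : 'I_n) : d l = 0 -> d t = 0 ->
  map_mx d (Dmx m x y l t) i j = (f l *: (Sh B n m *m
    (dgf (d \o x) + f t *: (dgf (d \o y) *m Sh B n 1)))) i j.
Proof.
move=> dl dt; rewrite mxE DmxE raddfD raddfB !dM dl mul0r add0r [d (_ + _)]raddfD !dM dt !der_nat.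
rewrite [RHS]mxE dirmxE !rmorphM !rmorph_nat /=.
by rewrite !(mul0r, mulr0, add0r, addr0, oppr0) !mulr_natr.
Qed.

Lemma der_det_Dmx n m (x y : 'I_n -> A) l t (x' y' a b : 'I_n -> B) l' t' :
  d l = 0 -> d t = 0 -> f l = l' -> f t = t' ->
  (forall i, f (x i) = x' i) -> (forall i, f (y i) = y' i) ->
  (forall i, d (x i) = a i) -> (forall i, d (y i) = b i) ->
  d (\det (Dmx m x y l t)) = l' * varDet m x' y' l' t' a b.
Proof.
move=> dl dt <- <- /boolp.funext <- /boolp.funext <- /boolp.funext <- /boolp.funext <-.
rewrite /varDet -mxtraceZ scalemxAr (der_det dM) map_Dmx.
by congr (\tr (_ *m _)); apply/matrixP => i j; rewrite der_Dmx.
Qed.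

End PolyDerivation.

Section Tangent.
Variables (A : idomainType) (R : fieldType) (f : {rmorphism A -> R}) (d : {additive A -> R}).
Hypothesis dM : forall a b, d (a * b) = d a * f b + f a * d b.
Variables (n m : nat) (x y : 'I_n -> A).
Let x0 := f \o x.
Let y0 := f \o y.
Let a := d \o x.
Let b := d \o y.
Let CC (c : R) : {poly {poly R}} := c%:P%:P.

Lemma der_bivDet : map_poly (map_poly d) (bivDet m x y) =
  'X * varDet m (CC \o x0) (CC \o y0) 'X 'X%:P (CC \o a) (CC \o b).
Proof.
apply: (der_det_Dmx (map_poly_derM (map_poly_derM dM))).
- exact: (der_polyX (map_poly_derM dM)).
- exact: (etrans (der_polyC (map_poly d) _) (congr1 polyC (der_polyX dM))).
- exact: map_polyX.
- exact: (etrans (der_polyC (map_poly f) _) (congr1 polyC (map_polyX f))).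
- by move=> i; apply: der2_polyC.
- by move=> i; apply: der2_polyC.
- by move=> i; apply: der2_polyC.
- by move=> i; apply: der2_polyC.
Qed.

Hypothesis db0 : map_poly (map_poly d) (bivDet m x y) = 0.

Let G : 'M[R]_n := Sh R n m *m dgf x0.

Let ev (c : R) : {rmorphism {poly {poly R}} -> {poly R}} := map_poly (horner_eval c).
Let evX c : ev c 'X = 'X. Proof. exact: map_polyX. Qed.
Let evC c p : ev c p%:P = p.[c]%:P. Proof. exact: map_polyC. Qed.
Let evCC c v i : ev c ((CC \o v) i) = (polyC \o v : 'I_n -> {poly R}) i.
Proof. by rewrite evC hornerC. Qed.

Let HE : 1%:M + 'X *: map_mx polyC G = 1%:M + 'X *: (Sh _ n m *m dgf (polyC \o x0)).
Proof.
congr (_ + _ *: _); apply/matrixP => i j.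
by rewrite mxE !mul_ShE !dgfE rmorphMn.
Qed.

Let map_dgf (v : 'I_n -> R) : map_mx polyC (dgf v) = dgf (polyC \o v).
Proof. by apply/matrixP => i j; rewrite mxE !dgfE rmorphMn. Qed.

Let map_Sh c : map_mx polyC (Sh R n c) = Sh _ n c.
Proof. by apply/matrixP => i j; rewrite mxE !ShE rmorph_nat. Qed.

Let varDet0 : varDet m (CC \o x0) (CC \o y0) 'X 'X%:P (CC \o a) (CC \o b) = 0.
Proof. by move: db0; rewrite der_bivDet => /eqP; rewrite mulf_eq0 polyX_eq0 => /eqP. Qed.

(** At t = 0 the b-terms and the y-terms drop out, and the Krylov argument extracts one equation for
    each power of [G]. *)
Lemma tangent_x e : \tr (dgf a *m G ^+ e *m Sh R n m) = 0.
Proof.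
apply: krylov; rewrite HE map_dgf map_Sh -(varDet_t0 m (polyC \o x0) (polyC \o y0) (polyC \o a) (polyC \o b)).
have h := congr1 (ev 0) varDet0; rewrite rmorph0 in h; apply: etrans h.
apply/esym/map_varDet; try exact: evCC.
  exact: evX.
by rewrite evC hornerX polyC0.
Qed.

Lemma tangent_y : (forall i, a i = 0) -> (forall i, y0 i = - x0 i) ->
  forall e, \tr (dgf b *m const_mx 1 *m G ^+ e *m Sh R n m) = 0.
Proof.
move=> /boolp.funext a0 /boolp.funext yx; apply: krylov; rewrite HE map_mxM map_dgf map_Sh map_const_mx.
pose xx : 'I_n -> {poly {poly R}} := CC \o x0.
have t0 : 'X%:P != 0 :> {poly {poly R}} by rewrite polyC_eq0 polyX_eq0.
have d0 : \det (Dmx m xx (fun i => - xx i) 'X 'X%:P) != 0.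
  (* At l = t = 0 the matrix is the identity. *)
  apply/eqP => /(congr1 (ev 0))/(congr1 (horner_eval 0)).
  rewrite -det_map_mx map_Dmx evX evC hornerX polyC0 rmorph0 -det_map_mx map_Dmx rmorph0.
  rewrite /= horner_evalE hornerX /Dmx !scale0r subr0 addr0 det1 => /eqP.
  by rewrite rmorph0 oner_eq0.
have ey : CC \o y0 = (fun i => - xx i).
  by apply: boolp.funext => i; rewrite /= yx /CC !polyCN.
have ea : CC \o a = (fun=> 0) by apply: boolp.funext => i; rewrite /= a0.
pose V v w := varDet m xx v 'X 'X%:P w (CC \o b).
have h : V (fun i => - xx i) (fun=> 0) = 0 := etrans (esym (f_equal2 V ey ea)) varDet0.
apply: (@varDet_opp1 _ _ (ev 1) n m xx (CC \o b) 'X 'X%:P (polyC \o x0) (polyC \o b) 'X t0 d0 h).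
- by rewrite evC hornerX polyC1.
- exact: evX.
- exact: evCC.
- exact: evCC.
Qed.

End Tangent.

(** A Vandermonde argument: the vanishing power sums are combined into a Lagrange polynomial
    supported on the node of c. *)
Lemma class_sum_eq0 (K : fieldType) (I : finType) d (cl : I -> 'I_d) (x : 'I_d -> K)
    (g : I -> K) : injective x ->
  (forall f, \sum_i x (cl i) ^+ f * g i = 0) ->
  forall c, \sum_(i | cl i == c) g i = 0.
Proof.
move=> x_inj h c; pose p := \prod_(c' | c' != c) ('X - (x c')%:P).
have px i : p.[x (cl i)] = if cl i == c then p.[x c] else 0.
  case: eqP => [->//|/eqP ne]; rewrite horner_prod (bigD1 (cl i)) //=.
  by rewrite hornerXsubC subrr mul0r.
have pc : p.[x c] != 0.
  rewrite horner_prod; apply/prodf_neq0 => c' ne.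
  by rewrite hornerXsubC subr_eq0 (inj_eq x_inj) eq_sym.
have : \sum_i p.[x (cl i)] * g i = 0.
  under eq_bigr do rewrite horner_coef mulr_suml.
  rewrite exchange_big big1 // => f _ /=.
  by under eq_bigr do rewrite -mulrA; rewrite -mulr_sumr h mulr0.
under eq_bigr do rewrite px (fun_if (fun z => z * _)) mul0r.
rewrite -big_mkcond -mulr_sumr => /eqP; rewrite mulf_eq0 (negPf pc) /=.
by move/eqP.
Qed.

(** * Tangency equations along the orbits of the shift by m *)

Section OrbitProduct.
Variables (K : fieldType) (n m : nat) (u : 'I_n -> K).

Definition orbprod e i : K := \prod_(s < e) u (i +~ (s.+1 * m)).

Lemma orbprodSr e i : orbprod e.+1 i = orbprod e i * u (i +~ (e.+1 * m)).
Proof. by rewrite /orbprod big_ord_recr. Qed.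

Lemma orbprodS e i : orbprod e.+1 i = u (i +~ m) * orbprod e (i +~ m).
Proof.
rewrite /orbprod big_ord_recl mul1n; congr (_ * _); apply: eq_bigr => s _.
by rewrite shiftpD /= -mulSn.
Qed.

Lemma orbprodD e e' i : orbprod (e + e') i = orbprod e i * orbprod e' (i +~ (e * m)).
Proof.
elim: e' => [|e' IH]; first by rewrite addn0 /orbprod big_ord0 mulr1.
by rewrite addnS !orbprodSr IH -mulrA shiftpD -mulnDl addnS.
Qed.

Lemma orbprod_neq0 e i : (forall j, u j != 0) -> orbprod e i != 0.
Proof. by move=> u0; apply/prodf_neq0. Qed.

Lemma pow_orbprod e : (Sh K n m *m dgf u) ^+ e *m Sh K n m =
  dgf (orbprod e) *m Sh K n (e.+1 * m).
Proof.
elim: e => [|e IH].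
  rewrite expr0 mul1mx mul1n (_ : dgf _ = 1%:M) ?mul1mx //.
  by rewrite -dgf1; apply: eq_dgf => i; rewrite /orbprod big_ord0.
rewrite exprS -[_ *m _ ^+ e *m _]mulmxA IH mulmxA -[_ *m dgf u *m dgf _]mulmxA dgfM.
rewrite Sh_dgf -mulmxA ShD -mulSn; congr (_ *m _); apply: eq_dgf => i.
by rewrite orbprodS.
Qed.

Lemma trace_orbprod_y b e :
  \tr (dgf b *m const_mx 1 *m (Sh K n m *m dgf u) ^+ e *m Sh K n m) =
  \sum_i orbprod e i * b (i +~ (e.+1 * m)).
Proof.
rewrite -mulmxA pow_orbprod -mulmxA [const_mx 1 *m _]mulmxA mulmxA [RHS](reindex_shiftm (e.+1 * m)).
apply: eq_bigr => i _; rewrite mulmx_ShE mul_dgfE mulmx_dgfE mxE mul1r shiftmK.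
by rewrite mulrC.
Qed.

Lemma trace_orbprod_x a e :
  \tr (dgf a *m (Sh K n m *m dgf u) ^+ e *m Sh K n m) =
  \sum_i a i * (orbprod e i * (i == i +~ (e.+1 * m))%:R).
Proof.
rewrite -mulmxA pow_orbprod; apply: eq_bigr => i _.
by rewrite !mul_dgfE ShE.
Qed.

End OrbitProduct.

Section BasePoint.
Variables (K : numFieldType) (n m : nat).
Hypotheses (m0 : (0 < m)%N) (n0 : (0 < n)%N).
Let d := gcdn m n.
Let q := (n %/ d)%N.

Let d0 : (0 < d)%N. Proof. by rewrite gcdn_gt0 n0 orbT. Qed.
Let q0 : (0 < q)%N. Proof. by rewrite divn_gt0 // dvdn_leq // dvdn_gcdr. Qed.
Let nE : n = (q * d)%N. Proof. by rewrite divnK // dvdn_gcdr. Qed.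
Let mE : m = (m %/ d * d)%N. Proof. by rewrite divnK // dvdn_gcdl. Qed.
Let dn : (d <= n)%N. Proof. by rewrite dvdn_leq // dvdn_gcdr. Qed.

(* Chosen so that the product over the orbit of [i] under the shift by [m] only
   depends on [i mod d], and tells the [d] orbits apart ([orbprod_period]). *)
Definition base (i : 'I_n) : K := if (i < d)%N then i.+2%:R else 1.

Lemma base_neq0 i : base i != 0.
Proof. by rewrite /base; case: ifP => _; rewrite ?Num.Theory.pnatr_eq0 ?oner_eq0. Qed.

Let F := orbprod m base.

Let shift_qm (i : 'I_n) f : i +~ (q * f * m) = i.
Proof.
by rewrite (_ : (q * f * m = n * (f * (m %/ d)))%N) ?shiftpnM // {1}mE [in RHS]nE; lia.
Qed.

Lemma orbprod_period i : F q i = (i %% d).+2%:R.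
Proof.
have cyc j : F q (j +~ m) = F q j.
  apply: (mulfI (base_neq0 (j +~ m))); rewrite -orbprodS orbprodSr mulrC.
  by rewrite mulSn addnC -shiftpD -[q in (q * m)%N]muln1 shift_qm.
have cn : (i %% d < n)%N by rewrite (leq_trans (ltn_pmod _ d0)).
rewrite (shift_gcd_mod m0 cyc (j := Ordinal cn)); last by rewrite /= modn_mod.

set c := Ordinal cn; have cd : (c < d)%N by rewrite ltn_pmod.
transitivity (F q.-1.+1 c); first by rewrite prednK.
rewrite /F orbprodSr prednK //.
rewrite -[q in (q * m)%N]muln1 shift_qm {2}/base cd.
(* An earlier point of the orbit lying below d would have the residue of c mod d, hence be c itself.
   As q and m / d are coprime, q would then divide s + 1 < q. *)
rewrite /orbprod big1 ?mul1r // => s _; rewrite /base ifN //; apply/negP => sd.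
have sm : (d %| s.+1 * m)%N by rewrite dvdn_mull // dvdn_gcdl.
have ve : (c + s.+1 * m = c + 0 %[mod n])%N.
  rewrite addn0 [RHS]modn_small // -shiftp_val -[LHS](modn_small sd) shiftp_val.
  by rewrite modn_dvdm ?dvdn_gcdr // -modnDmr (eqP sm) addn0 modn_small.
move/eqP: ve; rewrite eqn_modDl mod0n => ns.
have : (q * d %| s.+1 * (m %/ d) * d)%N by rewrite -nE -mulnA -mE.
rewrite dvdn_pmul2r // Gauss_dvdl; last first.
  by rewrite coprime_sym /coprime /q -(eqn_pmul2r d0) mul1n muln_gcdl -mE -nE.
by move/dvdn_leq => /(_ isT); have := ltn_ord s; lia.
Qed.

Let cl (i : 'I_n) : 'I_d := Ordinal (ltn_pmod i d0).
Let X (c : 'I_d) : K := c.+2%:R.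
Let X_inj : injective X.
Proof. by move=> c c' /eqP; rewrite /X Num.Theory.eqr_nat => /eqP [] /val_inj. Qed.

Let F_period e f i : F (e + q * f) i = F e i * X (cl i) ^+ f.
Proof.
elim: f => [|f IH]; first by rewrite muln0 addn0 expr0 mulr1.
rewrite mulnS addnC -addnA [(q * f + e)%N]addnC /F orbprodD -/F orbprod_period.
by rewrite -[q in (q * m)%N]muln1 shift_qm IH exprS mulrCA.
Qed.

(** For e + 1 = q (f + 1) the shift is trivial, and F e i is the power f + 1 of the full orbit
    product divided by [base i]. For i < d these two numbers coincide, so F e i = X ^ f; each class
    contains a single i < d. *)
Lemma orbit_x_eq0 (a : 'I_n -> K) : (forall i : 'I_n, (d <= i)%N -> a i = 0) ->
  (forall e, \sum_i a i * (F e i * (i == i +~ (e.+1 * m))%:R) = 0) ->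
  forall i, a i = 0.
Proof.
move=> a_supp h; have : forall f, \sum_i X (cl i) ^+ f * a i = 0.
  move=> f; rewrite -[RHS](h (q * f.+1).-1); apply: eq_bigr => i _.
  have [/a_supp -> | id] := leqP d i; first by rewrite mul0r mulr0.
  rewrite mulrC prednK ?muln_gt0 ?q0 // shift_qm eqxx mulr1; congr (_ * _).
  have Xi : base i = X (cl i) by rewrite /base id /X /= modn_small.
  apply: (mulIf (base_neq0 i)).
  have := F_period 0 f.+1 i; rewrite add0n /F {2}/orbprod big_ord0 mul1r.
  rewrite -{1}(@prednK (q * f.+1)) ?muln_gt0 ?q0 // orbprodSr prednK ?muln_gt0 ?q0 //.
  by rewrite shift_qm Xi exprSr => ->.
move=> /(class_sum_eq0 X_inj) cs i.
have [/a_supp // | id] := leqP d i.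
rewrite -[RHS](cs (cl i)) (bigD1 i) //= big1 ?addr0 // => j /andP[/eqP clj ne].
apply: a_supp; rewrite leqNgt; apply: contra ne => jd.
move/(congr1 val): clj; rewrite /= !modn_small // => ji.
by apply/eqP/val_inj.
Qed.

(** Adding multiples of q to e separates the classes. Reindexing the class sum for e + 1 by the
    shift m gives the one for e weighted by [base]; in their difference the weight [base j - 1]
    survives only at the one j < d of the class. Thus b vanishes along the whole orbit of that j. *)
Lemma orbit_y_eq0 (b : 'I_n -> K) :
  (forall e, \sum_i F e i * b (i +~ (e.+1 * m)) = 0) -> forall i, b i = 0.
Proof.
move=> h; have cs e c : \sum_(i | cl i == c) F e i * b (i +~ (e.+1 * m)) = 0.
  move: c; apply: (class_sum_eq0 X_inj) => f.
  rewrite -[RHS](h (e + q * f)%N); apply: eq_bigr => i _.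
  rewrite F_period mulrCA mulrA; congr (_ * b _).
  by rewrite -addSn mulnDl -shiftpD shift_qm.
have cl_m i : cl (i +~ m) = cl i.
  apply: val_inj; rewrite /= shiftp_val modn_dvdm ?dvdn_gcdr //.
  by rewrite -modnDmr (eqP (dvdn_gcdl m n)) addn0.
have bd e (i : 'I_n) : (i < d)%N -> b (i +~ (e.+1 * m)) = 0.
  move=> id; have := cs e.+1 (cl i).
  have -> : \sum_(j | cl j == cl i) F e.+1 j * b (j +~ (e.+2 * m)) =
      \sum_(j | cl j == cl i) base j * (F e j * b (j +~ (e.+1 * m))).
    rewrite [RHS](reindex_inj (@shiftp_inj n m)); apply: eq_big => j; rewrite ?cl_m // => _.
    by rewrite /F orbprodS mulrA shiftpD -mulSn.
  move=> h1; have : \sum_(j | cl j == cl i) (base j - 1) * (F e j * b (j +~ (e.+1 * m))) = 0.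
    under eq_bigr do rewrite mulrBl mul1r.
    by rewrite sumrB h1 cs subr0.
  rewrite (bigD1 i) //= big1 ?addr0 => [/eqP|j /andP[/eqP clj ne]].
    rewrite !mulf_eq0 (negPf (orbprod_neq0 _ _ _ base_neq0)) /= => /orP[|/eqP //].
    by rewrite /base id -[i.+2]addn1 natrD addrK Num.Theory.pnatr_eq0.
  rewrite /base ifN ?subrr ?mul0r //; apply: contra ne => jd.
  move/(congr1 val): clj; rewrite /= !modn_small // => ji.
  by apply/eqP/val_inj.
have bm (i : 'I_n) : (i < d)%N -> forall e, b (i +~ (e * m)) = 0.
  move=> id [|e]; last exact: bd.
  by rewrite -(shift_qm i 1) shiftpD addn0 muln1 -(prednK q0); apply: bd.
pose v (i : 'I_n) := forall e, b (i +~ (e * m)) = 0.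
have vm i : v (i +~ m) = v i.
  apply: boolp.propext; split=> vi e.
    rewrite -(shift_qm i 1) shiftpD muln1 -mulnDl.
    by have := vi (q + e).-1; rewrite shiftpD -mulSn prednK // addn_gt0 q0.
  by rewrite shiftpD -mulSn; apply: vi.
move=> i; suff : v i by move=> /(_ 0%N).
have cn : (i %% d < n)%N by rewrite (leq_trans (ltn_pmod _ d0)).
rewrite (shift_gcd_mod m0 vm (j := Ordinal cn)) ?modn_mod //.
by apply: bm; rewrite /= ltn_pmod.
Qed.

End BasePoint.

(** * Directional derivatives and the Jacobian matrix at the base point *)

Section DirectionalDerivative.
Variables (R : realType) (N : nat) (v w : 'I_N -> R).

Definition dirder (p : {mpoly R[N]}) : R := \sum_a w a * p^`M(a).@[v].

Lemma dirder_is_additive : {morph dirder : p q / p - q}.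
Proof.
move=> p q; rewrite /dirder -sumrB; apply: eq_bigr => a _.
by rewrite mderivB mevalB mulrBr.
Qed.
HB.instance Definition _ := GRing.isZmodMorphism.Build _ _ dirder dirder_is_additive.

Lemma dirderM p q : dirder (p * q) = dirder p * q.@[v] + p.@[v] * dirder q.
Proof.
rewrite /dirder mulr_suml mulr_sumr -big_split; apply: eq_bigr => a _ /=.
by rewrite mderivM mevalD !mevalM; ring.
Qed.

Lemma dirder_X a : dirder 'X_a = w a.
Proof.
rewrite /dirder (bigD1 a) //= big1 ?addr0 => [|b ne].
  by rewrite mderivXU eqxx meval1 mulr1.
by rewrite mderivXU (negPf ne) meval0 mulr0.
Qed.

End DirectionalDerivative.

(** A right inverse [B] at the single point v serves as a constant matrix elsewhere: the rank stays
    full wherever the polynomial det (M B) does not vanish. *)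
Lemma generic_row_free (R : realType) (N m : nat) (M : 'M[{mpoly R[N]}]_(m, N)) v :
  row_free (map_mx (meval v) M) -> generically (fun v => row_free (map_mx (meval v) M)).
Proof.
move=> /row_freeP[B MB]; pose q := \det (M *m map_mx (@mpolyC N R) B).
have qE v' : q.@[v'] = \det (map_mx (meval v') M *m B).
  rewrite -[LHS]/(meval v' q) -det_map_mx map_mxM; congr (\det (_ *m _)).
  by rewrite -map_mx_comp; apply/matrixP => i j; rewrite mxE /= mevalC.
exists q => [|v'].
  apply/eqP => q0; have := qE v; rewrite q0 meval0 MB det1 => /esym/eqP.
  by rewrite oner_eq0.
rewrite qE -unitfE -[_ \is a _]/(_ \in unitmx) => u.
by apply/row_freeP; exists (B *m invmx (map_mx (meval v') M *m B)); rewrite mulmxA mulmxV.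
Qed.

Section Independence.
Variables (R : realType) (n k : nat).
Hypotheses (hk : (2 <= k)%N) (hkn : (k <= n)%N).
Local Notation Pol := {mpoly R[n + n]}.
Let m := k.-1.
Let d := gcdn m n.
Let q := (n %/ d)%N.

Let m0 : (0 < m)%N. Proof. by rewrite /m; lia. Qed.
Let n0 : (0 < n)%N. Proof. by lia. Qed.
Let d0 : (0 < d)%N. Proof. by rewrite gcdn_gt0 n0 orbT. Qed.
Let dn : (d <= n)%N. Proof. by rewrite dvdn_leq // dvdn_gcdr. Qed.
Let nE : n = (q * d)%N. Proof. by rewrite divnK // dvdn_gcdr. Qed.
Let mE : m = (m %/ d * d)%N. Proof. by rewrite divnK // dvdn_gcdl. Qed.
Let q0 : (0 < q)%N. Proof. by rewrite divn_gt0. Qed.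

(* The nonconstant coefficients of the spectral polynomial: lambda has the
   exponent i > 0, and the exponent [n j - m i] of t lies in (0, n], or is 0. *)
Definition selected (s : 'I_(n + d)) : nat * nat :=
  match split s with
  | inl i => (i.+1, (m * i.+1 %/ n).+1)
  | inr f => (q * f.+1, m %/ d * f.+1)%N
  end.

Definition base_point (a : 'I_(n + n)) : R :=
  match split a with inl i => base R m i | inr i => - base R m i end.

Let base_x i : (px R i).@[base_point] = base R m i.
Proof. by rewrite mevalXU /base_point (unsplitK (inl _ i)). Qed.

Let base_y i : (py R i).@[base_point] = - base R m i.
Proof. by rewrite mevalXU /base_point (unsplitK (inr _ i)). Qed.

Section Tangent.
Variable w : 'I_(n + n) -> R.
Local Notation dw := (dirder base_point w).
Let dwM : forall p p' : Pol, dw (p * p') = dw p * p'.@[base_point] + p.@[base_point] * dw p'.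
Proof. exact: dirderM. Qed.

(** The coefficients of l ^ 0 are those of det (1 - t S) and do not depend on the point. *)
Let dw0 c : dw (specLT R n k)`_0`_c = 0.
Proof.
have h := der_bivDet (f := meval base_point) (d := dirder base_point w) dwM m (@px R n) (@py R n).
have := congr1 (fun p : {poly {poly R}} => p`_0`_c) h.
by rewrite coefXM coef0 coef_map coef_map.
Qed.

Lemma dirder_specLT :
  (forall s, dw (I_ R k n (selected s).1 (selected s).2) = 0) ->
  forall i c, dw (specLT R n k)`_i`_c = 0.
Proof.
move=> ds i c; have [ic | ] := boolP ((n < i) || (n < c))%N.
  by rewrite specLT_eq0 // raddf0.
rewrite negb_or -!leqNgt => /andP[ni nc].
case: i ni => [|i] ni; first exact: dw0.
rewrite specLT_coef // -/m; case: ifP => [/dvdnP[j E] | _]; last by rewrite raddf0.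
rewrite E mulnK //.
suff Ij : dw (I_ R k n i.+1 j) = 0.
  by rewrite -signr_odd mulr_sign; case: ifP => _; rewrite ?raddfN /= Ij ?oppr0.
(* For exponent 0 of t, n divides m (i + 1), so q divides i + 1 because q and m / d are coprime.
   These are the d additional functions. *)
case: c nc E => [_ | c nc] E.
  have /dvdnP[f fE] : (q %| i.+1)%N.
    have : (q * d %| m %/ d * i.+1 * d)%N.
      by rewrite -nE mulnAC -mE; apply/dvdnP; exists j.
    rewrite dvdn_pmul2r // Gauss_dvdr // coprime_sym /coprime.
    by rewrite -(eqn_pmul2r d0) mul1n muln_gcdl -mE -nE.
  case: f fE => [//|f] fE.
  have fd : (f < d)%N by rewrite -ltnS -(ltn_pmul2r q0) -fE [X in (_ < X)%N]mulSn mulnC; lia.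
  have := ds (rshift n (Ordinal fd)); rewrite /selected (unsplitK (inr _ _)) /= mulnC -fE.
  suff -> : j = (m %/ d * f.+1)%N by [].
  by apply/eqP; rewrite -(eqn_pmul2r n0) -E fE [X in (X * _)%N == _]mE [X in _ == (_ * X)%N]nE; apply/eqP; lia.
(* Since n j - m (i + 1) lies in (0, n], j can only be the quotient plus one. *)
have := ds (lshift d (Ordinal ni)); rewrite /selected (unsplitK (inl _ _)) /=.
suff -> : j = (m * i.+1 %/ n).+1 by [].
case: j E => [|j] E; first by lia.
congr _.+1; have -> : (m * i.+1 = j * n + (n - c.+1))%N by lia.
by rewrite divnMDl // divn_small ?addn0 //; lia.
Qed.

Hypothesis w_supp : forall i : 'I_n, (d <= i)%N -> w (lshift n i) = 0.

Lemma tangent_eq0 :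
  (forall s, dw (I_ R k n (selected s).1 (selected s).2) = 0) -> forall a, w a = 0.
Proof.
move=> /dirder_specLT ds.
have db0 : map_poly (map_poly (dirder base_point w)) (bivDet m (@px R n) (@py R n)) = 0.
  by apply/polyP => i; apply/polyP => c; rewrite coef0 coef_map coef_map coef0; apply: ds.
have bx : meval base_point \o @px R n = base R m by apply: boolp.funext => i; exact: base_x.
have wx (i : 'I_n) : dirder base_point w (px R i) = w (lshift n i) by apply: dirder_X.
have wy (i : 'I_n) : dirder base_point w (py R i) = w (rshift n i) by apply: dirder_X.
have hx : forall i : 'I_n, (dirder base_point w \o @px R n) i = 0.
  apply: (orbit_x_eq0 m0 n0) => [i di|e]; first by rewrite /= wx w_supp.
  have := tangent_x (f := meval base_point) dwM db0 e.
  by rewrite bx trace_orbprod_x.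
have hy : forall i : 'I_n, (dirder base_point w \o @py R n) i = 0.
  apply: (orbit_y_eq0 m0 n0) => e.
  have hyx i : (meval base_point \o @py R n) i = - (meval base_point \o @px R n) i.
    by rewrite /= base_y base_x.
  have := tangent_y (f := meval base_point) dwM db0 hx hyx e.
  by rewrite bx trace_orbprod_y.
move=> a; case: (split_ordP a) => i ->; first by rewrite -wx; apply: hx.
by rewrite -wy; apply: hy.
Qed.

End Tangent.

Lemma selected_independent :
  functionally_independent (fun s => I_ R k n (selected s).1 (selected s).2).
Proof.
pose J : 'M[Pol]_(n + d, n + n) :=
  \matrix_(s, b) (I_ R k n (selected s).1 (selected s).2)^`M(b).
suff : row_free (map_mx (meval base_point) J).
  move=> /generic_row_free[p p0 hp]; exists p => // v /hp.
  by congr (row_free _); apply/matrixP => s b; rewrite !mxE.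
set J0 := map_mx _ J.
pose P : 'M[R]_(d, n) := \matrix_(f, i) (i == f :> nat)%:R.
(* The rows of [W] are the test directions: all the y-directions, then the first d x-directions.
   Invertibility of the Jacobian restricted to their span is exactly [tangent_eq0]. *)
pose W : 'M[R]_(n + d, n + n) := block_mx 0 1%:M P 0.
have PP : P *m P^T = 1%:M.
  apply/matrixP => f g; rewrite !mxE (bigD1 (widen_ord dn f)) //= big1 => [|i ne].
    by rewrite !mxE /= eqxx mul1r addr0.
  by rewrite !mxE -(inj_eq val_inj) /= in ne *; rewrite (negPf ne) mul0r.
suff : W *m J0^T \in unitmx.
  rewrite -unitmx_tr trmx_mul trmxK => u.
  by apply/row_freeP; exists (W^T *m invmx (J0 *m W^T)); rewrite mulmxA mulmxV.
rewrite -row_free_unit; apply: inj_row_free => v.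
rewrite mulmxA; set w := v *m W => wJ.
have wE : w = row_mx (rsubmx v *m P) (lsubmx v).
  rewrite /w -[in LHS](hsubmxK v) mul_row_block !mulmx0 mulmx1 add0r addr0.
  by [].
have w0 : forall a, w 0 a = 0.
  apply: tangent_eq0 => [i di|s].
    rewrite wE row_mxEl mxE big1 // => f _; rewrite [P f i]mxE.
    by case: (i =P f :> nat) => [E|_]; [have := ltn_ord f; lia | rewrite mulr0].
  have := congr1 (fun M : 'M_(1, n + d) => M 0 s) wJ; rewrite mxE [RHS]mxE => <-.
  by apply: eq_bigr => a _; rewrite !mxE.
have {}w0 : w = 0 by apply/rowP => a; rewrite w0 mxE.
have := wE; rewrite w0 -row_mx0 => /esym/eq_row_mx[vr vl].
rewrite -(hsubmxK v) vl -[rsubmx v]mulmx1 -PP mulmxA vr mul0mx.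
by rewrite row_mx0.
Qed.

End Independence.

Theorem theorem4p12 (R : realType) (k n : nat) (hk : (2 <= k)%N)
    (hkn : (k <= n)%N) :
  let d := gcdn (k - 1) n in
  let T := @T_ R k n in
  exists (br : ratfun R (n + n) -> ratfun R (n + n) -> ratfun R (n + n))
         (P : 'M[{mpoly R[n + n]}]_(n + n)),
    (poisson_bracket br /\ poisson_tensor br P) /\
    ((2 * k - 1 <= n)%N -> standard_bracket k br) /\
    bracket_invariant T br /\
    generic_rank P (2 * (n - d))%N /\
    (forall i j, rat_comp T (I_ R k n i j)%:F = (I_ R k n i j)%:F) /\
    (forall i j i' j', br (I_ R k n i j)%:F (I_ R k n i' j')%:F = 0) /\
    (exists ij : 'I_(n + d) -> nat * nat,
       functionally_independent
         (fun a => I_ R k n (ij a).1 (ij a).2)).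
Proof.
move=> d T; pose A := Jmx int n k.-1.
exists (@pbr R _ A), (Ptensor R n k).
split; [split|split; [|split; [|split; [|split; [|split]]]]].
- by apply: pbr_poisson; apply: trJmx; lia.
- exact: pbr_tensor.
- exact: pbr_standard.
- exact: T_bracket_invariant.
- exact: Ptensor_rank.
- exact: I_invariant.
- exact: I_involutive.
- rewrite /d subn1; exists (@selected n k); exact: selected_independent.
Qed.
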